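(* Let $G=SU(N)$ ($N\ge2$), let $q>0$, and let $\lambda\in P_+$ be either regular, or of the form $\lambda=m\omega_1$ with $m\in\mathbb N$. Then: (1) if $q\ge1$, then $\|(1-1\otimes P^h_{n\lambda})P^h_{\lambda,n\lambda}\|\to0$ and $\big\|f_{\lambda,n\lambda}\big((1-P^h_\lambda)\otimes P^h_{n\lambda}\big)\big\|\to0$ as $n\to+\infty$; (2) if $q\le1$, then $\|(1-1\otimes P^l_{n\lambda})P^l_{\lambda,n\lambda}\|\to0$ and $\big\|f_{\lambda,n\lambda}\big((1-P^l_\lambda)\otimes P^l_{n\lambda}\big)\big\|\to0$ as $n\to+\infty$. Moreover, for $q\ne1$ the convergences are exponentially fast: if $q>1$, there exist $C>0$ and $0<t<1$ such that $\|(1-1\otimes P^h_{n\lambda})P^h_{\lambda,n\lambda}\|\le Ct^n$ and $\big\|f_{\lambda,n\lambda}\big((1-P^h_\lambda)\otimes P^h_{n\lambda}\big)\big\|\le Ct^n$ for all $n$, and if $q<1$, there exist $C>0$ and $0<t<1$ such that $\|(1-1\otimes P^l_{n\lambda})P^l_{\lambda,n\lambda}\|\le Ct^n$ and $\big\|f_{\lambda,n\lambda}\big((1-P^l_\lambda)\otimes P^l_{n\lambda}\big)\big\|\le Ct^n$ for all $n$.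
   Context: Let $\mathfrak g=\mathfrak{sl}_N$ be the complexified Lie algebra of $G=SU(N)$, with the standard Cartan subalgebra $\mathfrak h$ and simple roots $\alpha_1,\dots,\alpha_{N-1}$, weight lattice $P$, dominant integral weights $P_+$, and fundamental weights $\omega_1,\dots,\omega_{N-1}$; $\omega_1$ is the highest weight of the standard representation on $\mathbb C^N$. The invariant form is normalized so that $(\alpha_i,\alpha_i)=2$; $a_{ij}=(\alpha_i,\alpha_j)$. A weight $\lambda\in P_+$ is regular if $\lambda(i)=(\lambda,\alpha_i)>0$ for all $i$. For $q>0$, $q\ne1$, $U_q\mathfrak g$ is the Hopf $*$-algebra with generators $E_i,F_i,K_i^{\pm1}$, $1\le i\le N-1$, such that the $K_i$ commute, $K_iE_jK_i^{-1}=q^{a_{ij}}E_j$, $K_iF_jK_i^{-1}=q^{-a_{ij}}F_j$, $E_iF_j-F_jE_i=\delta_{ij}(K_i-K_i^{-1})/(q-q^{-1})$, and the quantum Serre relations hold, with coproduct $\hat\Delta_q(K_i)=K_i\otimes K_i$, $\hat\Delta_q(E_i)=E_i\otimes1+K_i\otimes E_i$, $\hat\Delta_q(F_i)=F_i\otimes K_i^{-1}+1\otimes F_i$, and involution $K_i^*=K_i$, $E_i^*=F_iK_i$, $F_i^*=K_i^{-1}E_i$. For $q=1$, $U_1\mathfrak g=U\mathfrak g$ with its usual Hopf algebra structure and involution $E_i^*=F_i$ making the Lie algebra of $SU(N)$ skew-adjoint. A vector $v$ has weight $\mu\in P$ if $K_iv=q^{(\mu,\alpha_i)}v$ for all $i$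 (for $q=1$: $hv=\mu(h)v$ for $h\in\mathfrak h$). For $\mu\in P_+$, $V_\mu$ is the simple finite dimensional $U_q\mathfrak g$-module with highest weight $\mu$ (a direct sum of weight spaces), with a Hilbert space structure making the action a $*$-representation. Tensor products of modules are formed using $\hat\Delta_q$. For $\lambda,\mu\in P_+$: $P^h_{\lambda,\mu}$ (resp. $P^l_{\lambda,\mu}$) is the orthogonal projection of $V_\lambda\otimes V_\mu$ onto the subspace of vectors killed by all $E_i$ (resp. all $F_i$); $P^h_\mu$ (resp. $P^l_\mu$) is the orthogonal projection of $V_\mu$ onto the line of highest (resp. lowest) weight vectors; $f_{\lambda,\mu}$ is the orthogonal projection of $V_\lambda\otimes V_\mu$ onto its Cartan component, the unique submodule isomorphic to $V_{\lambda+\mu}$. Norms are operator norms. *)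

(* Defs.v *)
From mathcomp Require Import all_boot all_order all_algebra.
From mathcomp Require Import all_classical all_reals all_analysis.
From mathcomp Require Import complex mxtens.

Set Implicit Arguments.
Unset Strict Implicit.
Unset Printing Implicit Defensive.

Import Order.TTheory GRing.Theory Num.Theory.
Import numFieldNormedType.Exports.

Local Open Scope classical_set_scope.
Local Open Scope complex_scope.
Local Open Scope ring_scope.

(* Finite dimensional Hilbert spaces are taken in orthonormal coordinates:
   column vectors 'cV[R[i]]_d with the standard inner product, operators acting
   by left multiplication.  The Hilbert space tensor product is then the
   Kronecker product *t. *)

Section Hilbert.
Variable R : realType.
Local Notation C := R[i].

Definition adjoint (m n : nat) (A : 'M[C]_(m, n)) : 'M[C]_(n, m) :=
  (map_mx Num.conj A)^T.

Definition hnorm (d : nat) (v : 'cV[C]_d) : R :=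
  Num.sqrt (\sum_(k < d)
    (complex.Re (v k 0) ^+ 2 + complex.Im (v k 0) ^+ 2)).

Definition opnorm (m n : nat) (A : 'M[C]_(m, n)) : R :=
  sup [set hnorm (A *m v) | v in [set v : 'cV[C]_n | hnorm v <= 1]].

Definition is_orthoproj (d : nat) (W : set 'cV[C]_d) (P : 'M[C]_d) : Prop :=
  [/\ P *m P = P, adjoint P = P & range (fun v : 'cV[C]_d => P *m v) = W].

(* The orthogonal projection onto W; it is unique, and exists when W is a
   linear subspace (the default value 0 is used otherwise). *)
Definition orthoproj (d : nat) (W : set 'cV[C]_d) : 'M[C]_d :=
  xget 0 [set P | is_orthoproj W P].

End Hilbert.

(* mu : weight N is the integral weight with (mu, alpha_i) = mu i; the simple
   root alpha_{i+1} of sl_N is indexed by i = 0, ..., N-2. *)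
Notation weight N := {ffun 'I_N.-1 -> int}.

Definition dominant (N : nat) (mu : weight N) : Prop := forall i, 0 <= mu i.
Definition regular (N : nat) (mu : weight N) : Prop := forall i, 0 < mu i.

(* omega_1 is the fundamental weight of the first simple root, of index 0. *)
Definition omega1 (N : nat) : weight N :=
  [ffun i : 'I_N.-1 => ((i : nat) == 0%N)%:R].

Definition cartan (N : nat) (i j : 'I_N.-1) : int :=
  if i == j then 2
  else if ((i : nat) == j.+1) || ((j : nat) == i.+1) then -1 else 0.

(* The operators by which the generators of U_q sl_N act: E_i, F_i, and a third
   family T_i, standing for K_i when q != 1 (and then K_i^-1 acts by invmx T_i)
   and for the coroot H_i = [E_i, F_i] when q = 1. *)
Record genops (R : realType) (N : nat) := GenOps {
  dim : nat;
  opE : 'I_N.-1 -> 'M[R[i]]_dim;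
  opF : 'I_N.-1 -> 'M[R[i]]_dim;
  opT : 'I_N.-1 -> 'M[R[i]]_dim
}.

Section Modules.
Variables (R : realType) (N : nat).
Local Notation C := R[i].
Implicit Types (q : R) (V U W X : genops R N) (mu nu : weight N).

Definition quantum_relations q V : Prop :=
  let E := opE V in let F := opF V in let K := opT V in
  let z : C := q%:C in
  let serre (Y : 'I_N.-1 -> 'M[C]_(dim V)) (i j : 'I_N.-1) :=
    (cartan i j = 0 -> Y i *m Y j = Y j *m Y i) /\
    (cartan i j = -1 ->
       Y i *m Y i *m Y j - (z + z^-1) *: (Y i *m Y j *m Y i)
         + Y j *m Y i *m Y i = 0) in
  (forall i, K i \in unitmx) /\
  (forall i j,
    [/\ K i *m K j = K j *m K i,
        K i *m E j *m invmx (K i) = (z ^ cartan i j) *: E j,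
        K i *m F j *m invmx (K i) = (z ^ (- cartan i j)) *: F j,
        E i *m F j - F j *m E i =
          ((i == j)%:R / (z - z^-1)) *: (K i - invmx (K i))
      & serre E i j /\ serre F i j]).

Definition elem_mx (k l : nat) : 'M[C]_N :=
  \matrix_(a, b) (((a : nat) == k) && ((b : nat) == l))%:R.

(* rho is only relevant on sl_N, i.e. on traceless matrices. *)
Definition lie_representation (d : nat) (rho : 'M[C]_N -> 'M[C]_d) : Prop :=
  (forall (c : C) (x y : 'M[C]_N), \tr x = 0 -> \tr y = 0 ->
     rho (c *: x + y) = c *: rho x + rho y) /\
  (forall x y : 'M[C]_N, \tr x = 0 -> \tr y = 0 ->
     rho (x *m y - y *m x) = rho x *m rho y - rho y *m rho x).

Definition classical_relations V : Prop :=
  exists2 rho : 'M[C]_N -> 'M[C]_(dim V), lie_representation rho &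
    forall i : 'I_N.-1,
      [/\ opE V i = rho (elem_mx i i.+1),
          opF V i = rho (elem_mx i.+1 i)
        & opT V i = rho (elem_mx i i - elem_mx i.+1 i.+1)].

Definition is_module q V : Prop :=
  if q == 1 then classical_relations V else quantum_relations q V.

Definition is_star q V : Prop :=
  forall i, adjoint (opT V i) = opT V i /\
    if q == 1 then adjoint (opE V i) = opF V i /\ adjoint (opF V i) = opE V i
    else adjoint (opE V i) = opF V i *m opT V i /\
         adjoint (opF V i) = invmx (opT V i) *m opE V i.

Definition has_weight q V mu (v : 'cV[C]_(dim V)) : Prop :=
  forall i, opT V i *m v =
    (if q == 1 then (mu i)%:~R else (q%:C : C) ^ (mu i)) *: v.

(* Stability under K_i^-1 follows from stability under K_i, as W is finite
   dimensional. *)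
Definition submodule V (W : {vspace 'cV[C]_(dim V)}) : Prop :=
  forall i v, v \in W ->
    [/\ opE V i *m v \in W, opF V i *m v \in W & opT V i *m v \in W].

Definition simple_module V : Prop :=
  (0 < dim V)%N /\
  forall W : {vspace 'cV[C]_(dim V)}, submodule W -> W = 0%VS \/ W = fullv.

Definition killed_by_E V : set 'cV[C]_(dim V) :=
  [set v | forall i, opE V i *m v = 0].
Definition killed_by_F V : set 'cV[C]_(dim V) :=
  [set v | forall i, opF V i *m v = 0].

Definition spanned_by_weight_vectors q V : Prop :=
  forall W : {vspace 'cV[C]_(dim V)},
    (forall nu v, has_weight q nu v -> v \in W) -> W = fullv.

(* V is (a unitary model of) the simple module V_mu. *)
Definition is_Vmu q mu V : Prop :=
  [/\ is_module q V, is_star q V, simple_module V,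
      spanned_by_weight_vectors q V
    & exists v : 'cV[C]_(dim V),
        [/\ v != 0, has_weight q mu v & killed_by_E v]].

Definition tens q U W : genops R N :=
  @GenOps R N (dim U * dim W)
    (fun i => if q == 1 then opE U i *t 1%:M + 1%:M *t opE W i
              else opE U i *t 1%:M + opT U i *t opE W i)
    (fun i => if q == 1 then opF U i *t 1%:M + 1%:M *t opF W i
              else opF U i *t invmx (opT W i) + 1%:M *t opF W i)
    (fun i => if q == 1 then opT U i *t 1%:M + 1%:M *t opT W i
              else opT U i *t opT W i).

Definition Ph_tens q U W : 'M[C]_(dim U * dim W) :=
  orthoproj (@killed_by_E (tens q U W)).
Definition Pl_tens q U W : 'M[C]_(dim U * dim W) :=
  orthoproj (@killed_by_F (tens q U W)).

(* The lines of highest (lowest) weight vectors of V, including 0. *)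
Definition Ph q V : 'M[C]_(dim V) :=
  orthoproj [set v | (exists nu, has_weight q nu v) /\ killed_by_E v].
Definition Pl q V : 'M[C]_(dim V) :=
  orthoproj [set v | (exists nu, has_weight q nu v) /\ killed_by_F v].

Definition intertwiner X V (S : 'M[C]_(dim V, dim X)) : Prop :=
  forall i, [/\ S *m opE X i = opE V i *m S, S *m opF X i = opF V i *m S
              & S *m opT X i = opT V i *m S].

Definition submodule_iso X V (W : {vspace 'cV[C]_(dim V)}) : Prop :=
  submodule W /\
  exists S : 'M[C]_(dim V, dim X),
    [/\ intertwiner S, injective (fun v : 'cV[C]_(dim X) => S *m v)
      & range (fun v : 'cV[C]_(dim X) => S *m v) = [set` W]].

(* For X a model of V_{lambda + mu}, where U and W are models of V_lambda and
   V_mu: the orthogonal projection of U (x) W onto its unique submodule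
   isomorphic to X. *)
Definition cartan_proj q U W X : 'M[C]_(dim U * dim W) :=
  xget 0 [set P | exists2 Y : {vspace 'cV[C]_(dim (tens q U W))},
    submodule_iso X Y & is_orthoproj [set` Y] P].

End Modules.

(* Main.v *)
Require Import Defs.
From mathcomp Require Import all_boot all_order all_algebra.
From mathcomp Require Import all_classical all_reals all_analysis.
From mathcomp Require Import complex mxtens.
From mathcomp Require Import zify ring lra.

Import Order.TTheory GRing.Theory Num.Theory.
Import numFieldNormedType.Exports.

Set Implicit Arguments.
Unset Strict Implicit.
Unset Printing Implicit Defensive.

Local Open Scope classical_set_scope.
Local Open Scope complex_scope.
Local Open Scope ring_scope.

(* Let q >= 1.  The quantum Casimir element acts on V_mu by a scalar; evaluating
   its quadratic form on a vector y of weight nu expresses a positively weighted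
   sum of the ||E_ij y||^2, over the quantum root vectors E_ij, as the product of
   ||y||^2 and a difference of Casimir eigenvalues.  For mu = n lambda with lambda
   regular or a multiple of omega_1, and nu <> mu at bounded height below mu, that
   difference tends to infinity with n, exponentially fast when q > 1.  So any y
   orthogonal to the highest weight vector and supported near the top of the
   module is small as soon as the E_ij y stay bounded.

   If z in V_lambda (x) V_(n lambda) is killed by all E_i, the coproduct formula
   trades operators on the second leg of z for operators on the first leg, whose
   norms do not depend on n; this bounds the component of z orthogonal to the
   highest weight line of the second leg.  For the Cartan projection f, the vector
   f ((1 - P) (x) P) x comes from a vector of V_((n + 1) lambda) orthogonal to the
   highest weight vector; as f intertwines the actions and the second leg is
   killed by the E_i, root vectors act on it through the first leg only, and the
   same estimate applies.

   For q <= 1, the operators q^-1 E_(N-1-i)^* satisfy the relations of the E_i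
   with q replaced by its inverse, and exchange highest and lowest weights. *)

(** * Deciding identities between noncommutative polynomials in matrices *)

(** Working with [D_i = (K_i^2 - 1) / (q - q^-1)] and with the adjoint of [E_i] in place of [K_i]
    and [F_i] gives relations that survive at [q = 1], where [D_i] is the coroot; one argument then
    covers the classical and the quantum case. The Casimir element is a sum over positive roots plus
    a Cartan part, which is a scalar on each weight space. Only the root part is formalised, with
    coefficients depending on the weight; it acts by the difference of the Cartan values at [mu] and
    at the weight. The obstacle for [q > 1] is that this difference collects terms of very different
    exponential sizes, so a gain at one simple root could be swamped by losses at others. All terms
    are at most of the scale attached to the smallest simple root occurring in [mu - nu], so
    largeness of [mu] is needed exactly at that root. For regular [lambda] it always holds; for
    multiples of [omega_1] every weight below [mu] involves the first simple root. This asymmetry is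
    also why the Dynkin diagram is reversed in the passage to [q <= 1]. *)

Section NonCommutativePolynomials.
Variables (K : comNzRingType) (d : nat).

Inductive ncexpr :=
  | NCzero | NCone | NCatom of nat | NCadd of ncexpr & ncexpr | NCopp of ncexpr
  | NCscale of K & ncexpr | NCmul of ncexpr & ncexpr.

Fixpoint nclookup (env : seq 'M[K]_d) n : 'M[K]_d :=
  match env, n with
  | [::], _ => 0
  | x :: _, O => x
  | _ :: env, n.+1 => nclookup env n
  end.

Fixpoint ncdenote env (t : ncexpr) : 'M[K]_d :=
  match t with
  | NCzero => 0
  | NCone => 1%:M
  | NCatom n => nclookup env n
  | NCadd a b => ncdenote env a + ncdenote env b
  | NCopp a => - ncdenote env a
  | NCscale k a => k *: ncdenote env a
  | NCmul a b => ncdenote env a *m ncdenote env b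
  end.

(** This and the following functions are fixpoints of their own, so that [cbv] can unfold exactly
    them on a reified identity and leave the coefficients in [K] alone. *)
Fixpoint mono_eqb (a b : list nat) : bool :=
  match a, b with
  | [::], [::] => true
  | x :: a, y :: b => if Nat.eqb x y then mono_eqb a b else false
  | _, _ => false
  end.

Fixpoint mono_app (a b : list nat) :=
  match a with [::] => b | x :: a => x :: mono_app a b end.

Fixpoint lin_app (a b : list (list nat * K)) :=
  match a with [::] => b | x :: a => x :: lin_app a b end.

Fixpoint lin_scale k (a : list (list nat * K)) :=
  match a with [::] => [::] | (m, c) :: a => (m, k * c) :: lin_scale k a end.

Fixpoint lin_mulm m k (a : list (list nat * K)) :=
  match a with
  | [::] => [::] | (n, c) :: a => (mono_app m n, k * c) :: lin_mulm m k a
  end.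

Fixpoint lin_mul (a b : list (list nat * K)) :=
  match a with
  | [::] => [::] | (m, c) :: a => lin_app (lin_mulm m c b) (lin_mul a b)
  end.

Fixpoint ncnorm t : list (list nat * K) :=
  match t with
  | NCzero => [::]
  | NCone => [:: ([::], 1)]
  | NCatom n => [:: ([:: n], 1)]
  | NCadd a b => lin_app (ncnorm a) (ncnorm b)
  | NCopp a => lin_scale (-1) (ncnorm a)
  | NCscale k a => lin_scale k (ncnorm a)
  | NCmul a b => lin_mul (ncnorm a) (ncnorm b)
  end.

Fixpoint lin_coef m (a : list (list nat * K)) : K :=
  match a with
  | [::] => 0
  | (n, c) :: a => if mono_eqb m n then c + lin_coef m a else lin_coef m a
  end.

Fixpoint lin_del m (a : list (list nat * K)) :=
  match a with
  | [::] => [::]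
  | (n, c) :: a => if mono_eqb m n then lin_del m a else (n, c) :: lin_del m a
  end.

(** One equation in [K] for each distinct word: the terms carrying the word of the head are
    collected, then deleted. [fuel] is there because [lin_del] does not return a structural
    subterm. *)
Fixpoint lin_vanish fuel (a : list (list nat * K)) : Prop :=
  match fuel, a with
  | _, [::] => True
  | O, _ => False
  | S fuel, (m, c) :: a => c + lin_coef m a = 0 /\ lin_vanish fuel (lin_del m a)
  end.

Variable env : seq 'M[K]_d.

Fixpoint mono_denote (m : list nat) : 'M[K]_d :=
  match m with [::] => 1%:M | n :: m => nclookup env n *m mono_denote m end.

Fixpoint lin_denote (a : list (list nat * K)) : 'M[K]_d :=
  match a with [::] => 0 | (m, c) :: a => c *: mono_denote m + lin_denote a end.

Lemma mono_denote_app a b :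
  mono_denote (mono_app a b) = mono_denote a *m mono_denote b.
Proof. by elim: a => [|x a IH] /=; rewrite ?mul1mx ?IH ?mulmxA. Qed.

Lemma lin_denote_app a b : lin_denote (lin_app a b) = lin_denote a + lin_denote b.
Proof. by elim: a => [|[m c] a IH] /=; rewrite ?add0r ?IH ?addrA. Qed.

Lemma lin_denote_scale k a : lin_denote (lin_scale k a) = k *: lin_denote a.
Proof.
by elim: a => [|[m c] a IH] /=; rewrite ?scaler0 ?IH ?scalerDr ?scalerA.
Qed.

Lemma lin_denote_mul a b : lin_denote (lin_mul a b) = lin_denote a *m lin_denote b.
Proof.
elim: a => [|[m c] a IH] /=; first by rewrite mul0mx.
rewrite lin_denote_app IH mulmxDl; congr (_ + _).
elim: b {IH} => [|[n k] b IH] /=; first by rewrite mulmx0.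
have ZZ (A B : 'M[K]_d) : (c *: A) *m (k *: B) = (c * k) *: (A *m B).
  by rewrite -scalemxAl -scalemxAr scalerA.
by rewrite IH mulmxDr mono_denote_app ZZ.
Qed.

Lemma ncnormE t : ncdenote env t = lin_denote (ncnorm t).
Proof.
elim: t => [||n|a IHa b IHb|a IHa|k a IHa|a IHa b IHb] //=.
- by rewrite scale1r addr0.
- by rewrite scale1r addr0 mulmx1.
- by rewrite IHa IHb lin_denote_app.
- by rewrite IHa lin_denote_scale scaleN1r.
- by rewrite IHa lin_denote_scale.
- by rewrite IHa IHb lin_denote_mul.
Qed.

Lemma mono_eqbP a b : mono_eqb a b -> a = b.
Proof.
elim: a b => [|x a IH] [|y b] //=.
by case: (PeanoNat.Nat.eqb_spec x y) => // -> /IH ->.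
Qed.

Lemma lin_denote_del m a :
  lin_denote a = lin_coef m a *: mono_denote m + lin_denote (lin_del m a).
Proof.
elim: a => [|[n c] a IH] /=; first by rewrite scale0r addr0.
case: ifP => [/mono_eqbP <-|_]; first by rewrite scalerDl IH addrA.
by rewrite /= IH addrCA.
Qed.

Lemma lin_vanishP fuel a : lin_vanish fuel a -> lin_denote a = 0.
Proof.
elim: fuel a => [|fuel IH] [|[m c] a] //= [h /IH h'].
by rewrite (lin_denote_del m a) h' addr0 -scalerDl h scale0r.
Qed.

Lemma ncexpr_eq s t :
  (let n := ncnorm (NCadd s (NCopp t)) in lin_vanish (List.length n) n) ->
  ncdenote env s = ncdenote env t.
Proof.
move=> /lin_vanishP; rewrite -ncnormE /= => /eqP.
by rewrite subr_eq0 => /eqP.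
Qed.

End NonCommutativePolynomials.

Ltac nc_insert x env :=
  lazymatch env with
  | nil => constr:(x :: nil)
  | x :: _ => env
  | ?y :: ?l => let l' := nc_insert x l in constr:(y :: l')
  end.

Ltac nc_atoms t env :=
  lazymatch t with
  | ?a + ?b => let env := nc_atoms a env in nc_atoms b env
  | - ?a => nc_atoms a env
  | _ *: ?a => nc_atoms a env
  | ?a *m ?b => let env := nc_atoms a env in nc_atoms b env
  | 0 => env
  | 1%:M => env
  | _ => nc_insert t env
  end.

Ltac nc_index x env :=
  lazymatch env with
  | x :: _ => constr:(O)
  | _ :: ?l => let n := nc_index x l in constr:(S n)
  end.

Ltac nc_reify K t env :=
  lazymatch t with
  | ?a + ?b => let a := nc_reify K a env in let b := nc_reify K b env in
               constr:(@NCadd K a b)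
  | - ?a => let a := nc_reify K a env in constr:(@NCopp K a)
  | ?k *: ?a => let a := nc_reify K a env in constr:(@NCscale K k a)
  | ?a *m ?b => let a := nc_reify K a env in let b := nc_reify K b env in
                constr:(@NCmul K a b)
  | 0 => constr:(@NCzero K)
  | 1%:M => constr:(@NCone K)
  | _ => let n := nc_index t env in constr:(@NCatom K n)
  end.

(* Reduces an identity between matrix expressions over the ring K to identities
   between the coefficients of the words in the atoms. *)
Ltac nc_ring_over K :=
  lazymatch goal with
  | |- @eq ?T ?s ?t =>
    let env := nc_atoms s (@nil T) in let env := nc_atoms t env in
    let s' := nc_reify K s env in let t' := nc_reify K t env in
    refine (@ncexpr_eq K _ env s' t' _);
    cbv [ncnorm lin_app lin_scale lin_mul lin_mulm mono_app lin_vanish lin_coef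
         lin_del mono_eqb Nat.eqb List.length];
    repeat (split; [|]); try exact I
  end.

Ltac nc_ring :=
  lazymatch goal with
  | R : realType |- _ => nc_ring_over (R[i] : comNzRingType)
  end.

(** The scheme of the computations with generators: [z] is an explicit two-sided combination of
    relations already known to vanish, and [x - y = z] is then an identity of free noncommutative
    polynomials, left to [nc_ring]. *)
Lemma eq_of_cert (V : zmodType) (x y z : V) : z = 0 -> x - y = z -> x = y.
Proof. by move=> -> /eqP; rewrite subr_eq0 => /eqP. Qed.

Lemma eq_sub0 (V : zmodType) (x y : V) : x = y -> x - y = 0.
Proof. by move=> ->; rewrite subrr. Qed.

Ltac nc_zero := rewrite ?(mulmx0, mul0mx, scaler0, addr0, oppr0); try reflexivity.

(** * Adjoints, squared norms and orthogonal projections *)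

Section Hilbert.
Variable R : realType.
Local Notation C := R[i].

Lemma adjointE m n (A : 'M[C]_(m, n)) i j : adjoint A i j = (A j i)^*%C.
Proof. by rewrite !mxE. Qed.

Section Adjoint.
Variables m n : nat.
Implicit Types A B : 'M[C]_(m, n).

Lemma adjointK A : adjoint (adjoint A) = A.
Proof. by apply/matrixP => i j; rewrite !adjointE conjcK. Qed.

Lemma adjointD A B : adjoint (A + B) = adjoint A + adjoint B.
Proof. by apply/matrixP => i j; rewrite adjointE [(A + B) _ _]mxE [RHS]mxE !adjointE rmorphD. Qed.

Lemma adjointN A : adjoint (- A) = - adjoint A.
Proof. by apply/matrixP => i j; rewrite adjointE [(- A) _ _]mxE [RHS]mxE !adjointE rmorphN. Qed.

Lemma adjointB A B : adjoint (A - B) = adjoint A - adjoint B.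
Proof. by rewrite adjointD adjointN. Qed.

Lemma adjointZ c A : adjoint (c *: A) = c^*%C *: adjoint A.
Proof. by apply/matrixP => i j; rewrite adjointE [(c *: A) _ _]mxE [RHS]mxE !adjointE rmorphM. Qed.

Lemma adjoint0 : adjoint (0 : 'M[C]_(m, n)) = 0.
Proof. by apply/matrixP => i j; rewrite adjointE !mxE rmorph0. Qed.

End Adjoint.

Lemma adjointM m n p (A : 'M[C]_(m, n)) (B : 'M[C]_(n, p)) :
  adjoint (A *m B) = adjoint B *m adjoint A.
Proof.
apply/matrixP => i j; rewrite adjointE !mxE rmorph_sum.
by apply: eq_bigr => k _; rewrite !adjointE rmorphM mulrC.
Qed.

Lemma adjoint1 n : adjoint (1%:M : 'M[C]_n) = 1%:M.
Proof.
by apply/matrixP => i j; rewrite adjointE !mxE eq_sym; case: eqP => _;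
  rewrite ?rmorph1 ?rmorph0.
Qed.

Lemma adjoint_tens m n p q (A : 'M[C]_(m, n)) (B : 'M[C]_(p, q)) :
  adjoint (A *t B) = adjoint A *t adjoint B.
Proof. by rewrite /adjoint map_mxT trmx_tens. Qed.

Section Norm.
Variable d : nat.
Implicit Types u v w : 'cV[C]_d.

Definition sqnorm v : R :=
  \sum_(k < d) (complex.Re (v k 0) ^+ 2 + complex.Im (v k 0) ^+ 2).

Definition dot u v : C := (adjoint u *m v) 0 0.

Lemma dotE u v : dot u v = \sum_k (u k 0)^*%C * v k 0.
Proof. by rewrite /dot mxE; apply: eq_bigr => k _; rewrite adjointE. Qed.

Lemma dot_sqnorm v : dot v v = (sqnorm v)%:C.
Proof.
rewrite dotE /sqnorm rmorph_sum; apply: eq_bigr => k _ /=.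
by rewrite add_Re2_Im2 sqr_normc mulrC.
Qed.

Lemma dotDl u v w : dot (u + v) w = dot u w + dot v w.
Proof. by rewrite /dot adjointD mulmxDl mxE. Qed.

Lemma dotDr u v w : dot u (v + w) = dot u v + dot u w.
Proof. by rewrite /dot mulmxDr mxE. Qed.

Lemma dotZl c u v : dot (c *: u) v = c^*%C * dot u v.
Proof. by rewrite /dot adjointZ -scalemxAl mxE. Qed.

Lemma dotZr c u v : dot u (c *: v) = c * dot u v.
Proof. by rewrite /dot -scalemxAr mxE. Qed.

Lemma dot0l v : dot 0 v = 0.
Proof. by rewrite /dot adjoint0 mul0mx mxE. Qed.

Lemma dot0r v : dot v 0 = 0.
Proof. by rewrite /dot mulmx0 mxE. Qed.

Lemma dotC u v : dot u v = (dot v u)^*%C.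
Proof.
rewrite !dotE rmorph_sum; apply: eq_bigr => k _.
by rewrite rmorphM /= conjcK mulrC.
Qed.

Lemma dot_eq0C u v : dot u v = 0 -> dot v u = 0.
Proof. by move=> h; rewrite dotC h rmorph0. Qed.

Lemma sqnorm_ge0 v : 0 <= sqnorm v.
Proof. by apply: sumr_ge0 => k _; rewrite addr_ge0 ?sqr_ge0. Qed.

Lemma sqnorm_eq0 v : sqnorm v = 0 -> v = 0.
Proof.
move=> h; apply/matrixP => k j; rewrite ord1 mxE.
have /eqP := h; rewrite /sqnorm psumr_eq0; last first.
  by move=> i _; rewrite addr_ge0 ?sqr_ge0.
move=> /allP/(_ k (mem_index_enum _))/=.
rewrite paddr_eq0 ?sqr_ge0 // !sqrf_eq0 => /andP[/eqP a /eqP b].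
by apply/eqP; rewrite eq_complex a b !eqxx.
Qed.

Lemma sqnorm0 : sqnorm 0 = 0.
Proof. by apply: complexI; rewrite -dot_sqnorm dot0l. Qed.

Lemma sqnorm_gt0 v : v != 0 -> 0 < sqnorm v.
Proof.
move=> v0; rewrite lt_neqAle sqnorm_ge0 andbT eq_sym.
by apply: contra_neqN v0 => /eqP/sqnorm_eq0.
Qed.

Lemma dot_self_neq0 v : v != 0 -> dot v v != 0.
Proof.
move=> /sqnorm_gt0 h; rewrite dot_sqnorm; apply/eqP => e.
by have := h; rewrite (complexI e) ltxx.
Qed.

Lemma sqnormZ c v :
  sqnorm (c *: v) = (complex.Re c ^+ 2 + complex.Im c ^+ 2) * sqnorm v.
Proof.
apply: complexI; rewrite -dot_sqnorm dotZl dotZr mulrA rmorphM /= -dot_sqnorm.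
by rewrite add_Re2_Im2 sqr_normc [_ * c]mulrC.
Qed.

Lemma sqnormD_orth u v : dot u v = 0 -> sqnorm (u + v) = sqnorm u + sqnorm v.
Proof.
move=> h; apply: complexI; rewrite rmorphD /= -!dot_sqnorm dotDl !dotDr.
by rewrite h (dot_eq0C h) addr0 add0r.
Qed.

Lemma dot_sumr (I : Type) (s : seq I) (P : pred I) (F : I -> 'cV[C]_d) u :
  dot u (\sum_(i <- s | P i) F i) = \sum_(i <- s | P i) dot u (F i).
Proof. by elim/big_rec2: _ => [|i x y _ <-]; rewrite ?dot0r ?dotDr. Qed.

Lemma sqnorm_sum_orth (I : eqType) (s : seq I) (F : I -> 'cV[C]_d) : uniq s ->
  (forall i j, i \in s -> j \in s -> i != j -> dot (F i) (F j) = 0) ->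
  sqnorm (\sum_(i <- s) F i) = \sum_(i <- s) sqnorm (F i).
Proof.
elim: s => [|a s IH] /=; first by rewrite !big_nil sqnorm0.
move=> /andP[as_ us] h; rewrite !big_cons sqnormD_orth ?IH //.
  by move=> i j i_s j_s; apply: h; rewrite inE ?i_s ?j_s orbT.
rewrite dot_sumr big_seq big1 // => j js; apply: h; rewrite ?inE ?eqxx ?js ?orbT//.
by apply: contraNneq as_ => ->.
Qed.

Lemma sqnorm_add_le u v : sqnorm (u + v) <= 2 * (sqnorm u + sqnorm v).
Proof.
have -> : 2 * (sqnorm u + sqnorm v) = sqnorm (u + v) + sqnorm (u - v).
  apply: complexI; rewrite rmorphM rmorph_nat !rmorphD /= -!dot_sqnorm.
  rewrite -scaleN1r !(dotDl, dotDr, dotZl, dotZr) rmorphN1; ring.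
by rewrite lerDl sqnorm_ge0.
Qed.

End Norm.

Lemma hnormE d (v : 'cV[C]_d) : hnorm v = Num.sqrt (sqnorm v).
Proof. by []. Qed.

Lemma dot_adjointl m n (A : 'M[C]_(m, n)) (u : 'cV[C]_n) (v : 'cV[C]_m) :
  dot (A *m u) v = dot u (adjoint A *m v).
Proof. by rewrite /dot adjointM mulmxA. Qed.

Lemma dot_adjointr m n (A : 'M[C]_(m, n)) (u : 'cV[C]_m) (v : 'cV[C]_n) :
  dot u (A *m v) = dot (adjoint A *m u) v.
Proof. by rewrite dot_adjointl adjointK. Qed.

Lemma sqnorm_sum_le d (I : Type) (s : seq I) :
  exists2 k : R, 0 <= k & forall F : I -> 'cV[C]_d,
    sqnorm (\sum_(i <- s) F i) <= k * \sum_(i <- s) sqnorm (F i).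
Proof.
elim: s => [|a s [k k0 IH]].
  by exists 0 => // F; rewrite !big_nil sqnorm0 mulr0.
exists (2 * (1 + k)) => [|F]; first by rewrite mulr_ge0 // addr_ge0.
rewrite !big_cons; apply: (le_trans (sqnorm_add_le _ _)).
have := IH F; have := sqnorm_ge0 (F a).
have : 0 <= \sum_(i <- s) sqnorm (F i) by apply: sumr_ge0 => i _; exact: sqnorm_ge0.
nra.
Qed.

Lemma sqnorm_mulmx_le m n (A : 'M[C]_(m, n)) :
  exists2 k : R, 0 <= k & forall v, sqnorm (A *m v) <= k * sqnorm v.
Proof.
have [k k0 hk] := sqnorm_sum_le m (index_enum 'I_n).
exists (k * \sum_i sqnorm (col i A)) => [|v].
  by rewrite mulr_ge0 // sumr_ge0 // => i _; exact: sqnorm_ge0.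
have -> : A *m v = \sum_i v i 0 *: col i A.
  apply/matrixP => a b; rewrite ord1 summxE mxE; apply: eq_bigr => i _.
  by rewrite !mxE mulrC.
apply: (le_trans (hk _)); rewrite -mulrA ler_wpM2l // mulr_suml ler_sum // => i _.
rewrite sqnormZ mulrC ler_wpM2l ?sqnorm_ge0 //.
rewrite /sqnorm (bigD1 i) //= lerDl sumr_ge0 // => j _.
by rewrite addr_ge0 ?sqr_ge0.
Qed.

Lemma opnorm_ge0 m n (A : 'M[C]_(m, n)) : 0 <= opnorm A.
Proof.
rewrite /opnorm; set S := [set _ | _ in _].
have S0 : S 0.
  by exists 0 => /=; rewrite hnormE ?mulmx0 sqnorm0 sqrtr0 // ler01.
(* Without a supremum, [sup] takes the default value 0. *)
have [hS|/sup_out -> //] := pselect (has_sup S).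
by apply: ub_le_sup => //; case: hS.
Qed.

Lemma opnorm_le m n (A : 'M[C]_(m, n)) (k : R) : 0 <= k ->
  (forall v, sqnorm (A *m v) <= k * sqnorm v) -> opnorm A <= Num.sqrt k.
Proof.
move=> k0 h; apply: ge_sup.
  by exists 0, 0 => /=; rewrite ?hnormE ?mulmx0 sqnorm0 sqrtr0 // ler01.
move=> _ [v /= v1 <-]; rewrite hnormE; apply: ler_wsqrtr.
apply: (le_trans (h v)); rewrite -[leRHS]mulr1 ler_wpM2l //.
by move: v1; rewrite hnormE -[leRHS]sqrtr1 ler_sqrt ?ler01.
Qed.

(** With the default value 0 the operator to be estimated vanishes, so either case can be fed to the
    norm bounds. *)
Lemma orthoproj_cases d (W : set 'cV[C]_d) :
  orthoproj W = 0 \/ is_orthoproj W (orthoproj W).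
Proof. by rewrite /orthoproj; case: xgetP => [P _ h|_]; [right | left]. Qed.

Lemma orthoprojP d (W : set 'cV[C]_d) P :
  is_orthoproj W P -> is_orthoproj W (orthoproj W).
Proof. by move=> h; apply: (@xgetPex _ 0 [set P | is_orthoproj W P]); exists P. Qed.

Section OrthoprojTheory.
Variables (d : nat) (W : set 'cV[C]_d) (P : 'M[C]_d).
Hypothesis hP : is_orthoproj W P.

Lemma orthoproj_in x : W (P *m x).
Proof. by case: hP => _ _ <-; exists x. Qed.

Lemma orthoproj_id x : W x -> P *m x = x.
Proof. by case: hP => h1 _ <- [y _ <-]; rewrite mulmxA h1. Qed.

Lemma orthoproj_adj : adjoint P = P. Proof. by case: hP. Qed.

Lemma sqnorm_orthoproj_le x : sqnorm (P *m x) <= sqnorm x.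
Proof.
have -> : sqnorm x = sqnorm (P *m x) + sqnorm (x - P *m x).
  rewrite -sqnormD_orth; first by congr sqnorm; rewrite addrC subrK.
  case: hP => h1 h2 _.
  by rewrite dot_adjointl h2 mulmxBr mulmxA h1 subrr dot0r.
by rewrite lerDl sqnorm_ge0.
Qed.

End OrthoprojTheory.

Definition line_proj d (x : 'cV[C]_d) : 'M[C]_d :=
  (dot x x)^-1 *: (x *m adjoint x).

Lemma line_projE d (x v : 'cV[C]_d) :
  line_proj x *m v = (dot x v / dot x x) *: x.
Proof.
rewrite /line_proj -scalemxAl -mulmxA [adjoint x *m v]mx11_scalar.
by rewrite -/(dot x v) mul_mx_scalar scalerA mulrC.
Qed.

Lemma is_orthoproj_line d (x : 'cV[C]_d) : x != 0 ->
  is_orthoproj [set v | exists c, v = c *: x] (line_proj x).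
Proof.
move=> x0; have hx := dot_self_neq0 x0; split.
- have hM : x *m adjoint x *m (x *m adjoint x) = dot x x *: (x *m adjoint x).
    rewrite mulmxA -(mulmxA x) [adjoint x *m x]mx11_scalar -/(dot x x).
    by rewrite mul_mx_scalar -scalemxAl.
  by rewrite /line_proj -scalemxAl -scalemxAr hM !scalerA divfK.
- rewrite /line_proj adjointZ adjointM adjointK dot_sqnorm.
  by rewrite conjc_inv conjc_real.
- apply/seteqP; split => v /=.
    by move=> [y _ <-]; rewrite line_projE; eexists.
  by move=> [c ->]; exists (c *: x) => //; rewrite line_projE dotZr mulfK.
Qed.

End Hilbert.

(** * Chevalley relations and quantum root vectors *)

Definition neighbors (i j : nat) := (j == i.+1) || (i == j.+1).
Definition apart (i j : nat) := (i.+1 < j)%N || (j.+1 < i)%N.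

(* The relations of U_q sl_{r+1} between the operators e_i, their Hilbert space
   adjoints e_i^* = F_i K_i, and D_i = (K_i^2 - 1) / (p - p^-1), with p = q.  At
   p = 1 one has D_i = H_i, and these are the relations of sl_{r+1}. *)
Record chevalley (R : realType) (d : nat) (p : R[i]) (r : nat)
    (e D : nat -> 'M[R[i]]_d) : Prop := Chevalley {
  chev_p0 : p != 0;
  chev_pJ : p^*%C = p;
  chev_p2 : p ^+ 2 + 1 != 0;
  chev_DJ : forall i, (i < r)%N -> adjoint (D i) = D i;
  chev_self : forall i, (i < r)%N ->
    e i *m adjoint (e i) = p ^- 2 *: (adjoint (e i) *m e i) + D i;
  chev_adj : forall i j, (i < r)%N -> (j < r)%N -> neighbors i j ->
    e i *m adjoint (e j) = p *: (adjoint (e j) *m e i);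
  chev_apart : forall i j, (i < r)%N -> (j < r)%N -> apart i j ->
    e i *m adjoint (e j) = adjoint (e j) *m e i;
  chev_Dself : forall i, (i < r)%N ->
    D i *m e i = p ^+ 4 *: (e i *m D i) + (p ^+ 3 + p) *: e i;
  chev_Dadj : forall i j, (i < r)%N -> (j < r)%N -> neighbors i j ->
    D i *m e j = p ^- 2 *: (e j *m D i) - p^-1 *: e j;
  chev_Dapart : forall i j, (i < r)%N -> (j < r)%N -> apart i j ->
    D i *m e j = e j *m D i;
  chev_serre : forall i j, (i < r)%N -> (j < r)%N -> neighbors i j ->
    e i *m e i *m e j - (p + p^-1) *: (e i *m e j *m e i)
      + e j *m e i *m e i = 0;
  chev_ecomm : forall i j, (i < r)%N -> (j < r)%N -> apart i j ->
    e i *m e j = e j *m e i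
}.

Section RootVectors.
Variables (R : realType) (d : nat).
Local Notation C := R[i].
Variable p : C.

(** The quantum root vector of the root [alpha_i + ... + alpha_(i+m)]. At [p = 1] the bracket is a
    commutator, and in the standard representation the result is the matrix unit in row [i] and
    column [i + m + 1]. *)
Fixpoint rootvec (e : nat -> 'M[C]_d) (i m : nat) : 'M[C]_d :=
  if m is m'.+1 then
    rootvec e i m' *m e (i + m)%N - p^-1 *: (e (i + m)%N *m rootvec e i m')
  else e i.

Lemma rootvecS e i m : rootvec e i m.+1 =
  rootvec e i m *m e (i + m.+1)%N - p^-1 *: (e (i + m.+1)%N *m rootvec e i m).
Proof. by []. Qed.

Definition qcomm (a : C) (A B : 'M[C]_d) := A *m B = a *: (B *m A).

Lemma qcommM a b A B X : qcomm a A X -> qcomm b B X -> qcomm (a * b) (A *m B) X.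
Proof.
rewrite /qcomm => hA hB.
by rewrite -mulmxA hB -scalemxAr !mulmxA hA -scalemxAl scalerA [b * a]mulrC.
Qed.

Lemma qcomm_bracket a b c A B X : qcomm a A X -> qcomm b B X ->
  qcomm (a * b) (A *m B - c *: (B *m A)) X.
Proof.
move=> hA hB; have hAB := qcommM hA hB; have hBA := qcommM hB hA.
rewrite /qcomm mulmxBl -scalemxAl hAB hBA mulmxBr -scalemxAr scalerBr.
by rewrite !scalerA [b * a]mulrC [c * _]mulrC.
Qed.

Variables (r : nat) (e D : nat -> 'M[C]_d).
Hypothesis H : chevalley p r e D.
Local Notation f k := (adjoint (e k)).
Local Notation E := (rootvec e).
Let p0 : p != 0 := chev_p0 H.

Lemma qcomm1 A B : qcomm 1 A B <-> A *m B = B *m A.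
Proof. by rewrite /qcomm scale1r. Qed.

Lemma rootvec_e_apart i m k : (i + m < r)%N -> (k < r)%N ->
  (k.+1 < i)%N || (i + m.+1 < k)%N -> E i m *m e k = e k *m E i m.
Proof.
move=> im kr h; apply/qcomm1; elim: m im h => [|m IH] im h /=.
  apply/qcomm1/(chev_ecomm H); rewrite /apart; lia.
rewrite -[1]mulr1; apply: qcomm_bracket; first by apply: IH; lia.
apply/qcomm1/(chev_ecomm H); rewrite /apart; lia.
Qed.

Lemma rootvec_f_apart i m k : (i + m < r)%N -> (k < r)%N ->
  (k.+1 < i)%N || (i + m.+1 < k)%N -> E i m *m f k = f k *m E i m.
Proof.
move=> im kr h; apply/qcomm1; elim: m im h => [|m IH] im h /=.
  apply/qcomm1/(chev_apart H); rewrite /apart; lia.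
rewrite -[1]mulr1; apply: qcomm_bracket; first by apply: IH; lia.
apply/qcomm1/(chev_apart H); rewrite /apart; lia.
Qed.

Lemma rootvec_f_left i m : (i.+1 + m < r)%N ->
  E i.+1 m *m f i = p *: (f i *m E i.+1 m).
Proof.
move=> im; rewrite -/(qcomm p _ _); elim: m im => [|m IH] im /=.
  apply: (chev_adj H); rewrite /neighbors; lia.
rewrite -[p]mulr1; apply: qcomm_bracket; first by apply: IH; lia.
apply/qcomm1/(chev_apart H); rewrite /apart; lia.
Qed.

Lemma rootvec_f_right i m : (i + m.+1 < r)%N ->
  E i m *m f (i + m.+1) = p *: (f (i + m.+1) *m E i m).
Proof.
move=> im; rewrite -/(qcomm p _ _); case: m im => [|m] im /=.
  apply: (chev_adj H); rewrite /neighbors; lia.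
rewrite -[p]mul1r; apply: qcomm_bracket.
  by apply/qcomm1/rootvec_f_apart; lia.
apply: (chev_adj H); rewrite /neighbors; lia.
Qed.

(** The iterated bracket can be opened at its first letter as well as at its last, since the two end
    letters of a longer root commute. This gives access to the left end in the relations with
    [f i]. *)
Lemma rootvec_left i m : (i.+1 + m < r)%N ->
  E i m.+1 = e i *m E i.+1 m - p^-1 *: (E i.+1 m *m e i).
Proof.
elim: m => [|m IH] im; first by rewrite /= addn1.
have {}IH := IH ltac:(lia).
rewrite [LHS]/= -/(rootvec _ _ m.+1) IH /= !addSnnS.
have cm : e i *m e (i + m.+2) - e (i + m.+2) *m e i = 0.
  by apply/eq_sub0/(chev_ecomm H); rewrite /apart; lia.
move: cm; move: (E i.+1 m) (e (i + m.+2)%N) (e i) => x y z cm.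
apply: (@eq_of_cert _ _ _ (- (p^-1) *: (x *m (z *m y - y *m z))
          + p^-1 *: ((z *m y - y *m z) *m x))); first by rewrite cm; nc_zero.
by nc_ring; field.
Qed.

(** The Serre relation of two adjacent generators, bracketed with a shorter root vector that
    commutes with [y], is again a Serre relation. *)
Lemma rootvec_serre i m : (i + m.+1 < r)%N -> let x := E i m in
  let y := e (i + m.+1)%N in
  x *m y *m y - (p + p^-1) *: (y *m x *m y) + y *m y *m x = 0.
Proof.
case: m => [|m] im /=.
  have := chev_serre H (i := (i + 1)%N) (j := i) im ltac:(lia).
  rewrite /neighbors addn1 eqxx orbT => /(_ isT) h.
  by rewrite -[RHS]h; nc_ring; field.
have h := chev_serre H (i := (i + m.+2)%N) (j := (i + m.+1)%N) im ltac:(lia).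
have {}h := h ltac:(rewrite /neighbors; lia).
have cm : E i m *m e (i + m.+2)%N - e (i + m.+2)%N *m E i m = 0.
  by apply/eq_sub0/rootvec_e_apart; lia.
move: h cm; move: (E i m) (e (i + m.+2)%N) (e (i + m.+1)%N) => x z y h cm.
set c := x *m z - z *m x in cm.
set s := _ + _ in h.
apply: (@eq_of_cert _ _ _ (x *m s - p^-1 *: (s *m x)
   - p^-1 *: (y *m c *m z + y *m z *m c) + (p + p^-1) *: (c *m y *m z)
   + (p^-1 * (p + p^-1)) *: (z *m y *m c) - c *m z *m y - z *m c *m y)).
  by rewrite h cm; nc_zero.
by rewrite /c /s; nc_ring; field.
Qed.

Lemma rootvec_e_last i m : (i + m.+1 < r)%N ->
  E i m.+1 *m e (i + m.+1) = p *: (e (i + m.+1) *m E i m.+1).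
Proof.
move=> im; have h := rootvec_serre im; move: h => /=.
move: (E i m) (e (i + m.+1)%N) => x y; set s := _ + _ => h.
apply: (@eq_of_cert _ _ _ s) => //; rewrite /s; nc_ring; by field.
Qed.

Lemma rootvec_e_first i m : (i + m.+1 < r)%N ->
  E i m.+1 *m e i = p^-1 *: (e i *m E i m.+1).
Proof.
elim: m => [|m IH] im.
  have := chev_serre H (i := i) (j := i.+1) ltac:(lia) ltac:(lia).
  rewrite /neighbors eqxx => /(_ isT) /= h; rewrite addn1.
  move: h; move: (e i) (e i.+1) => x y; set s := _ + _ => h.
  apply: (@eq_of_cert _ _ _ (- p^-1 *: s)); first by rewrite h; nc_zero.
  by rewrite /s; nc_ring; field.
rewrite -/(qcomm _ _ _) -[X in qcomm X]mulr1.
apply: (@qcomm_bracket p^-1 1 p^-1 (E i m.+1)); first by apply: IH; lia.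
by apply/qcomm1/(chev_ecomm H); rewrite /apart; lia.
Qed.

Lemma rootvec_e_penultimate i m : (i + m.+2 < r)%N ->
  E i m.+2 *m e (i + m.+1) = e (i + m.+1) *m E i m.+2.
Proof.
move=> im.
have h1 := eq_sub0 (rootvec_e_last (i := i) (m := m) ltac:(lia)).
have h2 : (e (i + m.+1) *m e (i + m.+2) - p^-1 *: (e (i + m.+2) *m e (i + m.+1)))
    *m e (i + m.+1) - p^-1 *: (e (i + m.+1) *m
  (e (i + m.+1) *m e (i + m.+2) - p^-1 *: (e (i + m.+2) *m e (i + m.+1)))) = 0.
  have := rootvec_e_first (i := (i + m.+1)%N) (m := 0); rewrite /= addn1 -addnS.
  by move=> /(_ im)/eq_sub0.
have c0 : E i m *m e (i + m.+2) - e (i + m.+2) *m E i m = 0.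
  by apply/eq_sub0/rootvec_e_apart; lia.
move: h1 h2 c0 => /=.
move: (E i m) (e (i + m.+1)%N) (e (i + m.+2)%N) => X y z.
set h1 := (X in X = 0 -> _) => e1; set h2 := (X in X = 0 -> _) => e2.
set c0 := (X in X = 0 -> _) => e3; have pp : p + p^-1 != 0.
  apply: contra_neq (chev_p2 H) => pp.
  by rewrite expr2 -(mulfV p0) -mulrDr pp mulr0.
(* The certificate reaches the commutator only up to the factor [p + p^-1], whence the field
   [chev_p2]. *)
set lhs := LHS; set rhs := RHS; suff: (p + p^-1) *: (lhs - rhs) = 0.
  move/eqP; rewrite scaler_eq0 (negbTE pp) /= subr_eq0 => /eqP //.
set cc := p^-1 *: (c0 *m y) - p^-1 *: (y *m c0).
apply: (@eq_of_cert _ _ _ (- (p *: (- p^-1 *: (h1 *m z) + p^- 3 *: (z *m h1))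
  + p^-1 *: (h2 *m X - p ^+ 2 *: (X *m h2) + y *m cc - p ^+ 2 *: (cc *m y))))).
  by rewrite /cc e1 e2 e3; nc_zero; rewrite ?subr0 ?oppr0 //; nc_zero.
by rewrite /cc /lhs /rhs /h1 /h2 /c0; nc_ring; field.
Qed.

Lemma rootvec_e_interior i m k : (i + m < r)%N -> (i < k < i + m)%N ->
  E i m *m e k = e k *m E i m.
Proof.
elim: m k => [|m IH] k im hk; first by lia.
have [km|km] := ltnP k (i + m).
  apply/qcomm1; rewrite [E i m.+1]/= -[1]mulr1; apply: qcomm_bracket.
    by apply/qcomm1/IH; lia.
  by apply/qcomm1/(chev_ecomm H); rewrite /apart; lia.
have ek : k = (i + m)%N by lia.
case: m im hk km ek {IH} => [|m] im hk km ->; first by lia.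
exact: rootvec_e_penultimate.
Qed.

Lemma rootvec_D_apart i m k : (i + m < r)%N -> (k < r)%N ->
  (k.+1 < i)%N || (i + m.+1 < k)%N -> D k *m E i m = E i m *m D k.
Proof.
move=> im kr h; apply/esym/qcomm1; elim: m im h => [|m IH] im h /=.
  apply/qcomm1/esym/(chev_Dapart H); rewrite /apart; lia.
rewrite -[1]mulr1; apply: qcomm_bracket; first by apply: IH; lia.
apply/qcomm1/esym/(chev_Dapart H); rewrite /apart; lia.
Qed.

Lemma rootvec_D_right i m : (i + m.+1 < r)%N ->
  D (i + m.+1) *m E i m = p ^- 2 *: (E i m *m D (i + m.+1)) - p^-1 *: E i m.
Proof.
case: m => [|m] im.
  by apply: (chev_Dadj H); rewrite /neighbors; lia.
have c0 := eq_sub0 (rootvec_D_apart (i := i) (m := m) (k := (i + m.+2)%N)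
  ltac:(lia) ltac:(lia) ltac:(lia)).
have h := eq_sub0 (chev_Dadj H (i := (i + m.+2)%N) (j := (i + m.+1)%N)
  ltac:(lia) ltac:(lia) ltac:(rewrite /neighbors; lia)).
move: h c0 => /=; move: (E i m) (e (i + m.+1)%N) (D (i + m.+2)%N) => x y D'.
set h := _ - _; set c0 := _ - _ => eh e0.
apply: (@eq_of_cert _ _ _ (c0 *m y + x *m h - p^-1 *: (h *m x)
    - p^- 3 *: (y *m c0))); first by rewrite eh e0; nc_zero.
by rewrite /h /c0; nc_ring; field.
Qed.

Lemma rootvec_D_left i m : (i.+1 + m < r)%N ->
  D i *m E i.+1 m = p ^- 2 *: (E i.+1 m *m D i) - p^-1 *: E i.+1 m.
Proof.
elim: m => [|m IH] im.
  by apply: (chev_Dadj H); rewrite /neighbors; lia.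
have c0 := eq_sub0 (chev_Dapart H (i := i) (j := (i.+1 + m.+1)%N)
  ltac:(lia) ltac:(lia) ltac:(rewrite /apart; lia)).
have h := eq_sub0 (IH ltac:(lia)).
move: h c0 => /=; move: (E i.+1 m) (e (i.+1 + m.+1)%N) (D i) => x y D'.
set h := _ - _; set c0 := _ - _ => eh e0.
apply: (@eq_of_cert _ _ _ (h *m y + p ^- 2 *: (x *m c0) - p^-1 *: (c0 *m x)
    - p^-1 *: (y *m h))); first by rewrite eh e0; nc_zero.
by rewrite /h /c0; nc_ring; field.
Qed.

(** This is [K_k^2] written through [D_k]; at [p = 1] it is the identity. *)
Definition Ksq k : 'M[C]_d := 1%:M + (p - p^-1) *: D k.

(** Only at the two end letters of a root does [f k] fail to commute with the root vector up to a
    scalar; there it cuts off the end letter. *)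
Lemma rootvec_f_last i m : (i + m.+1 < r)%N ->
  E i m.+1 *m f (i + m.+1) =
    p^-1 *: (f (i + m.+1) *m E i m.+1) + p^-1 *: (E i m *m Ksq (i + m.+1)).
Proof.
move=> im.
have hX := eq_sub0 (rootvec_f_right im).
have hy := eq_sub0 (chev_self H im).
have hD := eq_sub0 (rootvec_D_right im).
rewrite /Ksq /=; move: hX hy hD.
move: (E i m) (e (i + m.+1)%N) (D (i + m.+1)%N) (f (i + m.+1)%N) => X y D' F.
set hX := X *m F - _; set hy := y *m F - _; set hD := D' *m X - _.
move=> eX ey eD.
apply: (@eq_of_cert _ _ _ (X *m hy + p ^- 2 *: (hX *m y) - p^-1 *: (y *m hX)
   - hy *m X - hD)); first by rewrite eX ey eD; nc_zero.
by rewrite /hX /hy /hD; nc_ring; field.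
Qed.

Lemma rootvec_f_first i m : (i.+1 + m < r)%N ->
  E i m.+1 *m f i = p^-1 *: (f i *m E i m.+1) - E i.+1 m.
Proof.
move=> im; rewrite rootvec_left //.
have hZ := eq_sub0 (rootvec_f_left im).
have hx := eq_sub0 (chev_self H (i := i) ltac:(lia)).
have hD := eq_sub0 (rootvec_D_left im).
move: hZ hx hD; move: (E i.+1 m) (e i) (D i) (f i) => Z x D' F.
set hZ := Z *m F - _; set hx := x *m F - _; set hD := D' *m Z - _.
move=> eZ ex eD.
apply: (@eq_of_cert _ _ _ (x *m hZ + p *: (hx *m Z) - p^-1 *: (Z *m hx)
   - p ^- 3 *: (hZ *m x) + p *: hD)); first by rewrite eZ ex eD; nc_zero.
by rewrite /hZ /hx /hD; nc_ring; field.
Qed.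

Lemma rootvec_f_penultimate i m : (i + m.+2 < r)%N ->
  E i m.+2 *m f (i + m.+1) = f (i + m.+1) *m E i m.+2.
Proof.
move=> im; rewrite [E i m.+2]rootvecS.
have hY := eq_sub0 (rootvec_f_last (i := i) (m := m) ltac:(lia)).
have hz := eq_sub0 (chev_adj H (i := (i + m.+2)%N) (j := (i + m.+1)%N)
  ltac:(lia) ltac:(lia) ltac:(rewrite /neighbors; lia)).
have hD := eq_sub0 (chev_Dadj H (i := (i + m.+1)%N) (j := (i + m.+2)%N)
  ltac:(lia) ltac:(lia) ltac:(rewrite /neighbors; lia)).
have c0 : E i m *m e (i + m.+2) - e (i + m.+2) *m E i m = 0.
  by apply/eq_sub0/rootvec_e_apart; lia.
move: hY hz hD c0; rewrite /Ksq.
move: (E i m.+1) (E i m) (e (i + m.+2)%N) (D (i + m.+1)%N) (f (i + m.+1)%N).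
move=> Y X z D' F.
set hY := Y *m F - _; set hz := z *m F - _; set hD := D' *m z - _.
set c0 := _ - z *m X => eY ez eD e0.
apply: (@eq_of_cert _ _ _ (Y *m hz + p *: (hY *m z) - p^-1 *: (z *m hY)
   - p ^- 2 *: (hz *m Y) + (p - p^-1) *: (X *m hD) + p ^- 2 *: c0
   + ((p - p^-1) * p ^- 2) *: (c0 *m D'))).
  by rewrite eY ez eD e0; nc_zero.
by rewrite /hY /hz /hD /c0; nc_ring; field.
Qed.

Lemma rootvec_f_interior i m k : (i + m < r)%N -> (i < k < i + m)%N ->
  E i m *m f k = f k *m E i m.
Proof.
elim: m k => [|m IH] k im hk; first by lia.
have [km|km] := ltnP k (i + m).
  apply/qcomm1; rewrite [E i m.+1]/= -[1]mulr1; apply: qcomm_bracket.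
    by apply/qcomm1/IH; lia.
  by apply/qcomm1/(chev_apart H); rewrite /apart; lia.
have ek : k = (i + m)%N by lia.
case: m im hk km ek {IH} => [|m] im hk km ->; first by lia.
exact: rootvec_f_penultimate.
Qed.

End RootVectors.

(** * Commutation of the Casimir summands with the lowering operators *)

Section CasimirTerms.
Variables (R : realType) (d : nat) (p : R[i]) (r : nat).
Variables (e D : nat -> 'M[R[i]]_d).
Hypothesis H : chevalley p r e D.
Local Notation f k := (adjoint (e k)).
Local Notation E := (rootvec p e).
Local Notation E2 i m := (adjoint (E i m) *m E i m).
Let p0 : p != 0 := chev_p0 H.

Let pVJ : (p^-1)^*%C = p^-1. Proof. by rewrite conjc_inv (chev_pJ H). Qed.

Lemma casimir_apart i m k : (i + m < r)%N -> (k < r)%N ->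
  [|| (k.+1 < i)%N, (i + m.+1 < k)%N | (i < k < i + m)%N] ->
  E2 i m *m f k = f k *m E2 i m.
Proof.
move=> im kr h.
have h1 : E i m *m f k = f k *m E i m.
  move: h; rewrite orbA => /orP[h|h]; first exact: (rootvec_f_apart H).
  exact: (rootvec_f_interior H).
have h2 : adjoint (E i m) *m f k = f k *m adjoint (E i m).
  rewrite -!adjointM; congr adjoint.
  move: h; rewrite orbA => /orP[h|h]; first exact/esym/(rootvec_e_apart H).
  exact/esym/(rootvec_e_interior H).
by rewrite -mulmxA h1 mulmxA h2 mulmxA.
Qed.

(** The summands of the roots ending just before [k] and at [k] both fail to commute with [f k], and
    both errors involve the product of [adjoint (E i m.+1)] and [E i m]; with suitable weights they
    cancel. [casimir_left] and [casimir_left_next] play the same game at the other end of the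
    roots. *)
Lemma casimir_right i m : (i + m.+1 < r)%N -> let k := (i + m.+1)%N in
  E2 i m *m f k = p ^+ 2 *: (f k *m E2 i m - adjoint (E i m.+1) *m E i m).
Proof.
move=> im k; have h1 := eq_sub0 (rootvec_f_right H im).
have h2 : adjoint (E i m.+1) - (f k *m adjoint (E i m)
    - p^-1 *: (adjoint (E i m) *m f k)) = 0.
  by apply: eq_sub0; rewrite rootvecS adjointB adjointZ !adjointM pVJ.
move: h1 h2; rewrite -/k.
move: (E i m) (adjoint (E i m)) (adjoint (E i m.+1)) (f k) => X XJ G F.
set h1 := _ - p *: _; set h2 := G - _ => e1 e2.
apply: (@eq_of_cert _ _ _ (XJ *m h1 + p ^+ 2 *: (h2 *m X))).
  by rewrite e1 e2; nc_zero.
by rewrite /h1 /h2; nc_ring; field.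
Qed.

Lemma casimir_right_next i m : (i + m.+1 < r)%N -> let k := (i + m.+1)%N in
  E2 i m.+1 *m f k = p ^- 2 *: (f k *m E2 i m.+1)
    + p^-1 *: (adjoint (E i m.+1) *m E i m *m Ksq p D k).
Proof.
move=> im k; have h1 := eq_sub0 (rootvec_f_last H im).
have h2 := congr1 (@adjoint _ _ _) (rootvec_e_last H im).
rewrite adjointZ !adjointM (chev_pJ H) -/k in h2; have {}h2 := eq_sub0 h2.
move: h1 h2; rewrite -/k.
move: (E i m) (E i m.+1) (adjoint (E i m.+1)) (f k) (Ksq p D k) => X Y YJ F K.
set h1 := _ - (p^-1 *: _ + _); set h2 := _ - p *: _ => e1 e2.
apply: (@eq_of_cert _ _ _ (YJ *m h1 - p ^- 2 *: (h2 *m Y))).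
  by rewrite e1 e2; nc_zero.
by rewrite /h1 /h2; nc_ring; field.
Qed.

Lemma casimir_left i m : (i.+1 + m < r)%N ->
  E2 i.+1 m *m f i = f i *m E2 i.+1 m + p *: (adjoint (E i m.+1) *m E i.+1 m).
Proof.
move=> im; have h1 := eq_sub0 (rootvec_f_left H im).
have h2 : adjoint (E i m.+1) - (adjoint (E i.+1 m) *m f i
    - p^-1 *: (f i *m adjoint (E i.+1 m))) = 0.
  by apply: eq_sub0; rewrite (rootvec_left H) // adjointB adjointZ !adjointM pVJ.
move: h1 h2.
move: (E i.+1 m) (adjoint (E i.+1 m)) (adjoint (E i m.+1)) (f i) => X XJ G F.
set h1 := _ - p *: _; set h2 := G - _ => e1 e2.
apply: (@eq_of_cert _ _ _ (XJ *m h1 - p *: (h2 *m X))).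
  by rewrite e1 e2; nc_zero.
by rewrite /h1 /h2; nc_ring; field.
Qed.

Lemma casimir_left_next i m : (i.+1 + m < r)%N ->
  E2 i m.+1 *m f i = f i *m E2 i m.+1 - adjoint (E i m.+1) *m E i.+1 m.
Proof.
move=> im; have h1 := eq_sub0 (rootvec_f_first H im).
have h2 := congr1 (@adjoint _ _ _) (rootvec_e_first H (i := i) (m := m) ltac:(lia)).
rewrite adjointZ !adjointM pVJ in h2; have {}h2 := eq_sub0 h2.
move: h1 h2.
move: (E i.+1 m) (E i m.+1) (adjoint (E i m.+1)) (f i) => X Y YJ F.
set h1 := Y *m _ - _; set h2 := F *m YJ - p^-1 *: (YJ *m F) => e1 e2.
apply: (@eq_of_cert _ _ _ (YJ *m h1 - (h2 *m Y))).
  by rewrite e1 e2; nc_zero.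
by rewrite /h1 /h2; nc_ring; field.
Qed.

End CasimirTerms.

(** * The eigenvalues of D_i *)

Section DNum.
Variable R : realType.

(* The eigenvalue of D_i on vectors of weight nu with (nu, alpha_i) = m. *)
Definition dnum (p : R) (m : int) : R :=
  if p == 1 then m%:~R else (p ^ (m *+ 2) - 1) / (p - p^-1).

Variable p : R.
Hypothesis p_gt0 : 0 < p.

Let p_neq0 : p != 0. Proof. by rewrite gt_eqF. Qed.

Lemma dnum_den_neq0 : p != 1 -> p - p^-1 != 0.
Proof.
move=> p1; rewrite subr_eq0; apply: contra_neq p1 => h.
have : (p - 1) * (p + 1) = 0 by rewrite -subr_sqr expr1n expr2 {2}h mulfV ?subrr.
move/eqP; rewrite mulf_eq0 => /orP[|]; first by rewrite subr_eq0 => /eqP.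
by rewrite gt_eqF // addr_gt0.
Qed.

Lemma dnum_ksq m : 1 + (p - p^-1) * dnum p m = p ^ (m *+ 2).
Proof.
rewrite /dnum; case: eqP => [->|/eqP p1].
  by rewrite invr1 subrr mul0r addr0 exp1rz.
by rewrite mulrC divfK ?dnum_den_neq0 // addrC subrK.
Qed.

Lemma dnum0 : dnum p 0 = 0.
Proof. by rewrite /dnum; case: eqP => // _; rewrite mul0rn expr0z subrr mul0r. Qed.

(** The rule [D (x) 1 + K^2 (x) D] for [D] on a tensor product, read on eigenvalues. *)
Lemma dnumD a b : dnum p (a + b) = p ^ (b *+ 2) * dnum p a + dnum p b.
Proof.
rewrite /dnum; case: eqP => [->|/eqP p1]; first by rewrite exp1rz mul1r intrD.
rewrite mulrnDl expfzDr //; move: (dnum_den_neq0 p1).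
by move: (p - p^-1) => c c0; field.
Qed.

Lemma dnum1 : dnum p 1 = p.
Proof.
rewrite /dnum; case: eqP => [->//|/eqP p1].
rewrite -[p ^ _]/(p ^+ 2); have := dnum_den_neq0 p1 => h.
apply: (mulIf h); rewrite divfK //; field; exact: p_neq0.
Qed.

Lemma dnumN1 : dnum p (-1) = - p^-1.
Proof.
have := dnumD 1 (-1); rewrite subrr dnum0 dnum1 => /eqP.
rewrite eq_sym addrC addr_eq0 => /eqP ->; congr (- _).
rewrite -[_ ^ _]/(p ^- 2); field; exact: p_neq0.
Qed.

Lemma dnumS m : dnum p (m + 1) = dnum p m + p ^ (m *+ 2) * p.
Proof. by rewrite addrC dnumD dnum1 addrC. Qed.

Lemma dnumS2 m : dnum p (m + 1) = p ^+ 2 * dnum p m + p.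
Proof. by rewrite dnumD dnum1. Qed.

Lemma dnumB2 m : dnum p (m - 2) = p ^- 4 * dnum p m - (p^-1 + p ^- 3).
Proof.
have -> : m - 2 = m - 1 - 1 by lia.
rewrite !dnumD dnumN1 -[_ ^ _]/(p ^- 2); field; exact: p_neq0.
Qed.

Lemma dnum_lt : {homo dnum p : m n / m < n}.
Proof.
move=> m n mn; have [k ->] : exists k : nat, n = m + 1 + k%:Z.
  by exists (absz (n - m - 1)%R); lia.
elim: k => [|k IH]; first by rewrite addr0 dnumS ltrDl mulr_gt0 ?exprz_gt0.
apply: (lt_trans IH).
have -> : m + 1 + k.+1%:Z = m + 1 + k%:Z + 1 by lia.
by rewrite [in ltRHS]dnumS ltrDl mulr_gt0 ?exprz_gt0.
Qed.

Lemma dnum_ltE : {mono dnum p : m n / m < n}.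
Proof.
move=> m n; case: (ltgtP m n) => [/dnum_lt ->//|/dnum_lt h|->]; last exact: ltxx.
by apply/negbTE; rewrite -leNgt ltW.
Qed.

Lemma dnum_leE : {mono dnum p : m n / m <= n}.
Proof. by move=> m n; rewrite !leNgt dnum_ltE. Qed.

Lemma dnum_inj : injective (dnum p).
Proof.
move=> m n h; apply/eqP; rewrite eq_le -!dnum_leE h lexx //.
Qed.

Lemma dnum_ge0 m : (0 <= dnum p m) = (0 <= m).
Proof. by rewrite -{1}dnum0 dnum_leE. Qed.

Lemma dnum_gt0 m : (0 < dnum p m) = (0 < m).
Proof. by rewrite -{1}dnum0 dnum_ltE. Qed.

Lemma dnum_inv m : dnum p^-1 (- m) = - dnum p m.
Proof.
rewrite /dnum invr_eq1; case: eqP => [_|/eqP p1]; first by rewrite intrN.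
rewrite mulNrn exprz_inv opprK invrK.
by rewrite -[p^-1 - p]opprB invrN mulrN.
Qed.

End DNum.

(** Linear growth is all there is at [p = 1], and it suffices for convergence without a rate. *)
Lemma dnum_ge_nat (R : realType) (p : R) (n : nat) : 1 <= p -> n%:R <= dnum p n.
Proof.
move=> p1; have p0 : 0 < p by apply: lt_le_trans p1.
elim: n => [|n IH]; first by rewrite dnum0.
rewrite -addn1 PoszD natrD dnumS // lerD //.
by rewrite -[_ ^ _]/(p ^+ _) mulr_ege1 // exprn_ege1.
Qed.

(** * Words in the raising and lowering operators *)

Section Mono.
Variables (R : realType) (d : nat).

Definition opword (a : nat -> 'M[R[i]]_d) (w : seq nat) : 'M[R[i]]_d :=
  foldr (fun k A => a k *m A) 1%:M w.

Lemma opword_rcons a w k : opword a (rcons w k) = opword a w *m a k.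
Proof. by elim: w => [|l w IH] /=; rewrite ?mul1mx ?mulmx1 // IH mulmxA. Qed.

Lemma adjoint_opword a w :
  adjoint (opword a w) = opword (fun k => adjoint (a k)) (rev w).
Proof.
elim: w => [|k w IH] /=; first by rewrite adjoint1.
by rewrite adjointM IH rev_cons opword_rcons.
Qed.

End Mono.

Record highest_weight (R : realType) (d : nat) (p : R) (r : nat)
    (e D : nat -> 'M[R[i]]_d) (mu : nat -> int) (xi : 'cV[R[i]]_d) : Prop := {
  hw_neq0 : xi != 0;
  hw_e : forall k, (k < r)%N -> e k *m xi = 0;
  hw_D : forall k, (k < r)%N -> D k *m xi = (dnum p (mu k))%:C *: xi
}.

(* The weight mu - sum_(l in w) alpha_l. *)
Definition wt (mu : nat -> int) (w : seq nat) (k : nat) : int :=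
  mu k - (count_mem k w)%:Z *+ 2 + (count_mem k.+1 w)%:Z
    + (if k is k'.+1 then (count_mem k' w)%:Z else 0).

Lemma wt_cons mu l w k : wt mu (l :: w) k =
  wt mu w k - (l == k)%:Z *+ 2 + (l == k.+1)%:Z + (k == l.+1)%:Z.
Proof.
rewrite /wt /=; case: k => [|k]; first by lia.
by rewrite eqSS [k == l]eq_sym; lia.
Qed.

Lemma index_cases (i k : nat) : [\/ i = k, neighbors i k | apart i k].
Proof.
rewrite /neighbors /apart; have [->|ik] := eqVneq i k; first by constructor 1.
by case: (boolP ((k == i.+1) || (i == k.+1))) => h;
  [constructor 2 | constructor 3; lia].
Qed.

Section Words.
Variables (R : realType) (p : R) (d r : nat) (e D : nat -> 'M[R[i]]_d).
Variables (mu : nat -> int) (xi : 'cV[R[i]]_d).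
Hypothesis p_gt0 : 0 < p.
Hypothesis H : chevalley p%:C r e D.
Hypothesis hw : highest_weight p r e D mu xi.
Local Notation f k := (adjoint (e k)).

Let p0 : p != 0. Proof. by rewrite gt_eqF. Qed.

Definition word (w : seq nat) : 'cV[R[i]]_d :=
  opword (fun k => f k) w *m xi.

Lemma word_cons k w : word (k :: w) = f k *m word w.
Proof. by rewrite /word /= mulmxA. Qed.

Lemma dot_word w y : dot (word w) y = dot xi (opword e (rev w) *m y).
Proof.
rewrite /word dot_adjointl adjoint_opword; congr (dot _ (opword _ _ *m _)).
by apply/funext => k; rewrite adjointK.
Qed.

Lemma D_f_self k : (k < r)%N -> D k *m f k =
  (p%:C) ^- 4 *: (f k *m D k) - ((p%:C)^-1 + (p%:C) ^- 3) *: f k.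
Proof.
move=> kr; have P0 := chev_p0 H.
have h := congr1 (@adjoint _ _ _) (chev_Dself H kr).
have PJ := chev_pJ H.
rewrite adjointD !adjointZ !adjointM (chev_DJ H kr) in h.
move: PJ P0 h; move: (p%:C) => P PJ P0 h.
rewrite rmorphD !rmorphXn /= PJ in h.
have {}h := eq_sub0 h; move: h; move: (f k) (D k) => F D'.
set h := _ - _ => eh.
apply: (@eq_of_cert _ _ _ (- P ^- 4 *: h)); first by rewrite eh; nc_zero.
by rewrite /h; nc_ring; field.
Qed.

Lemma D_f_adj i k : (i < r)%N -> (k < r)%N -> neighbors i k ->
  D i *m f k = p%:C ^+ 2 *: (f k *m D i) + p%:C *: f k.
Proof.
move=> ir kr ik; have P0 := chev_p0 H.
have h := congr1 (@adjoint _ _ _) (chev_Dadj H ir kr ik).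
have PJ := chev_pJ H.
rewrite adjointB !adjointZ !adjointM (chev_DJ H ir) in h.
move: PJ P0 h; move: (p%:C) => P PJ P0 h.
rewrite !conjc_inv rmorphXn /= PJ in h.
have {}h := eq_sub0 h; move: h; move: (f k) (D i) => F D'.
set h := _ - _ => eh.
apply: (@eq_of_cert _ _ _ (- P ^+ 2 *: h)); first by rewrite eh; nc_zero.
by rewrite /h; nc_ring; field.
Qed.

Lemma D_f_apart i k : (i < r)%N -> (k < r)%N -> apart i k ->
  D i *m f k = f k *m D i.
Proof.
move=> ir kr ik.
have := congr1 (@adjoint _ _ _) (chev_Dapart H ir kr ik).
by rewrite !adjointM (chev_DJ H ir).
Qed.

Definition Dweight (nu : nat -> int) (y : 'cV[R[i]]_d) :=
  forall k, (k < r)%N -> D k *m y = (dnum p (nu k))%:C *: y.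

Lemma Dweight_f nu y l : (l < r)%N -> Dweight nu y ->
  Dweight (fun k => nu k - (l == k)%:Z *+ 2 + (l == k.+1)%:Z + (k == l.+1)%:Z)
    (f l *m y).
Proof.
move=> lr hy k kr; rewrite mulmxA.
case: (index_cases k l) => [ekl|kl|kl].
- subst l; rewrite D_f_self // mulmxBl -!scalemxAl -mulmxA hy // -scalemxAr scalerA.
  rewrite -scalerBl; congr (_ *: _).
  have -> : nu k - (k == k)%:Z *+ 2 + (k == k.+1)%:Z + (k == k.+1)%:Z = nu k - 2.
    by rewrite eqxx; lia.
  by rewrite dnumB2 // rmorphB rmorphD rmorphM !fmorphV !rmorphXn.
- rewrite D_f_adj // mulmxDl -!scalemxAl -mulmxA hy // -scalemxAr scalerA.
  rewrite -scalerDl; congr (_ *: _).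
  have -> : nu k - (l == k)%:Z *+ 2 + (l == k.+1)%:Z + (k == l.+1)%:Z = nu k + 1.
    by move: kl; rewrite /neighbors; lia.
  by rewrite dnumS2 // rmorphD rmorphM rmorphXn.
- rewrite D_f_apart // -mulmxA hy // -scalemxAr.
  have -> // : nu k - (l == k)%:Z *+ 2 + (l == k.+1)%:Z + (k == l.+1)%:Z = nu k.
  by move: kl; rewrite /apart; lia.
Qed.

Lemma word_Dweight w : all (fun k => k < r)%N w -> Dweight (wt mu w) (word w).
Proof.
elim: w => [_ k kr|l w IH /= /andP[lr /IH hw']].
  rewrite /word /= mul1mx (hw_D hw) //; congr ((dnum p _)%:C *: _).
  by rewrite /wt /=; case: k {kr} => [|k]; lia.
move=> k kr; rewrite word_cons (Dweight_f lr hw') //.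
by rewrite -wt_cons.
Qed.

Lemma word_Ksq w k : all (fun k => k < r)%N w -> (k < r)%N ->
  Ksq p%:C D k *m word w = (p ^ (wt mu w k *+ 2))%:C *: word w.
Proof.
move=> hw' kr; rewrite /Ksq mulmxDl mul1mx -scalemxAl (word_Dweight hw') //.
rewrite scalerA -{1}[word w]scale1r -scalerDl -dnum_ksq //.
by rewrite rmorphD rmorph1 rmorphM rmorphB fmorphV.
Qed.

(** * Grading by the content of words *)

(** Stands for a weight space: the span of the words whose multiset of letters is that of [b]. Lists
    up to permutation replace weights, so that heights and occurring simple roots can be read off
    directly. *)
Inductive graded (b : seq nat) : 'cV[R[i]]_d -> Prop :=
  | graded_zero : graded b 0
  | graded_cons c w y : perm_eq w b -> graded b y -> graded b (c *: word w + y).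

Lemma gradedD b u v : graded b u -> graded b v -> graded b (u + v).
Proof.
by elim=> [|c w y wb _ IH] gv; rewrite ?add0r // -addrA; constructor; auto.
Qed.

Lemma gradedZ b c v : graded b v -> graded b (c *: v).
Proof.
elim=> [|a w y wb _ IH]; first by rewrite scaler0; constructor.
by rewrite scalerDr scalerA; constructor.
Qed.

Lemma graded_word b w : perm_eq w b -> graded b (word w).
Proof.
by move=> h; rewrite -[word w]addr0 -[word w]scale1r; constructor=> //; constructor.
Qed.

Lemma graded_perm b b' v : perm_eq b b' -> graded b v -> graded b' v.
Proof.
move=> bb'; elim=> [|c w y wb _ IH]; constructor=> //.
exact: perm_trans wb bb'.
Qed.

Lemma graded_f k b v : graded b v -> graded (k :: b) (f k *m v).
Proof.
elim=> [|c w y wb _ IH]; first by rewrite mulmx0; constructor.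
rewrite mulmxDr -scalemxAr -word_cons; constructor=> //.
by rewrite perm_cons.
Qed.

Local Notation bounded b := (all (fun k => k < r)%N b).

(** [A] raises weights by the sum of the simple roots in [s], that is, removes the letters [s]. The
    second clause says that there is nothing above the highest weight: if the letters cannot be
    removed, the vector is killed. *)
Definition lowers (s : seq nat) (A : 'M[R[i]]_d) : Prop :=
  forall b v, bounded b -> graded b v ->
    (forall b', perm_eq b (s ++ b') -> graded b' (A *m v)) /\
    ((forall b', ~~ perm_eq b (s ++ b')) -> A *m v = 0).

Lemma lowers_lin s A B c : lowers s A -> lowers s B -> lowers s (c *: A + B).
Proof.
move=> hA hB b v bb gv; have [A1 A2] := hA b v bb gv; have [B1 B2] := hB b v bb gv.
split=> [b' h|h]; rewrite mulmxDl -scalemxAl.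
  by apply: gradedD; [apply/gradedZ/A1 | apply: B1].
by rewrite A2 // B2 // scaler0 addr0.
Qed.

Lemma lowers_perm s t A : perm_eq s t -> lowers s A -> lowers t A.
Proof.
move=> st hA b v bb gv; have [A1 A2] := hA b v bb gv.
have eqst b' : perm_eq b (s ++ b') = perm_eq b (t ++ b').
  by have /permPr -> : perm_eq (s ++ b') (t ++ b') by rewrite perm_cat2r.
by split=> [b' h|h]; [apply: A1; rewrite eqst | apply: A2 => b'; rewrite eqst].
Qed.

Lemma lowersM s t A B : lowers s A -> lowers t B -> lowers (t ++ s) (A *m B).
Proof.
move=> hA hB b v bb gv; have [B1 B2] := hB b v bb gv; rewrite -mulmxA.
have sub c : perm_eq b (t ++ c) -> bounded c.
  by move=> h; move: bb; rewrite (perm_all _ h) all_cat => /andP[].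
split=> [b' h|h].
  rewrite -catA in h; have [A1 _] := hA _ _ (sub _ h) (B1 _ h).
  exact: A1.
have [[c bc]|nc] := pselect (exists c, perm_eq b (t ++ c)); last first.
  by rewrite B2 ?mulmx0 // => c; apply/negP => bc; apply: nc; exists c.
have [_ A2] := hA _ _ (sub _ bc) (B1 _ bc); apply: A2 => b'.
apply: contraNN (h b') => cb'; rewrite -catA (permPl bc).
by rewrite perm_cat2l.
Qed.

(** [e k] is pushed to the right through the word: it commutes with the other letters up to a scalar
    and with [f k] up to [D k], which is a scalar on words, and in the end it kills [xi]. *)
Lemma e_word k w : (k < r)%N -> bounded w ->
  (forall b', perm_eq w (k :: b') -> graded b' (e k *m word w)) /\
  (k \notin w -> e k *m word w = 0).
Proof.
move=> kr; elim: w => [_|j w IH /= /andP[jr /[dup] bw /IH [IH1 IH2]]].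
  split=> [b'|_]; first by move/perm_size.
  by rewrite /word /= mul1mx (hw_e hw).
have step : j != k -> exists a, e k *m word (j :: w) = a *: (f j *m (e k *m word w)).
  move=> jk; rewrite word_cons mulmxA; case: (index_cases k j) => [ekj|kj|kj].
  - by rewrite ekj eqxx in jk.
  - by exists p%:C; rewrite (chev_adj H) // -scalemxAl mulmxA.
  - by exists 1; rewrite (chev_apart H) // scale1r mulmxA.
have fgr : k \in w -> graded w (f k *m (e k *m word w)).
  move=> kw; have := perm_to_rem kw; rewrite perm_sym => /graded_perm; apply.
  by apply/graded_f/IH1/perm_to_rem.
split=> [b' jb'|]; last first.
  rewrite inE negb_or eq_sym => /andP[/step [a ->] /IH2 ->].
  by rewrite mulmx0 scaler0.
have [ekj|jk] := eqVneq j k.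
  subst j; rewrite perm_cons in jb'; rewrite word_cons mulmxA (chev_self H) //.
  rewrite mulmxDl -scalemxAl -mulmxA (word_Dweight bw) //.
  apply: (graded_perm jb'); apply: gradedD.
    apply: gradedZ; have [/fgr//|/IH2 ->] := boolP (k \in w).
    by rewrite mulmx0; constructor.
  exact/gradedZ/graded_word.
have kw : k \in w.
  by have := perm_mem jb' k; rewrite !inE eqxx eq_sym (negbTE jk).
have [a ->] := step jk; apply: gradedZ.
apply: (graded_perm _ (graded_f j (IH1 _ (perm_to_rem kw)))).
rewrite -(perm_cons k) -(permPr jb').
rewrite -[k :: _]/([:: k] ++ [:: j] ++ rem k w) perm_catCA /= perm_cons.
by rewrite perm_sym perm_to_rem.
Qed.

Lemma lowers_e k : (k < r)%N -> lowers [:: k] (e k).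
Proof.
move=> kr b v bb gv.
have bw w : perm_eq w b -> bounded w by move=> h; rewrite (perm_all _ h).
split=> [b' h|h].
  elim: gv => [|c w y wb _ IH]; first by rewrite mulmx0; constructor.
  rewrite mulmxDr -scalemxAr; apply: gradedD => //; apply: gradedZ.
  by apply: (e_word kr (bw _ wb)).1; rewrite (permPl wb).
elim: gv => [|c w y wb _ IH]; first by rewrite mulmx0.
rewrite mulmxDr -scalemxAr IH addr0 (e_word kr (bw _ wb)).2 ?scaler0 //.
apply/negP => kw; have := h (rem k w); rewrite -(permPl wb) /=.
by rewrite perm_to_rem.
Qed.

Lemma lowers_opword (a : nat -> 'M[R[i]]_d) w : bounded w ->
  (forall k, (k < r)%N -> lowers [:: k] (a k)) -> lowers (rev w) (opword a w).
Proof.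
move=> bw ha; elim: w bw => [_|k w IH /= /andP[kr /IH h]].
  move=> b v bb gv; rewrite /= mul1mx; split=> [b' bb'|h].
    exact: graded_perm gv.
  by have := h b; rewrite perm_refl.
by rewrite rev_cons -cats1; apply: lowersM => //; apply: ha.
Qed.

Lemma lowers_long s A b v : lowers s A -> bounded b -> graded b v ->
  (size b < size s)%N -> A *m v = 0.
Proof.
move=> hA bb gv bs; apply: (hA _ _ bb gv).2 => b'; apply/negP => /perm_size.
by rewrite size_cat => eb; move: bs; rewrite eb ltnNge leq_addr.
Qed.

Lemma lowers_rootvec i m : (i + m < r)%N ->
  lowers (iota i m.+1) (rootvec p%:C e i m).
Proof.
elim: m => [|m IH] im.
  by apply: lowers_e; rewrite addn0 in im.
rewrite rootvecS addrC -scaleNr.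
have {}IH := IH ltac:(lia); have he := lowers_e im.
have -> : iota i m.+2 = iota i m.+1 ++ [:: (i + m.+1)%N].
  by rewrite -addn1 iotaD.
apply: lowers_lin; first exact: lowersM.
by apply: lowers_perm (lowersM IH he); rewrite perm_catC.
Qed.

(** The letters of a word on the left are moved across the inner product as raising operators, until
    one of them is missing on the right or only letters on the right remain. *)
Lemma graded_orth b b' u v : bounded b -> bounded b' -> graded b u ->
  graded b' v -> ~~ perm_eq b b' -> dot u v = 0.
Proof.
move=> bb bb' gu gv nbb'.
suff {u gu}: forall w, bounded w -> ~~ perm_eq w b' -> dot (word w) v = 0.
  move=> h; elim: gu => [|c w y wb _ IH]; first by rewrite dot0l.
  rewrite dotDl dotZl IH h ?mulr0 ?addr0 //; first by rewrite (perm_all _ wb).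
  by rewrite (permPl wb).
move=> w; elim: w b' v bb' gv {nbb'} => [|k w IH] b' v bb' gv /=.
  move=> _ nb'; elim: gv => [|c w y wb' _ IH]; first by rewrite dot0r.
  rewrite dotDr dotZr IH addr0; case: w wb' => [h|k w wb'].
    by rewrite h in nb'.
  have := bb'; rewrite -(perm_all _ wb') /= => /andP[kr _].
  by rewrite word_cons dot_adjointr adjointK {1}/word /= mul1mx (hw_e hw) // dot0l mulr0.
move=> /andP[kr bw] nb'; rewrite word_cons dot_adjointl adjointK.
have [h1 h2] := lowers_e kr bb' gv.
have [[c bc]|nc] := pselect (exists c, perm_eq b' ([:: k] ++ c)); last first.
  by rewrite h2 ?dot0r // => c; apply/negP => bc; apply: nc; exists c.
apply: (IH c) => //; last first.
- by apply: contraNN nb' => wc; rewrite (permPr bc) /= perm_cons.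
- exact: h1.
- by move: bb'; rewrite (perm_all _ bc) /= => /andP[].
Qed.

End Words.

Lemma sum_two (V : nmodType) (n k : nat) (F : nat -> V) : (k.+1 < n)%N ->
  (forall i, (i < n)%N -> i != k -> i != k.+1 -> F i = 0) ->
  \sum_(i < n) F i = F k + F k.+1.
Proof.
move=> kn h; have k'n : (k < n)%N by lia.
rewrite (bigD1 (Ordinal k'n)) //= (bigD1 (Ordinal kn)) /=; last first.
  by rewrite -val_eqE /= eqn_leq ltnn.
rewrite big1 ?addr0 // => i; rewrite -!val_eqE /= => /andP[i1 i2].
by apply: h => //; rewrite -?val_eqE.
Qed.

(** * The Casimir operator on words *)

Section Casimir.
Variables (R : realType) (p : R) (d r : nat) (e D : nat -> 'M[R[i]]_d).
Variables (mu : nat -> int) (xi : 'cV[R[i]]_d).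
Hypothesis p_gt0 : 0 < p.
Hypothesis H : chevalley p%:C r e D.
Hypothesis hw : highest_weight p r e D mu xi.
Local Notation f k := (adjoint (e k)).
Local Notation E := (rootvec p%:C e).
Local Notation word := (word e xi).
Local Notation graded := (graded e xi).
Local Notation bounded b := (all (fun k => k < r)%N b).

Let p0 : p != 0. Proof. by rewrite gt_eqF. Qed.
Local Notation c z := ((p ^ (z : int))%:C).

Let cD a b : c (a + b) = c a * c b.
Proof. by rewrite expfzDr // rmorphM. Qed.

Let cXn n : p%:C ^+ n = c n%:Z. Proof. by rewrite -rmorphXn. Qed.
Let cXNn n : p%:C ^- n = c (- n%:Z). Proof. by rewrite -rmorphXn -fmorphV exprnN. Qed.
Let c1 : p%:C = c 1%:Z. Proof. by rewrite -cXn expr1. Qed.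
Let cV : (p%:C)^-1 = c (- 1%:Z). Proof. by rewrite -cXNn expr1. Qed.

(** The [gl_(r+1)] coordinates of [mu], normalised to have last coordinate 0; for dominant [mu] they
    form a partition. *)
Definition mutail (j : nat) : int := \sum_(j <= i < r) mu i.

(* In gl_{r+1} coordinates: the j-th coordinate of the weight of [word w]. *)
Definition wtcoord (w : seq nat) (j : nat) : int :=
  mutail j - (count_mem j w)%:Z + (if j is j'.+1 then (count_mem j' w)%:Z else 0).

Lemma wtcoord_cons k w j :
  wtcoord (k :: w) j = wtcoord w j - (k == j)%:Z + (j == k.+1)%:Z.
Proof.
rewrite /wtcoord /=; case: j => [|j]; first by lia.
by rewrite eqSS [j == k]eq_sym; lia.
Qed.

Lemma wt_wtcoord w k : (k < r)%N -> wt mu w k = wtcoord w k - wtcoord w k.+1.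
Proof.
move=> kr; rewrite /wt /wtcoord /mutail big_ltn //.
by move: (\sum_(_ <= _ < _) _) => s; case: k kr => [|k] _; lia.
Qed.

Lemma wtcoord_perm w w' j : perm_eq w w' -> wtcoord w j = wtcoord w' j.
Proof. by move=> /permP h; rewrite /wtcoord h; case: j => [|j]; rewrite ?h. Qed.

(** The pair [i < j] stands for the root [alpha_i + ... + alpha_(j-1)]. In the Casimir element a
    group-like factor accompanies this root; on vectors of content [w] it is a scalar, and that
    scalar is written here. *)
Definition casimir_term (w : seq nat) (i j : nat) : 'M[R[i]]_d :=
  if (i < j)%N then
    c (wtcoord w j *+ 2 - i%:Z - j%:Z) *:
      (adjoint (E i (j - i.+1)) *m E i (j - i.+1))
  else 0.

Definition casimir w : 'M[R[i]]_d :=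
  \sum_(i < r.+1) \sum_(j < r.+1) casimir_term w i j.

Lemma casimir_termE w i m : casimir_term w i (i + m.+1) =
  c (wtcoord w (i + m.+1) *+ 2 - i%:Z - (i + m.+1)%:Z) *:
    (adjoint (E i m) *m E i m).
Proof.
rewrite /casimir_term ifT; last lia.
by have -> : (i + m.+1 - i.+1 = m)%N by lia.
Qed.

Section Step.
Variables (w : seq nat) (k : nat).
Hypothesis bw : bounded w.
Hypothesis kr : (k < r)%N.
Local Notation y := (word w).

(** The failure of one summand to commute with [f k], where the coefficient after [f k] is the one
    of the new content. *)
Definition casimir_defect i j : 'cV[R[i]]_d :=
  casimir_term (k :: w) i j *m (f k *m y) - f k *m (casimir_term w i j *m y).

Lemma casimir_defect0 i j : (i < r.+1)%N -> (j < r.+1)%N ->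
  i != k -> i != k.+1 -> j != k -> j != k.+1 -> casimir_defect i j = 0.
Proof.
move=> ir jr ik ik1 jk jk1; rewrite /casimir_defect.
have [ij|ij] := ltnP i j; last first.
  by rewrite /casimir_term ltnNge ij /= !mul0mx mulmx0 subrr.
have [m ej] : exists m, j = (i + m.+1)%N by exists (j - i.+1)%N; lia.
subst j.
rewrite !casimir_termE -!scalemxAl -!scalemxAr mulmxA (casimir_apart H); last first.
- by lia.
- by lia.
- by lia.
rewrite wtcoord_cons eq_sym (negbTE jk) [_ == k.+1](negbTE jk1).
by rewrite -[false%:Z]/(0 : int) subr0 addr0 !mulmxA subrr.
Qed.

(** Both defects are multiples of one vector. The new letter moves a unit from coordinate [k] to
    coordinate [k.+1], which makes the two exponents equal, and the signs are opposite. *)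
Lemma casimir_defect_right i : (i < k)%N ->
  casimir_defect i k + casimir_defect i k.+1 = 0.
Proof.
move=> ik; have [m ek] : exists m, k = (i + m.+1)%N by exists (k - i.+1)%N; lia.
have ek1 : k.+1 = (i + m.+2)%N by lia.
have hk : (i + m.+1 < r)%N by rewrite -ek.
have h1 := casimir_right H hk; have h2 := casimir_right_next H hk.
have hK := word_Ksq p_gt0 H hw bw kr.
cbv zeta in h1, h2; rewrite -ek in h1 h2.
have t1 w' : casimir_term w' i k =
    c (wtcoord w' k *+ 2 - i%:Z - k%:Z) *: (adjoint (E i m) *m E i m).
  by rewrite {1}ek casimir_termE -ek.
have t2 w' : casimir_term w' i k.+1 =
    c (wtcoord w' k.+1 *+ 2 - i%:Z - k.+1%:Z) *: (adjoint (E i m.+1) *m E i m.+1).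
  by rewrite {1}ek1 casimir_termE -ek1.
have a1 : adjoint (E i m) *m E i m *m (f k *m y) = c 2%:Z *:
  (f k *m (adjoint (E i m) *m E i m *m y) - adjoint (E i m.+1) *m E i m *m y).
  by rewrite mulmxA h1 -scalemxAl mulmxBl !mulmxA cXn.
have a2 : adjoint (E i m.+1) *m E i m.+1 *m (f k *m y) =
  c (- 2%:Z) *: (f k *m (adjoint (E i m.+1) *m E i m.+1 *m y)) +
  c (- 1%:Z + wt mu w k *+ 2) *: (adjoint (E i m.+1) *m E i m *m y).
  rewrite mulmxA h2 mulmxDl -!scalemxAl -[_ *m Ksq _ _ _ *m _]mulmxA hK.
  by rewrite -scalemxAr scalerA cXNn cV -cD !mulmxA.
rewrite /casimir_defect !t1 !t2 !wtcoord_cons -!scalemxAl a1 a2 -!scalemxAr.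
rewrite !scalerBr !scalerDr !scalerA -!cD wt_wtcoord // !eqxx.
have -> : (k == k.+1) = false by lia.
set z1 := wtcoord w k *+ 2 - i%:Z - k%:Z.
set z2 := wtcoord w k.+1 *+ 2 - i%:Z - k.+1%:Z.
have -> : (wtcoord w k - true%:Z + false%:Z) *+ 2 - i%:Z - k%:Z + 2%:Z = z1.
  by rewrite /z1; lia.
have -> : (wtcoord w k.+1 - false%:Z + true%:Z) *+ 2 - i%:Z - k.+1%:Z - 2%:Z = z2.
  by rewrite /z2; lia.
have -> : (wtcoord w k.+1 - false%:Z + true%:Z) *+ 2 - i%:Z - k.+1%:Z +
   (- 1%:Z + (wtcoord w k - wtcoord w k.+1) *+ 2) = z1 by rewrite /z1; lia.
move: (c z1 *: _) (c z1 *: _) (c z2 *: _) => a b b'.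
by rewrite [a - b]addrC addrK addrAC subrr add0r addNr.
Qed.

Lemma casimir_defect_left j : (k.+1 < j < r.+1)%N ->
  casimir_defect k j + casimir_defect k.+1 j = 0.
Proof.
move=> /andP[kj jr]; have [m ej] : exists m, j = (k.+1 + m.+1)%N.
  by exists (j - k.+2)%N; lia.
have ej1 : j = (k + m.+2)%N by lia.
have hk : (k.+1 + m < r)%N by lia.
have h1 := casimir_left H hk; have h2 := casimir_left_next H hk.
have t1 w' : casimir_term w' k.+1 j =
    c (wtcoord w' j *+ 2 - k.+1%:Z - j%:Z) *: (adjoint (E k.+1 m) *m E k.+1 m).
  by rewrite {1}ej casimir_termE -ej.
have t2 w' : casimir_term w' k j =
    c (wtcoord w' j *+ 2 - k%:Z - j%:Z) *: (adjoint (E k m.+1) *m E k m.+1).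
  by rewrite {1}ej1 casimir_termE -ej1.
have a1 : adjoint (E k.+1 m) *m E k.+1 m *m (f k *m y) =
  f k *m (adjoint (E k.+1 m) *m E k.+1 m *m y) +
  c 1%:Z *: (adjoint (E k m.+1) *m E k.+1 m *m y).
  by rewrite mulmxA h1 mulmxDl -scalemxAl !mulmxA c1.
have a2 : adjoint (E k m.+1) *m E k m.+1 *m (f k *m y) =
  f k *m (adjoint (E k m.+1) *m E k m.+1 *m y) -
  adjoint (E k m.+1) *m E k.+1 m *m y.
  by rewrite mulmxA h2 mulmxBl !mulmxA.
rewrite /casimir_defect !t1 !t2 !wtcoord_cons -!scalemxAl a1 a2 -!scalemxAr.
have -> : (k == j) = false by lia.
have -> : (j == k.+1) = false by lia.
have zz (x : int) : x - false%:Z + false%:Z = x by lia.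
rewrite zz scalerBr scalerDr scalerA -cD.
set z1 := wtcoord w j *+ 2 - k%:Z - j%:Z.
have -> : wtcoord w j *+ 2 - k.+1%:Z - j%:Z + 1%:Z = z1 by rewrite /z1; lia.
move: (c z1 *: _) (c z1 *: _) (c _ *: _) => a b b'.
by rewrite [a - b]addrC addrK [b' + b]addrC addrK addNr.
Qed.

(** The one defect that does not cancel is that of the simple root [alpha_k] itself. It is the
    increment of the eigenvalue of the root part when the letter [k] is added. *)
Definition casimir_step : R :=
  p ^ (wtcoord w k.+1 *+ 2 + 1 - k%:Z *+ 2) * dnum p (wt mu w k).

Lemma casimir_defect_self :
  casimir_defect k k.+1 = casimir_step%:C *: (f k *m y).
Proof.
have ek1 : k.+1 = (k + 1)%N by rewrite addn1.
have t1 w' : casimir_term w' k k.+1 =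
    c (wtcoord w' k.+1 *+ 2 - k%:Z - k.+1%:Z) *: (f k *m e k).
  by rewrite {1}ek1 casimir_termE -ek1.
have a1 : f k *m e k *m (f k *m y) = c (- 2%:Z) *: (f k *m (f k *m e k *m y)) +
   (dnum p (wt mu w k))%:C *: (f k *m y).
  rewrite -mulmxA (mulmxA (e k)) (chev_self H) // mulmxDl.
  rewrite (word_Dweight p_gt0 H hw bw) // mulmxDr -!scalemxAr -scalemxAl.
  by rewrite -scalemxAr cXNn !mulmxA.
rewrite /casimir_defect !t1 !wtcoord_cons -!scalemxAl a1 -!scalemxAr.
rewrite scalerDr !scalerA -cD eqxx.
have -> : (k == k.+1) = false by lia.
set z1 := wtcoord w k.+1 *+ 2 - k%:Z - k.+1%:Z.
have -> : (wtcoord w k.+1 - false%:Z + true%:Z) *+ 2 - k%:Z - k.+1%:Z - 2%:Z = z1.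
  by rewrite /z1; lia.
rewrite addrAC subrr add0r /casimir_step rmorphM; congr (c _ * _ *: _); lia.
Qed.

Lemma casimir_cons : casimir (k :: w) *m word (k :: w) =
  f k *m (casimir w *m y) + casimir_step%:C *: word (k :: w).
Proof.
suff h : \sum_(i < r.+1) \sum_(j < r.+1) casimir_defect i j =
    casimir_step%:C *: (f k *m y).
  rewrite word_cons -h /casimir_defect.
  under [X in _ + X]eq_bigr => i _ do rewrite sumrB.
  rewrite sumrB /casimir !mulmx_suml mulmx_sumr addrC.
  under [X in _ = _ - X + _]eq_bigr => i _ do rewrite -mulmx_sumr -mulmx_suml.
  rewrite subrK; apply: eq_bigr => i _; by rewrite mulmx_suml.
have z i j : (j <= i)%N -> casimir_defect i j = 0.
  by move=> ji; rewrite /casimir_defect /casimir_term ltnNge ji !mul0mx mulmx0 subrr.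
(* Each row other than [k] and [k.+1] sums to zero by itself; these two rows cancel against each
   other except at the entry [(k, k.+1)]. *)
rewrite (sum_two (k := k) (F := fun i => \sum_(j < r.+1) casimir_defect i j));
    last first.
- move=> i ir ik ik1; rewrite (sum_two (k := k)) ?ltnS //.
    have [ki|ki] := ltnP i k; first exact: casimir_defect_right.
    by rewrite !z ?addr0 //; lia.
  by move=> j jr jk jk1; apply: casimir_defect0.
- by [].
rewrite -big_split /= (bigD1 (Ordinal (n := r.+1) (m := k.+1) kr)) //=.
rewrite casimir_defect_self (z k.+1 k.+1) // addr0 big1 ?addr0 // => j.
rewrite -val_eqE /= => jk; have [kj|jk'] := ltnP k.+1 j.
  by apply: casimir_defect_left; rewrite kj /=.
by rewrite !z ?addr0 //; lia.
Qed.

End Step.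

(** * The Casimir eigenvalue *)

(* The summands of the closed form of the Casimir eigenvalue; at [p = 1] the
   exponential sum degenerates to a quadratic one. *)
Definition casimir_summand (x : int) (j : nat) : R :=
  if p == 1 then ((x - j%:Z) ^+ 2)%:~R / 2
  else p ^ (x *+ 2 + 2 - j%:Z *+ 2) / (p - p^-1) ^+ 2.

(** The Cartan part takes the value of the sum of the [casimir_summand] at the coordinates of a
    weight. As the full Casimir is constant on the module and its root part kills [xi], the root
    part acts by this difference. *)
Definition casimir_eig (w : seq nat) : R :=
  \sum_(j < r.+1)
    (casimir_summand (mutail j) j - casimir_summand (wtcoord w j) j).

Lemma casimir_eig_nil : casimir_eig [::] = 0.
Proof.
rewrite /casimir_eig big1 // => j _.
have -> : wtcoord [::] j = mutail j.
  by rewrite /wtcoord /=; move: (mutail j) => s; case: (nat_of_ord j) => *; lia.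
by rewrite subrr.
Qed.

Lemma casimir_summand_step (x y : int) (k : nat) :
  casimir_summand x k - casimir_summand (x - 1) k +
    (casimir_summand y k.+1 - casimir_summand (y + 1) k.+1) =
  p ^ (y *+ 2 + 1 - k%:Z *+ 2) * dnum p (x - y).
Proof.
rewrite /casimir_summand /dnum; case: eqP => [->|/eqP p1].
  rewrite exp1rz mul1r intS !(rmorphXn, rmorphB, rmorphD, rmorph1) /=.
  by field.
set a := p ^ (x *+ 2 - k%:Z *+ 2); set b := p ^ (y *+ 2 - k%:Z *+ 2).
have split2 (u v : int) (n : nat) : v = u + n%:Z -> p ^ v = p ^ u * p ^+ n.
  by move=> ->; rewrite expfzDr.
rewrite (split2 (x *+ 2 - k%:Z *+ 2) (x *+ 2 + 2 - k%:Z *+ 2) 2%N); last by lia.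
have -> : (x - 1) *+ 2 + 2 - k%:Z *+ 2 = x *+ 2 - k%:Z *+ 2 by lia.
have -> : y *+ 2 + 2 - k.+1%:Z *+ 2 = y *+ 2 - k%:Z *+ 2 by lia.
rewrite (split2 (y *+ 2 - k%:Z *+ 2) ((y + 1) *+ 2 + 2 - _) 2%N); last by lia.
rewrite (split2 (y *+ 2 - k%:Z *+ 2) (y *+ 2 + 1 - _) 1%N); last by lia.
have ab : b * p ^ ((x - y) *+ 2) = a.
  by rewrite /a /b -expfzDr //; congr (_ ^ _); lia.
rewrite -/a -/b expr1.
have k0 := dnum_den_neq0 p_gt0 p1.
have -> : b * p * ((p ^ ((x - y) *+ 2) - 1) / (p - p^-1)) =
   p * (a - b) / (p - p^-1) by rewrite -ab; ring.
have pk : p ^+ 2 = p * (p - p^-1) + 1 by rewrite mulrBr mulfV // -expr2 subrK.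
rewrite pk; move: (p - p^-1) k0 => g g0; field.
exact: g0.
Qed.

Lemma casimir_eig_cons k w : (k < r)%N ->
  casimir_eig (k :: w) = casimir_eig w + casimir_step w k.
Proof.
move=> kr; apply/eqP; rewrite addrC -subr_eq -sumrB.
rewrite (sum_two (k := k) (F := fun j => (casimir_summand (mutail j) j -
  casimir_summand (wtcoord (k :: w) j) j) - (casimir_summand (mutail j) j -
  casimir_summand (wtcoord w j) j))) //; last first.
  move=> j jr jk jk1; rewrite wtcoord_cons eq_sym (negbTE jk) (negbTE jk1).
  by rewrite -[false%:Z]/(0 : int) subr0 addr0 subrr.
rewrite /casimir_step wt_wtcoord // -casimir_summand_step !wtcoord_cons !eqxx.
have -> : (k == k.+1) = false by lia.
rewrite -[false%:Z]/(0 : int) -[true%:Z]/(1 : int) subr0 addr0.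
by apply/eqP; ring.
Qed.

Lemma casimir_eig_perm w w' : perm_eq w w' -> casimir_eig w = casimir_eig w'.
Proof.
by move=> h; apply: eq_bigr => j _; rewrite (wtcoord_perm _ h).
Qed.

Lemma casimir_perm w w' : perm_eq w w' -> casimir w = casimir w'.
Proof.
move=> h; apply: eq_bigr => i _; apply: eq_bigr => j _.
by rewrite /casimir_term (wtcoord_perm _ h).
Qed.

Lemma casimir_word w : bounded w ->
  casimir w *m word w = (casimir_eig w)%:C *: word w.
Proof.
elim: w => [_|k w IH /= /andP[kr bw]].
  rewrite casimir_eig_nil scale0r /casimir mulmx_suml big1 // => i _.
  rewrite mulmx_suml big1 // => j _; rewrite /casimir_term; case: ifP => ij.
    have hE := lowers_rootvec p_gt0 H hw (i := i) (m := (j - i.+1)%N).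
    have {}hE := hE ltac:(have := ltn_ord j; lia).
    rewrite -scalemxAl -mulmxA (lowers_long hE (b := [::])) ?mulmx0 ?scaler0 //.
    exact/graded_word.
  by rewrite mul0mx.
rewrite casimir_cons // IH // casimir_eig_cons // word_cons.
by rewrite -scalemxAr -scalerDl -rmorphD.
Qed.

Lemma casimir_graded b v : bounded b -> graded b v ->
  casimir b *m v = (casimir_eig b)%:C *: v.
Proof.
move=> bb; elim=> [|a w y wb _ IH]; first by rewrite mulmx0 scaler0.
rewrite mulmxDr -scalemxAr IH -(casimir_perm wb) casimir_word; last first.
  by rewrite (perm_all _ wb).
by rewrite (casimir_eig_perm wb) scalerDr !scalerA mulrC.
Qed.

(** Pairing the eigenvalue equation with [v] turns every summand into a squared norm with a positive
    weight; this positivity is what the estimates rest on. *)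
Lemma casimir_form b v : bounded b -> graded b v ->
  \sum_(i < r.+1) \sum_(j < r.+1) (if (i < j)%N then
     p ^ (wtcoord b j *+ 2 - (i : nat)%:Z - (j : nat)%:Z) *
       sqnorm (E i (j - i.+1) *m v) else 0) = casimir_eig b * sqnorm v.
Proof.
move=> bb gv; apply: complexI; rewrite rmorphM /= -dot_sqnorm -dotZr.
rewrite -(casimir_graded bb gv) /casimir mulmx_suml dot_sumr rmorph_sum.
apply: eq_bigr => i _; rewrite mulmx_suml dot_sumr rmorph_sum.
apply: eq_bigr => j _; rewrite /casimir_term; case: ifP => ij; last first.
  by rewrite mul0mx dot0r.
rewrite -scalemxAl dotZr -mulmxA dot_adjointr adjointK dot_sqnorm.
by rewrite rmorphM.
Qed.

End Casimir.

(** * Lower bounds for the Casimir eigenvalue *)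

Lemma mutail_le (mu : nat -> int) (r i k : nat) :
  (forall k, (k < r)%N -> 0 <= mu k) -> (i <= k)%N -> mutail r mu k <= mutail r mu i.
Proof.
move=> mu_ge0; elim: k => [|k IH] ik; first by have -> : i = 0%N by lia.
have [->//|ik'] := eqVneq i k.+1; apply: (le_trans _ (IH _)); last by lia.
rewrite /mutail; have [kr|kr] := ltnP k r; last by rewrite !big_geq // ltnW.
by rewrite [leRHS]big_ltn // lerDr mu_ge0.
Qed.

Section Gap.
Variables (R : realType) (p : R) (d r : nat) (e D : nat -> 'M[R[i]]_d).
Variables (mu : nat -> int) (xi : 'cV[R[i]]_d).
Hypothesis p_ge1 : 1 <= p.
Hypothesis H : chevalley p%:C r e D.
Hypothesis hw : highest_weight p r e D mu xi.
Hypothesis mu_ge0 : forall k, (k < r)%N -> 0 <= mu k.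
Local Notation E := (rootvec p%:C e).
Local Notation word := (word e xi).
Local Notation graded := (graded e xi).
Local Notation bounded b := (all (fun k => k < r)%N b).

Let p_gt0 : 0 < p. Proof. exact: lt_le_trans p_ge1. Qed.
Let p0 : p != 0. Proof. by rewrite gt_eqF. Qed.

(** The worst negative [casimir_step] after division by the common scale: within [L] letters a
    coordinate grows by at most [L], and the pairing with a simple root drops to no less than
    [-2L]. *)
Definition gap_loss (L : nat) : R := p ^ (L%:Z *+ 2 + 1) * - dnum p (- L%:Z *+ 2).

Lemma gap_loss_ge0 L : 0 <= gap_loss L.
Proof.
rewrite mulr_ge0 ?exprz_ge0 ?(ltW p_gt0) // oppr_ge0 -(dnum0 p) dnum_leE //.
Qed.

(** The step at a letter [k] has the scale [p^(2 mu_(k+1))] in [gl] coordinates, which for [k >= i0]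
    is at most the factor in front. Hence no loss exceeds that factor times [gap_loss L], while a
    letter [i0] gains the same factor times a quantity growing with [mu i0]. The gain is counted
    once, and [- (L + r)] allows for the lowered coordinate and for the exponent [-2k]. *)
Lemma casimir_eig_ge (L i0 : nat) (w : seq nat) : (i0 < r)%N ->
  L%:Z *+ 2 <= mu i0 -> bounded w -> (size w <= L)%N ->
  all (fun k => i0 <= k)%N w ->
  p ^ (mutail r mu i0.+1 *+ 2) *
   ((i0 \in w)%:R * (p ^ (- (L + r)%:Z *+ 2) * dnum p (mu i0 - L%:Z *+ 2))
     - (size w)%:R * gap_loss L) <= casimir_eig p r mu w.
Proof.
move=> i0r muL; elim: w => [_ _ _|k w IH /= /andP[kr bw] wL /andP[i0k hi]].
  by rewrite in_nil casimir_eig_nil // !mul0r subrr mulr0.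
have cnt_le j : (count_mem j w <= L)%N.
  exact: leq_trans (count_size _ _) (ltnW wL).
have {}IH := IH bw (ltnW wL) hi.
rewrite casimir_eig_cons //.
set c0 := p ^ _ in IH *; set g := _ * dnum p _ in IH *; set A := gap_loss L in IH *.
have c0_gt0 : 0 < c0 by rewrite exprz_gt0.
have A0 : 0 <= A by exact: gap_loss_ge0.
have g0 : 0 <= g.
  by rewrite mulr_ge0 ?exprz_ge0 ?(ltW p_gt0) // dnum_ge0 // subr_ge0.
have hx : wtcoord r mu w k.+1 <= mutail r mu i0.+1 + L%:Z.
  have := mutail_le (i := i0.+1) (k := k.+1) mu_ge0 ltac:(lia).
  rewrite /wtcoord; have := cnt_le k; have := cnt_le k.+1.
  by move: (mutail _ _ _) (mutail _ _ _) => u v; lia.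
have hwt : - L%:Z *+ 2 <= wt mu w k.
  rewrite /wt; have := mu_ge0 kr; have := cnt_le k.
  by case: (k) => [|k'] /=; clear; lia.
have step_ge : - (c0 * A) <= casimir_step p r mu w k.
  rewrite /casimir_step; have [h|h] := lerP 0 (dnum p (wt mu w k)).
    apply: (@le_trans _ _ 0); first by rewrite oppr_le0 mulr_ge0 // ltW.
    by rewrite mulr_ge0 // exprz_ge0 // ltW.
  rewrite -[leRHS]opprK lerN2 -mulrN.
  have -> : c0 * A = p ^ (mutail r mu i0.+1 *+ 2 + (L%:Z *+ 2 + 1)) *
      - dnum p (- L%:Z *+ 2) by rewrite expfzDr // -mulrA.
  apply: ler_pM.
  - by rewrite exprz_ge0 // ltW.
  - by rewrite oppr_ge0 ltW.
  - by apply: (ler_weXz2l p_ge1); clear -hx; lia.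
  - by rewrite lerN2 dnum_leE.
have [ek|nk] := eqVneq i0 k; last first.
  rewrite inE (negbTE nk) /=; apply: le_trans (lerD IH step_ge).
  rewrite -[- (c0 * A)]mulrN -mulrDr ler_pM2l // -[(size w).+1]addn1 natrD mulrDl mul1r.
  by rewrite opprD addrA.
subst k; rewrite inE eqxx /= mul1r.
have step_big : c0 * g <= casimir_step p r mu w i0.
  have -> : c0 * g = p ^ (mutail r mu i0.+1 *+ 2 + - (L + r)%:Z *+ 2) *
      dnum p (mu i0 - L%:Z *+ 2) by rewrite expfzDr // -mulrA.
  rewrite /casimir_step; apply: ler_pM.
  - by rewrite exprz_ge0 // ltW.
  - by rewrite dnum_ge0 // subr_ge0.
  - apply: (ler_weXz2l p_ge1); rewrite /wtcoord; have := cnt_le i0.+1.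
    move: (mutail _ _ _) (count_mem _ _) (count_mem _ _) => u a b ha.
    by clear -ha i0r p_ge1; lia.
  - rewrite dnum_leE // /wt; have := cnt_le i0.
    by case: (i0) => [|k'] /=; clear; lia.
have IH' : - (c0 * ((size w)%:R * A)) <= casimir_eig p r mu w.
  apply: le_trans IH; rewrite -mulrN ler_pM2l // lerDr mulr_ge0 //.
apply: le_trans (lerD IH' step_big).
rewrite -[- (c0 * _)]mulrN -mulrDr ler_pM2l // addrC lerD2r lerN2.
by rewrite ler_wpM2r // ler_nat.
Qed.

Definition rootsum (y : 'cV[R[i]]_d) : R :=
  \sum_(i < r.+1) \sum_(j < r.+1)
    (if (i < j)%N then sqnorm (E i (j - i.+1) *m y) else 0).

Lemma rootsum_ge0 y : 0 <= rootsum y.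
Proof.
apply: sumr_ge0 => i _; apply: sumr_ge0 => j _; case: ifP => // _.
exact: sqnorm_ge0.
Qed.

Lemma gap_graded (L i0 : nat) b v : L%:Z *+ 2 <= mu i0 ->
  bounded b -> (size b <= L)%N -> i0 \in b -> all (fun k => i0 <= k)%N b ->
  graded b v ->
  (p ^ (- (L + r)%:Z *+ 2) * dnum p (mu i0 - L%:Z *+ 2) - L%:R * gap_loss L)
    * sqnorm v <= p ^ (L%:Z *+ 2) * rootsum v.
Proof.
move=> muL bb bL i0b hi gv; have i0r : (i0 < r)%N by exact: (allP bb).
have := casimir_eig_ge i0r muL bb bL hi; rewrite i0b mul1r.
set c0 := p ^ (mutail _ _ _ *+ 2); set g := _ * dnum p _; set A := gap_loss L => h.
have c0_gt0 : 0 < c0 by rewrite exprz_gt0.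
have A0 : 0 <= A by exact: gap_loss_ge0.
rewrite -(ler_pM2l c0_gt0) mulrA; apply: (@le_trans _ _ (casimir_eig p r mu b * sqnorm v)).
  rewrite ler_wpM2r ?sqnorm_ge0 //; apply: le_trans h; rewrite ler_pM2l // lerD2l.
  by rewrite lerN2 ler_wpM2r // ler_nat.
rewrite -(casimir_form p_gt0 H hw bb gv) mulrA /rootsum mulr_sumr ler_sum // => i _.
rewrite mulr_sumr ler_sum // => j _; case: ifP => [ij|]; last by rewrite mulr0.
(* A root starting to the left of [i0] uses a letter absent from [b], so its root vector kills [v].
   For the other roots the weight is at most [c0 * p^(2L)]. *)
have [ii0|ii0] := ltnP i i0.
  have ir : (i + (j - i.+1) < r)%N by have := ltn_ord j; clear -ij; lia.
  have -> : E i (j - i.+1) *m v = 0; last by rewrite sqnorm0 !mulr0.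
  apply: ((lowers_rootvec p_gt0 H hw ir) b v bb gv).2 => b'.
  apply/negP => /perm_mem/(_ i); rewrite mem_cat mem_iota leqnn /= addnS ltnS leq_addr /=.
  by move=> ib; have := allP hi _ ib; rewrite leqNgt ii0.
rewrite ler_wpM2r ?sqnorm_ge0 // -expfzDr //; apply: (ler_weXz2l p_ge1).
have cnt_le k : (count_mem k b <= L)%N by apply: leq_trans (count_size _ _) _.
have := mutail_le (i := i0.+1) (k := j) mu_ge0 (leq_ltn_trans ii0 ij).
rewrite /wtcoord; have := cnt_le j; have := cnt_le j.-1.
move: (mutail _ _ _) (mutail _ _ _) => u u'.
by case: (nat_of_ord j) => [|j'] /=; clear; lia.
Qed.

End Gap.

(** The coefficients are those of [2 rho] in the simple roots, so the form takes the value 2 on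
    every simple root and recovers the number of letters from the weight. *)
Lemma wt_height (mu : nat -> int) (r : nat) (w : seq nat) :
  all (fun k => k < r)%N w ->
  \sum_(k < r) (k.+1 * (r - k))%N%:Z * (mu k - wt mu w k) = (size w)%:Z *+ 2.
Proof.
elim: w => [_|l w IH /= /andP[lr /IH {}IH]].
  rewrite big1 // => k _; rewrite /wt /=.
  by case: (nat_of_ord k) => [|k']; rewrite ?subrr ?mulr0 //; lia.
have -> : (size w).+1%:Z *+ 2 = (size w)%:Z *+ 2 + 2 by rewrite -addn1 PoszD; lia.
rewrite -IH; apply/eqP; rewrite addrC -subr_eq -sumrB; apply/eqP.
pose c k : int := (k.+1 * (r - k))%N%:Z.
have delta (i : nat) (F : nat -> int) : \sum_(k < r) F k * ((k : nat) == i)%:Z =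
    if (i < r)%N then F i else 0.
  case: ifP => ir; last first.
    by rewrite big1 // => k _; have := ltn_ord k; case: eqP => [->|]; rewrite ?ir // mulr0.
  rewrite (bigD1 (Ordinal ir)) //= eqxx mulr1 big1 ?addr0 // => k.
  by rewrite -val_eqE /= => /negbTE ->; rewrite mulr0.
transitivity (\sum_(k < r) (c k * (k == l :> nat)%:Z *+ 2
    - (c k * (k.+1 == l)%:Z) - c k * (k == l.+1 :> nat)%:Z)).
  apply: eq_bigr => k _; rewrite wt_cons -/(c k) (eq_sym l k) (eq_sym l k.+1); ring.
rewrite !sumrB sumrMnl !delta lr.
have -> : \sum_(k < r) c k * (k.+1 == l)%:Z = if l is l'.+1 then c l' else 0.
  case: l lr => [|l] lr; first by rewrite big1 // => k _; rewrite mulr0.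
  by rewrite delta ifT //; lia.
rewrite /c; case: l lr => [|l] lr; case: ifP => l1; nia.
Qed.

(** * Modules generated by a highest weight vector, and the gap estimate *)

Section Cyclic.
Variables (R : realType) (p : R) (d r : nat) (e D : nat -> 'M[R[i]]_d).
Variables (mu : nat -> int) (xi : 'cV[R[i]]_d).
Local Notation word := (word e xi).
Local Notation bounded b := (all (fun k => k < r)%N b).

Definition cyclic : Prop := forall y : 'cV[R[i]]_d,
  exists2 s : seq (R[i] * seq nat), all (fun t => bounded t.2) s &
    y = \sum_(t <- s) t.1 *: word t.2.

Hypothesis p_gt0 : 0 < p.
Hypothesis H : chevalley p%:C r e D.
Hypothesis hw : highest_weight p r e D mu xi.
Hypothesis cyc : cyclic.
Local Notation graded := (graded e xi).
Local Notation f k := (adjoint (e k)).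
Local Notation P := (line_proj xi).

Let xi0 : xi != 0 := hw_neq0 hw.

Lemma cyclic_dot y : y != 0 ->
  exists w, bounded w /\ dot y (word w) != 0.
Proof.
move=> y0; have [s bs ey] := cyc y; apply: contrapT => h.
have := dot_self_neq0 y0; rewrite {2}ey dot_sumr big_seq big1 ?eqxx // => t ts.
rewrite dotZr; apply/eqP; rewrite mulf_eq0; apply/orP; right.
apply: contrapT => /negP nz; apply: h; exists t.2; split=> //.
exact: (allP bs).
Qed.

(** The component of [y] orthogonal to [xi] is orthogonal to every longer word too, because the
    [e k] kill it; words span, so it is zero. *)
Lemma killed_by_e y : (forall k, (k < r)%N -> e k *m y = 0) ->
  exists c, y = c *: xi.
Proof.
move=> hy; exists (dot xi y / dot xi xi); apply/eqP; rewrite -subr_eq0.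
apply/negPn/negP => /cyclic_dot[w [bw]].
rewrite -line_projE; case: w bw => [_|k w /= /andP[kr _]].
  rewrite /word /= mul1mx -scaleN1r dotC dotDr dotZr line_projE dotZr.
  by rewrite divfK ?dot_self_neq0 // mulN1r subrr rmorph0 eqxx.
rewrite word_cons dot_adjointr adjointK mulmxBr hy // line_projE -scalemxAr.
by rewrite (hw_e hw) // scaler0 subr0 dot0l eqxx.
Qed.

Lemma Dweight_word nu y : y != 0 -> Dweight p r D nu y ->
  exists w, [/\ bounded w, dot y (word w) != 0 &
    forall k, (k < r)%N -> nu k = wt mu w k].
Proof.
move=> y0 hy; have [w [bw wy]] := cyclic_dot y0; exists w; split=> // k kr.
have h : dot (D k *m y) (word w) = dot y (D k *m word w).
  by rewrite dot_adjointl (chev_DJ H).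
rewrite hy // (word_Dweight p_gt0 H hw) // dotZl dotZr conjc_real in h.
exact/(dnum_inj p_gt0)/complexI/(mulIf wy).
Qed.

(** A nonzero remainder of weight [mu] would pair with a word of weight [mu], which by [wt_height]
    is empty; but the remainder is orthogonal to [xi]. *)
Lemma Dweight_top y : Dweight p r D mu y -> P *m y = y.
Proof.
move=> hy; apply/eqP; rewrite eq_sym -subr_eq0; apply/negPn/negP => z0.
have hz : Dweight p r D mu (y - P *m y).
  move=> k kr; rewrite mulmxBr hy // line_projE -scalemxAr (hw_D hw) // scalerBr.
  by rewrite !scalerA mulrC.
have [w [bw wz hwt]] := Dweight_word z0 hz.
have /eqP : (size w)%:Z *+ 2 = 0.
  by rewrite -(wt_height mu bw) big1 // => k _; rewrite -hwt // subrr mulr0.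
move=> sw; have {sw} : size w = 0%N by lia.
move/size0nil => ew; move: wz; rewrite ew /word /= mul1mx dotC -scaleN1r.
rewrite dotDr dotZr line_projE dotZr divfK ?dot_self_neq0 //.
by rewrite mulN1r subrr rmorph0 eqxx.
Qed.

(** [L] is chosen before the family [a], because one bound has to serve both the [e k] and their
    twists [- (invmx (Th k) *m e k)]. *)
Lemma nilpotent : exists L, forall (a : nat -> 'M[R[i]]_d),
  (forall k, (k < r)%N -> lowers r e xi [:: k] (a k)) ->
  forall u, bounded u -> (L < size u)%N -> opword a u = 0.
Proof.
have /choice[L hL] : forall j : 'I_d, exists L, forall a,
    (forall k, (k < r)%N -> lowers r e xi [:: k] (a k)) ->
    forall u, bounded u -> (L < size u)%N -> opword a u *m delta_mx j 0 = 0 :> 'cV_d.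
  move=> j; have [s bs ->] := cyc (delta_mx j 0).
  exists (\max_(t <- s) size t.2)%N => a ha u bu su.
  rewrite mulmx_sumr big_seq big1 // => t ts; rewrite -scalemxAr.
  rewrite (lowers_long (lowers_opword bu ha) (b := t.2)) ?scaler0 //.
  - exact: (allP bs).
  - exact: graded_word.
  - rewrite size_rev; apply: leq_ltn_trans su.
    by rewrite (big_rem t) //= leq_max leqnn.
exists (\max_j L j)%N => a ha u bu su; apply/matrixP => i j; rewrite mxE.
have : (opword a u *m delta_mx j 0 : 'cV_d) i 0 = 0.
  rewrite (hL j) ?mxE //; apply: leq_ltn_trans su.
  exact: leq_bigmax.
by rewrite -colE mxE.
Qed.

Section GapAll.
Hypothesis p_ge1 : 1 <= p.
Hypothesis mu_ge0 : forall k, (k < r)%N -> 0 <= mu k.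
Variables (L n : nat).
Hypothesis Ln : (L * 2 <= n)%N.
Hypothesis good : forall w, bounded w -> w != [::] -> word w != 0 ->
  exists2 i0, i0 \in w & all (fun k => i0 <= k)%N w /\ n%:Z <= mu i0.

(** The bound of [gap_graded] with [mu i0] replaced by its lower bound [n], so that it no longer
    depends on the module. *)
Definition gap_const : R :=
  p ^ (- (L + r)%:Z *+ 2) * dnum p (n%:Z - L%:Z *+ 2) - L%:R * gap_loss p L.

Local Notation rootsum := (rootsum p r e).

Lemma gap_graded_const b v : bounded b -> graded b v -> b != [::] ->
  (v != 0 -> (size b <= L)%N) ->
  gap_const * sqnorm v <= p ^ (L%:Z *+ 2) * rootsum v.
Proof.
move=> bb gv bn hb; have [->|v0] := eqVneq v 0.
  by rewrite sqnorm0 mulr0 mulr_ge0 ?rootsum_ge0 // exprz_ge0 // ltW.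
(* [good] speaks of nonzero words only: for multiples of [omega_1] it fails for contents that occur
   in no such word. *)
have [w [wb w0]] : exists w, perm_eq w b /\ word w != 0.
  apply: contrapT => h; move/eqP: v0; apply; elim: gv => // c w y wb _ ->.
  rewrite addr0; apply/eqP; rewrite scaler_eq0; apply/orP; right.
  by apply: contrapT => /negP nz; apply: h; exists w.
have bw : bounded w by rewrite (perm_all _ wb).
have wn : w != [::].
  by apply: contraNneq bn => wn; move: wb; rewrite wn perm_sym => /perm_nilP ->.
have [i0 i0w [hi nmu]] := good bw wn w0.
have muL : L%:Z *+ 2 <= mu i0 by apply: le_trans nmu; clear -Ln; lia.
rewrite (perm_mem wb) in i0w; rewrite (perm_all _ wb) in hi.
apply: le_trans (gap_graded p_ge1 H hw mu_ge0 muL bb (hb v0) i0w hi gv).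
rewrite ler_wpM2r ?sqnorm_ge0 // lerD2r ler_wpM2l ?exprz_ge0 ?(ltW p_gt0) //.
by rewrite dnum_leE // lerD2r.
Qed.

Lemma graded_decomposition y : exists bs (F : seq nat -> 'cV[R[i]]_d),
  [/\ uniq bs, y = \sum_(b <- bs) F b,
      forall b, b \in bs -> bounded b /\ graded b (F b) &
      forall b b', b \in bs -> b' \in bs -> b != b' -> ~~ perm_eq b b'].
Proof.
have [s bnd ->] := cyc y.
(* Sorted lists are canonical representatives of contents. *)
pose key (t : R[i] * seq nat) := sort leq t.2.
exists (undup [seq key t | t <- s]).
exists (fun b => \sum_(t <- s | key t == b) t.1 *: word t.2); split.
- exact: undup_uniq.
- under [RHS]eq_bigr => b _ do rewrite big_mkcond.
  rewrite exchange_big /= big_seq [RHS]big_seq; apply: eq_bigr => t ts.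
  rewrite (bigD1_seq (key t)) ?undup_uniq //=; last first.
    by rewrite mem_undup; apply: map_f.
  rewrite eqxx big1 ?addr0 // => b nb; rewrite eq_sym (negbTE nb) //.
- move=> b; rewrite mem_undup => /mapP[t ts ->]; split.
    by rewrite /key all_sort; exact: (allP bnd).
  apply: big_ind; [exact: graded_zero | exact: gradedD |] => t' /eqP <-.
  by apply/gradedZ/graded_word; rewrite /key perm_sym perm_sort.
- move=> b b'; rewrite !mem_undup => /mapP[t _ ->] /mapP[t' _ ->].
  apply: contraNN => h; apply/eqP; apply: (sorted_eq leq_trans anti_leq) => //;
  exact: (sort_sorted leq_total).
Qed.

Lemma gap y : (forall u, bounded u -> (L < size u)%N -> opword e u *m y = 0) ->
  gap_const * sqnorm (y - P *m y) <= p ^ (L%:Z *+ 2) * rootsum y.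
Proof.
move=> hy; have [bs [F [us ey hF nperm]]] := graded_decomposition y.
have orth b b' : b \in bs -> b' \in bs -> b != b' -> dot (F b) (F b') = 0.
  move=> h h' bb'; have [x1 x2] := hF _ h; have [x3 x4] := hF _ h'.
  by apply: (graded_orth p_gt0 H hw x1 x3 x2 x4); apply: nperm.
(* By orthogonality [dot (F b) y] is the squared norm of [F b]. If [b] is longer than [L] it is also
   0, since the words of [F b] become long products of [e k] applied to [y]. *)
have bound b : b \in bs -> F b != 0 -> (size b <= L)%N.
  move=> h; apply: contraNT; rewrite -ltnNge => Lb.
  have : dot (F b) y = 0.
    have [bb gb] := hF _ h; elim: gb => [|c w v wb _ IH]; first by rewrite dot0l.
    rewrite dotDl dotZl IH addr0 dot_word hy ?dot0r ?mulr0 //.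
      by rewrite all_rev (perm_all _ wb).
    by rewrite size_rev (perm_size wb).
  rewrite ey dot_sumr (bigD1_seq b) //= big_seq_cond big1 ?addr0.
    by move=> /eqP h0; apply: contraTT h0; exact: dot_self_neq0.
  by move=> b' /andP[b'b bb']; apply: orth; rewrite // eq_sym.
have -> : y - P *m y = \sum_(b <- bs | b != [::]) F b.
  have Pz b : b \in bs -> b != [::] -> P *m F b = 0.
    move=> h bn; have [x1 x2] := hF _ h.
    rewrite line_projE (graded_orth p_gt0 H hw (b := [::]) _ x1 _ x2) ?mul0r ?scale0r //.
      by have := @graded_word _ _ e xi [::] [::] isT; rewrite /word /= mul1mx.
    by apply: contra_neqN bn; rewrite perm_sym => /perm_nilP.
  have Pid : [::] \in bs -> P *m F [::] = F [::].
    move=> h; have [_] := hF _ h; elim=> [|c w v wb _ IH]; first by rewrite mulmx0.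
    rewrite mulmxDr IH -scalemxAr; congr (_ *: _ + _).
    move/perm_nilP: wb => ->; rewrite /word /= mul1mx line_projE.
    by rewrite divff ?dot_self_neq0 // scale1r.
  rewrite {1 2}ey (bigID (fun b => b == [::]) (r := bs)) /= mulmxDr !mulmx_sumr.
  rewrite [X in _ - (_ + X)]big_seq_cond [X in _ - (_ + X)]big1 ?addr0; last first.
    by move=> b /andP[h bn]; apply: Pz.
  rewrite [X in X - _]addrC.
  have -> : \sum_(b <- bs | b == [::]) P *m F b = \sum_(b <- bs | b == [::]) F b.
    rewrite big_seq_cond [RHS]big_seq_cond; apply: eq_bigr.
    by move=> b /andP[h /eqP eb]; move: h; rewrite eb => /Pid.
  by rewrite addrK.
rewrite -big_filter sqnorm_sum_orth ?filter_uniq //; last first.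
  by move=> b b'; rewrite !mem_filter => /andP[_ h] /andP[_ h']; apply: orth.
(* A root vector removes the same letters from every content, so the images of the components stay
   orthogonal. *)
have -> : rootsum y = \sum_(b <- bs) rootsum (F b).
  rewrite {1}ey /rootsum [RHS]exchange_big; apply: eq_bigr => i _.
  rewrite [RHS]exchange_big; apply: eq_bigr => j _; case: ifP => ij; last by rewrite big1.
  rewrite mulmx_sumr sqnorm_sum_orth // => b b' h h' bb'.
  have ir : (i + (j - i.+1) < r)%N by have := ltn_ord j; lia.
  have hE := lowers_rootvec p_gt0 H hw ir.
  have [x1 x2] := hF _ h; have [x3 x4] := hF _ h'.
  have [y1 y2] := hE _ _ x1 x2; have [y3 y4] := hE _ _ x3 x4.
  have [[c hc]|nc] := pselect (exists c, perm_eq b (iota i (j - i.+1).+1 ++ c));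
    last first.
    by rewrite y2 ?dot0l // => c; apply/negP => hc; apply: nc; exists c.
  have [[c' hc']|nc] := pselect (exists c, perm_eq b' (iota i (j - i.+1).+1 ++ c));
    last first.
    by rewrite y4 ?dot0r // => c'; apply/negP => hc'; apply: nc; exists c'.
  have sub v c1 : bounded v -> perm_eq v (iota i (j - i.+1).+1 ++ c1) -> bounded c1.
    by move=> bv hv; move: bv; rewrite (perm_all _ hv) all_cat => /andP[].
  apply: (graded_orth p_gt0 H hw (sub _ _ x1 hc) (sub _ _ x3 hc') (y1 _ hc) (y3 _ hc')).
  apply: contraNN (nperm _ _ h h' bb') => cc'.
  by rewrite (permPl hc) (permPr hc') perm_cat2l.
rewrite !mulr_sumr big_filter [leRHS](bigID (fun b => b != [::])) /=.
rewrite -[leLHS]addr0 lerD //.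
  rewrite big_seq_cond [leRHS]big_seq_cond ler_sum // => b /andP[h bn].
  by have [x1 x2] := hF _ h; apply: (gap_graded_const x1 x2 bn); apply: bound.
apply: sumr_ge0 => b _; rewrite mulr_ge0 ?rootsum_ge0 // exprz_ge0 // ltW //.
Qed.

End GapAll.
End Cyclic.

(** * Strings of weights and the lowest weight vector *)

Section Strings.
Variables (R : realType) (p : R) (d r : nat) (e D : nat -> 'M[R[i]]_d).
Variables (mu : nat -> int) (xi : 'cV[R[i]]_d).
Hypothesis p_gt0 : 0 < p.
Hypothesis H : chevalley p%:C r e D.
Hypothesis hw : highest_weight p r e D mu xi.
Hypothesis cyc : cyclic r e xi.
Local Notation f k := (adjoint (e k)).

Let p0 : p != 0. Proof. by rewrite gt_eqF. Qed.

(** The weight [nu + s alpha_k]. *)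
Definition shift (nu : nat -> int) (s : int) (k l : nat) : int :=
  nu l + s * ((k == l)%:Z *+ 2 - (k == l.+1)%:Z - (l == k.+1)%:Z).

Lemma Dweight_ext nu nu' y : (forall k, (k < r)%N -> nu k = nu' k) ->
  Dweight p r D nu y -> Dweight p r D nu' y.
Proof. by move=> h hy k kr; rewrite hy // h. Qed.

Lemma Dweight_shift_f nu k y : (k < r)%N -> Dweight p r D nu y ->
  Dweight p r D (shift nu (-1) k) (f k *m y).
Proof.
move=> kr /(Dweight_f p_gt0 H kr); apply: Dweight_ext => l lr.
by rewrite /shift; lia.
Qed.

Lemma Dweight_shift_e nu k y : (k < r)%N -> Dweight p r D nu y ->
  Dweight p r D (shift nu 1 k) (e k *m y).
Proof.
move=> kr hy l lr; rewrite mulmxA /shift.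
case: (index_cases l k) => [elk|lk|lk].
- subst l; rewrite (chev_Dself H) // mulmxDl -!scalemxAl -mulmxA hy // -scalemxAr.
  rewrite scalerA -scalerDl; congr (_ *: _).
  have -> : nu k + 1 * ((k == k)%:Z *+ 2 - (k == k.+1)%:Z - (k == k.+1)%:Z) =
    nu k + 1 + 1 by rewrite eqxx; lia.
  by rewrite !dnumS2 // !(rmorphD, rmorphM) ?rmorphXn /=; ring.
- rewrite (chev_Dadj H) // mulmxBl -!scalemxAl -mulmxA hy // -scalemxAr.
  rewrite scalerA -scalerBl; congr (_ *: _).
  have -> : nu l + 1 * ((k == l)%:Z *+ 2 - (k == l.+1)%:Z - (l == k.+1)%:Z) =
    nu l + -1 by move: lk; rewrite /neighbors; lia.
  have -> : dnum p (nu l + -1) = p ^- 2 * dnum p (nu l) - p^-1.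
    by rewrite dnumD // dnumN1.
  by rewrite rmorphB rmorphM !fmorphV rmorphXn.
- rewrite (chev_Dapart H) // -mulmxA hy // -scalemxAr.
  congr (_%:C *: _); congr (dnum _ _).
  by move: lk; rewrite /apart; lia.
Qed.

Lemma Dweight_iter (s : int) (a : nat -> 'M[R[i]]_d) nu k n y :
  (forall nu y, Dweight p r D nu y -> Dweight p r D (shift nu s k) (a k *m y)) ->
  Dweight p r D nu y ->
  Dweight p r D (shift nu (s * n%:Z) k) (opword a (nseq n k) *m y).
Proof.
move=> ha hy; elim: n => [|n IH] /=.
  rewrite mul1mx; apply: Dweight_ext hy => l _.
  by rewrite /shift mulr0 mul0r addr0.
rewrite -mulmxA; apply: Dweight_ext (ha _ _ IH) => l _.
have -> : n.+1%:Z = n%:Z + 1 by lia.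
by rewrite /shift; ring.
Qed.

(* The constant of sl_2-theory in [e f^(n+1) u = string_const l (n+1) f^n u] for
   a vector [u] of weight [l] killed by [e]. *)
Definition string_const (l : int) (n : nat) : R :=
  p ^ (1 - n%:Z *+ 2) * dnum p n * dnum p (l - n%:Z + 1).

Lemma string_constS l n :
  p ^- 2 * string_const l n + dnum p (l - n%:Z *+ 2) = string_const l n.+1.
Proof.
rewrite /string_const.
set m := l - n%:Z *+ 2.
have -> : l - n%:Z + 1 = m + n%:Z + 1 by rewrite /m; lia.
have -> : l - n.+1%:Z + 1 = m + n%:Z by rewrite /m; lia.
have -> : n.+1%:Z = n%:Z + 1 by lia.
have -> : 1 - (n%:Z + 1) *+ 2 = (- n%:Z *+ 2) + (-1) by lia.
have -> : 1 - n%:Z *+ 2 = (- n%:Z *+ 2) + 1 by lia.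
have e1 := dnumS p_gt0 n%:Z; have e2 := dnumS p_gt0 (m + n%:Z).
have e3 : dnum p (m + n%:Z) = p ^ (m *+ 2) * dnum p n + dnum p m.
  by rewrite addrC dnumD.
have e4 : p ^ ((m + n%:Z) *+ 2) = p ^ (m *+ 2) * p ^ (n%:Z *+ 2).
  by rewrite -expfzDr // -mulrnDl.
have e5 (s : int) : p ^ (- n%:Z *+ 2 + s) = (p ^ (n%:Z *+ 2))^-1 * p ^ s.
  by rewrite expfzDr // mulNrn -invr_expz.
rewrite e1 e2 e4 e3 !e5 expr1z -[p ^ -1]/(p^-1).
have := expfz_neq0 (n%:Z *+ 2) p0; move: (p ^ (n%:Z *+ 2)) => a a0.
by field; rewrite a0 p0.
Qed.

(** From [y] one climbs with [e k] to the top of the [alpha_k]-string, [a] steps up, and descends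
    [a + nu k] steps with [f k]. The top has pairing [nu k + 2a] with [alpha_k], and by
    [string_const] no vector vanishes within that many steps down. *)
Lemma weight_reflection nu k y : (k < r)%N -> 0 <= nu k -> y != 0 ->
  Dweight p r D nu y ->
  exists2 y', y' != 0 & Dweight p r D (shift nu (- nu k) k) y'.
Proof.
move=> kr nuk y0 hy.
have [L hL] := nilpotent cyc.
pose Q n := opword e (nseq n k) *m y != 0.
have Q0 : exists n, Q n by exists 0%N; rewrite /Q /= mul1mx.
have QL n : Q n -> (n <= L)%N.
  rewrite /Q; apply: contraNT; rewrite -ltnNge => Ln; rewrite (hL e) ?mul0mx //.
  - by move=> l lr; apply: (lowers_e p_gt0 H hw).
  - by rewrite all_nseq kr orbT.
  - by rewrite size_nseq.
case: (ex_maxnP Q0 QL) => a Qa amax.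
pose u := opword e (nseq a k) *m y.
have u0 : u != 0 by [].
have eu : e k *m u = 0.
  apply/eqP/negPn/negP => h; have := amax a.+1; rewrite /Q /= -mulmxA.
  by move=> /(_ h); rewrite ltnn.
have hu : Dweight p r D (shift nu a%:Z k) u.
  have := Dweight_iter (s := 1) (a := e) a (k := k)
    (fun nu' y' h => Dweight_shift_e kr h) hy.
  by rewrite mul1r.
set l := nu k + a%:Z *+ 2.
pose v n := opword (fun k => f k) (nseq n k) *m u.
have vS n : v n.+1 = f k *m v n by rewrite /v /= mulmxA.
have hv n : Dweight p r D (shift nu (a%:Z - n%:Z) k) (v n).
  have := Dweight_iter (s := -1) (a := fun k => f k) n (k := k)
    (fun nu' y' h => Dweight_shift_f kr h) hu.
  by apply: Dweight_ext => j _; rewrite /shift; ring.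
have ef n : e k *m v n.+1 = ((p ^- 2 * string_const l n + dnum p (l - n%:Z *+ 2)))%:C
    *: v n.
  elim: n => [|n IH].
    rewrite vS mulmxA (chev_self H) // mulmxDl -scalemxAl -mulmxA.
    have v0 : v 0%N = u by rewrite /v /= mul1mx.
    rewrite v0 eu mulmx0 scaler0 add0r -v0 hv //; congr (_%:C *: _).
    rewrite /string_const dnum0 mulr0 mul0r mulr0 add0r; congr (dnum _ _).
    by rewrite /shift /l; lia.
  rewrite vS mulmxA (chev_self H) // mulmxDl -scalemxAl -mulmxA IH hv //.
  rewrite -scalemxAr -vS scalerA -scalerDl; congr (_ *: _).
  rewrite (string_constS l n) [RHS]rmorphD [X in _ = X + _]rmorphM.
  rewrite fmorphV rmorphXn /=.
  congr (_ + _%:C); congr (dnum _ _).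
  by rewrite /shift /l; lia.
have vn0 n : n%:Z <= l -> v n != 0.
  elim: n => [_|n IH nl]; first by rewrite /v /= mul1mx.
  have {}IH := IH ltac:(lia).
  apply: contraNneq IH => h; have := ef n; rewrite h mulmx0 string_constS.
  move/esym/eqP; rewrite scaler_eq0 => /orP[|//] /eqP/(@complexI R _ 0)/eqP.
  rewrite gt_eqF // /string_const !mulr_gt0 ?exprz_gt0 ?dnum_gt0 //; lia.
exists (v (a + absz (nu k))%N).
  by apply: vn0; rewrite /l; lia.
by apply: Dweight_ext (hv _) => j _; rewrite /shift; congr (_ + _ * _); lia.
Qed.

(** Weights in [gl] coordinates, on which simple reflections act by exchanging adjacent entries. *)
Definition coord_weight (x : seq int) : Prop :=
  exists2 y : 'cV[R[i]]_d, y != 0 & Dweight p r D (fun k => x`_k - x`_k.+1) y.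

Lemma coord_weight_swap s a b t : (size (s ++ a :: b :: t) = r.+1)%N -> b <= a ->
  coord_weight (s ++ a :: b :: t) -> coord_weight (s ++ b :: a :: t).
Proof.
rewrite size_cat /= => sz ba [y y0 hy].
have kr : (size s < r)%N by move: sz; rewrite !addnS => -[<-]; rewrite ltnS leq_addr.
have nk : (s ++ a :: b :: t)`_(size s) = a by rewrite nth_cat ltnn subnn.
have nk1 : (s ++ a :: b :: t)`_(size s).+1 = b.
  by rewrite nth_cat ltnNge leqnSn /= subSnn.
have [|y' y'0 hy'] := weight_reflection kr _ y0 hy.
  by rewrite nk nk1 subr_ge0.
exists y' => //; apply: Dweight_ext hy' => l _; rewrite /shift nk nk1.
have key j : (s ++ b :: a :: t)`_j = (s ++ a :: b :: t)`_j
    - (a - b) * (j == size s)%:Z + (a - b) * (j == (size s).+1)%:Z.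
  rewrite !nth_cat; case: (ltngtP j (size s)) => js.
  - have -> : (j == (size s).+1) = false by lia.
    by rewrite -[false%:Z]/(0 : int) !mulr0 subr0 addr0.
  - have [->|j1] := eqVneq j (size s).+1.
      by rewrite subSnn /= -[false%:Z]/(0 : int) -[true%:Z]/(1 : int); ring.
    have [m ->] : exists m, (j - size s = m.+2)%N by exists (j - (size s).+2)%N; lia.
    by rewrite /= -[false%:Z]/(0 : int) !mulr0 subr0 addr0.
  - have -> : (j == (size s).+1) = false by lia.
    by rewrite js subnn /= -[false%:Z]/(0 : int) -[true%:Z]/(1 : int); ring.
rewrite !key ![(size s == _)]eq_sym [(l.+1 == (size s).+1)]eqSS.
by ring.
Qed.

Lemma coord_weight_move s a t u : (size (s ++ a :: t ++ u) = r.+1)%N ->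
  all (fun b => b <= a) t ->
  coord_weight (s ++ a :: t ++ u) -> coord_weight (s ++ t ++ a :: u).
Proof.
elim: t s => [|b t IH] s sz //= /andP[ba bt] hx.
rewrite -cat_rcons; apply: IH => //.
  by rewrite -sz cat_rcons !size_cat /=; lia.
by rewrite cat_rcons; apply: coord_weight_swap.
Qed.

(** The longest element of the Weyl group as a sequence of exchanges, each moving a larger entry to
    the right past a smaller one, the only direction that [weight_reflection] provides. *)
Lemma coord_weight_rev s t u : (size (s ++ t ++ u) = r.+1)%N ->
  pairwise (fun a b => b <= a) t ->
  coord_weight (s ++ t ++ u) -> coord_weight (s ++ rev t ++ u).
Proof.
elim: t u => [|a t IH] u //= sz /andP[at_ pt] hx.
rewrite rev_cons cat_rcons; apply: IH => //.
  by rewrite -sz !size_cat /= size_cat; lia.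
exact: coord_weight_move.
Qed.

Lemma hw_mu_ge0 k : (k < r)%N -> 0 <= mu k.
Proof.
move=> kr; rewrite -(dnum_ge0 p_gt0).
have xi0 := hw_neq0 hw.
have h : dot (f k *m xi) (f k *m xi) = (dnum p (mu k))%:C * dot xi xi.
  rewrite dot_adjointl adjointK mulmxA (chev_self H) // mulmxDl -scalemxAl -mulmxA.
  by rewrite (hw_e hw) // mulmx0 scaler0 add0r (hw_D hw) // dotZr.
rewrite !dot_sqnorm -rmorphM in h; have {}h := complexI h.
by rewrite -(pmulr_lge0 _ (sqnorm_gt0 xi0)) -h sqnorm_ge0.
Qed.

Lemma opposite_weight : exists2 y : 'cV[R[i]]_d, y != 0 &
  Dweight p r D (fun k => - mu (r.-1 - k)%N) y.
Proof.
pose x := mkseq (mutail r mu) r.+1.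
have sx : size x = r.+1 by rewrite size_mkseq.
have hx : coord_weight x.
  exists xi; first exact: hw_neq0 hw.
  move=> k kr; rewrite (hw_D hw) // !nth_mkseq ?ltnS // 1?ltnW //.
  by rewrite /mutail [in X in X - _]big_ltn // addrK.
have px : pairwise (fun a b => b <= a) x.
  apply/(pairwiseP 0) => i j; rewrite !inE sx => ir jr ij.
  by rewrite !nth_mkseq // (mutail_le hw_mu_ge0) // ltnW.
have := coord_weight_rev (s := [::]) (t := x) (u := [::]).
rewrite !cats0 /= => /(_ sx px hx) [y y0 hy]; exists y => //.
apply: Dweight_ext hy => k kr; rewrite !nth_rev ?sx ?ltnS // 1?ltnW //.
have -> : (r.+1 - k.+1 = (r.-1 - k).+1)%N by lia.
have -> : (r.+1 - k.+2 = r.-1 - k)%N by lia.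
rewrite !nth_mkseq; try lia.
by rewrite /mutail [in X in _ - X]big_ltn; [rewrite opprD addrCA subrr addr0 | lia].
Qed.

End Strings.

(** * Irreducible modules are generated by words *)

Section Irreducible.
Variables (R : realType) (d r : nat) (e D Th : nat -> 'M[R[i]]_d).
Local Notation f k := (adjoint (e k)).

(* [Th k] stands for K_k when q != 1 and for the identity when q = 1, so that the
   coproduct is always [e (x) 1 + Th (x) e]. *)
Record grouplike : Prop := {
  gl_unit : forall k, (k < r)%N -> Th k \in unitmx;
  gl_adj : forall k, (k < r)%N -> adjoint (Th k) = Th k;
  gl_e : forall k j, (k < r)%N -> (j < r)%N ->
    exists2 c, c != 0 & Th k *m e j = c *: (e j *m Th k)
}.

Definition irreducible : Prop := forall Q : 'cV[R[i]]_d -> Prop,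
  Q 0 -> (forall c u v, Q u -> Q v -> Q (c *: u + v)) ->
  (forall k v, (k < r)%N -> Q v ->
    [/\ Q (e k *m v), Q (f k *m v), Q (D k *m v), Q (Th k *m v)
      & Q (invmx (Th k) *m v)]) ->
  (exists2 v, v != 0 & Q v) -> forall v, Q v.

Hypothesis gl : grouplike.

Lemma gl_f k j : (k < r)%N -> (j < r)%N ->
  exists2 c, c != 0 & Th k *m f j = c *: (f j *m Th k).
Proof.
move=> kr jr; have [c c0 h] := gl_e gl kr jr.
have {}h := congr1 (@adjoint _ _ _) h.
rewrite adjointZ !adjointM (gl_adj gl kr) in h.
exists (c^*%C)^-1; first by rewrite invr_eq0 conjc_eq0.
by rewrite h scalerA mulVf ?scale1r // conjc_eq0.
Qed.

Lemma gl_word xi w k : (k < r)%N -> all (fun k => k < r)%N w ->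
  (exists2 c, c != 0 & Th k *m xi = c *: xi) ->
  exists2 c, c != 0 & Th k *m word e xi w = c *: word e xi w.
Proof.
move=> kr bw hxi; elim: w bw => [|j w IH] /= => [_|/andP[jr /IH [c c0 hc]]].
  by rewrite /word /= mul1mx.
have [a a0 ha] := gl_f kr jr; exists (a * c); first by rewrite mulf_neq0.
by rewrite word_cons mulmxA ha -scalemxAl -mulmxA hc -scalemxAr scalerA.
Qed.

Lemma gl_inv_word xi w k : (k < r)%N -> all (fun k => k < r)%N w ->
  (exists2 c, c != 0 & Th k *m xi = c *: xi) ->
  exists c, invmx (Th k) *m word e xi w = c *: word e xi w.
Proof.
move=> kr bw /(gl_word kr bw)[c c0 hc]; exists c^-1.
have := congr1 (fun v => c^-1 *: (invmx (Th k) *m v)) hc.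
rewrite mulmxA mulVmx ?(gl_unit gl) // mul1mx -scalemxAr scalerA mulVf //.
by rewrite scale1r => <-.
Qed.

Lemma gl_inv_graded xi b v k : (k < r)%N -> all (fun k => k < r)%N b ->
  (exists2 c, c != 0 & Th k *m xi = c *: xi) ->
  graded e xi b v -> graded e xi b (invmx (Th k) *m v).
Proof.
move=> kr bb hxi; elim=> [|c w y wb _ IH]; first by rewrite mulmx0; constructor.
have bw : all (fun k => k < r)%N w by rewrite (perm_all _ wb).
have [a ha] := gl_inv_word kr bw hxi.
rewrite mulmxDr -scalemxAr ha scalerA; constructor=> //.
Qed.

(** These operators replace [e k] on the second leg of a vector killed by the coproducts. [Th k]
    scales words, hence does not change contents. *)
Lemma lowers_glV_e xi k : (k < r)%N ->
  (exists2 c, c != 0 & Th k *m xi = c *: xi) ->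
  lowers r e xi [:: k] (e k) ->
  lowers r e xi [:: k] (- (invmx (Th k) *m e k)).
Proof.
move=> kr hxi hl b v bb gv; have [h1 h2] := hl b v bb gv.
rewrite mulNmx -mulmxA; split=> [b' bb'|nb]; last by rewrite h2 // mulmx0 oppr0.
rewrite -scaleN1r; apply/gradedZ/gl_inv_graded => //; last exact: h1.
by move: bb; rewrite (perm_all _ bb') /= => /andP[].
Qed.

Variable p : R.
Hypothesis p_gt0 : 0 < p.
Hypothesis H : chevalley p%:C r e D.
Hypothesis irr : irreducible.

Lemma cyclic_of_irreducible mu xi : highest_weight p r e D mu xi ->
  (forall k, (k < r)%N -> exists2 c, c != 0 & Th k *m xi = c *: xi) ->
  cyclic r e xi.
Proof.
move=> hw hTh.
pose Q (y : 'cV[R[i]]_d) := exists2 s : seq (R[i] * seq nat),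
  all (fun t => all (fun k => k < r)%N t.2) s &
  y = \sum_(t <- s) t.1 *: word e xi t.2.
have Q0 : Q 0 by exists [::] => //; rewrite big_nil.
have QZ c u : Q u -> Q (c *: u).
  move=> [s bs ->]; exists [seq (c * t.1, t.2) | t <- s]; first by rewrite all_map.
  by rewrite big_map scaler_sumr; apply: eq_bigr => t _; rewrite scalerA.
have QD u v : Q u -> Q v -> Q (u + v).
  move=> [s bs ->] [s' bs' ->]; exists (s ++ s'); first by rewrite all_cat bs bs'.
  by rewrite big_cat.
have Qw w : all (fun k => k < r)%N w -> Q (word e xi w).
  by move=> bw; exists [:: (1, w)]; rewrite ?big_seq1 ?scale1r //= bw.
have Qg b v : all (fun k => k < r)%N b -> graded e xi b v -> Q v.
  move=> bb; elim=> // c w y wb _ IH; apply: QD => //; apply: QZ; apply: Qw.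
  by rewrite (perm_all _ wb).
have Qlin A : (forall w, all (fun k => k < r)%N w -> Q (A *m word e xi w)) ->
    forall v, Q v -> Q (A *m v).
  move=> hA _ [s bs ->]; rewrite mulmx_sumr; elim: s bs => [|t s IH] /=.
    by rewrite big_nil.
  move=> /andP[bt bs]; rewrite big_cons -scalemxAr; apply: QD; last exact: IH.
  by apply: QZ; apply: hA.
apply: irr => //.
- by move=> c u v hu hv; apply: QD => //; apply: QZ.
- move=> k v kr hv; split; apply: Qlin hv => w bw.
  + have [h1 h2] := e_word p_gt0 H hw kr bw.
    have [kw|/h2 ->//] := boolP (k \in w).
    have pk := perm_to_rem kw; apply: (Qg (rem k w)); last exact: h1.
    by move: bw; rewrite (perm_all _ pk) /= => /andP[].
  + by rewrite -word_cons; apply: Qw; rewrite /= kr.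
  + by rewrite (word_Dweight p_gt0 H hw) //; apply: QZ; apply: Qw.
  + by have [c _ ->] := gl_word kr bw (hTh _ kr); apply: QZ; apply: Qw.
  + by have [c ->] := gl_inv_word kr bw (hTh _ kr); apply: QZ; apply: Qw.
- exists xi; first exact: hw_neq0 hw.
  by have := Qw [::] isT; rewrite /word /= mul1mx.
Qed.

End Irreducible.

(** * Exchange of highest and lowest weights *)

Section Duality.
Variables (R : realType) (r : nat).

(** Without this reversal the dual generators would give [V_mu] the reversed highest weight:
    [m omega_1] would become [m omega_(N-1)], and the smallest letter of a word need no longer be
    one at which the weight is large. *)
Definition revi (k : nat) : nat := (r.-1 - k)%N.

Lemma revi_lt k : (k < r)%N -> (revi k < r)%N.
Proof. by rewrite /revi; lia. Qed.

Lemma reviK k : (k < r)%N -> revi (revi k) = k.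
Proof. by rewrite /revi; lia. Qed.

Lemma neighbors_revi i j : (i < r)%N -> (j < r)%N -> neighbors i j ->
  neighbors (revi i) (revi j).
Proof. by rewrite /revi /neighbors; lia. Qed.

Lemma apart_revi i j : (i < r)%N -> (j < r)%N -> apart i j ->
  apart (revi i) (revi j).
Proof. by rewrite /revi /apart; lia. Qed.

Variables (d : nat).
Implicit Types e D Th : nat -> 'M[R[i]]_d.

(* Up to powers of K, these are the operators F_(r-1-k); they satisfy the
   relations of the e_k with q replaced by its inverse. *)
Definition dual_e (p : R) e k : 'M[R[i]]_d := (p^-1)%:C *: adjoint (e (revi k)).
Definition dual_D D k : 'M[R[i]]_d := - D (revi k).

Variables (p : R) (e D Th : nat -> 'M[R[i]]_d).
Hypothesis p_gt0 : 0 < p.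
Let p0 : p != 0. Proof. by rewrite gt_eqF. Qed.
Hypothesis H : chevalley p%:C r e D.
Local Notation f k := (adjoint (e k)).

Lemma adjoint_dual_e k : adjoint (dual_e p e k) = (p^-1)%:C *: e (revi k).
Proof. by rewrite /dual_e adjointZ adjointK conjc_real. Qed.

Lemma chevalley_dual : chevalley (p^-1)%:C r (dual_e p e) (dual_D D).
Proof.
have P0 := chev_p0 H; have rl := revi_lt.
have P2 := chev_p2 H.
split.
- by rewrite fmorphV invr_eq0.
- exact: conjc_real.
- rewrite fmorphV; apply: contra_neq P2 => h.
  have -> : p%:C ^+ 2 + 1 = p%:C ^+ 2 * ((p%:C)^-1 ^+ 2 + 1) by field.
  by rewrite h mulr0.
- by move=> i ir; rewrite /dual_D adjointN (chev_DJ H) // rl.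
- move=> i ir; rewrite adjoint_dual_e /dual_e /dual_D fmorphV.
  have h := eq_sub0 (chev_self H (rl _ ir)).
  move: h; move: (e _) (adjoint _) (D _) => x y D'; set h := _ - _ => eh.
  apply: (@eq_of_cert _ _ _ (- h)); first by rewrite eh; nc_zero.
  by rewrite /h; nc_ring; field.
- move=> i j ir jr ij; rewrite adjoint_dual_e /dual_e fmorphV.
  have nij := neighbors_revi jr ir; rewrite /neighbors orbC in ij.
  have h := eq_sub0 (chev_adj H (rl _ jr) (rl _ ir) (nij ij)).
  move: h; move: (e _) (adjoint _) => x y; set h := _ - _ => eh.
  apply: (@eq_of_cert _ _ _ (- (p%:C ^- 3) *: h)); first by rewrite eh; nc_zero.
  by rewrite /h; nc_ring; field.
- move=> i j ir jr ij; rewrite adjoint_dual_e /dual_e fmorphV.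
  have nij := apart_revi jr ir; rewrite /apart orbC in ij.
  have h := eq_sub0 (chev_apart H (rl _ jr) (rl _ ir) (nij ij)).
  move: h; move: (e _) (adjoint _) => x y; set h := _ - _ => eh.
  apply: (@eq_of_cert _ _ _ (- (p%:C ^- 2) *: h)); first by rewrite eh; nc_zero.
  by rewrite /h; nc_ring; field.
- move=> i ir; rewrite /dual_e /dual_D fmorphV.
  have h := eq_sub0 (D_f_self H (rl _ ir)).
  move: h; move: (adjoint _) (D _) => x D'; set h := _ - _ => eh.
  apply: (@eq_of_cert _ _ _ (- (p%:C ^- 1) *: h)); first by rewrite eh; nc_zero.
  by rewrite /h; nc_ring; field.
- move=> i j ir jr ij; rewrite /dual_e /dual_D fmorphV.
  have h := eq_sub0 (D_f_adj H (rl _ ir) (rl _ jr) (neighbors_revi ir jr ij)).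
  move: h; move: (adjoint _) (D _) => x D'; set h := _ - _ => eh.
  apply: (@eq_of_cert _ _ _ (- (p%:C ^- 1) *: h)); first by rewrite eh; nc_zero.
  by rewrite /h; nc_ring; field.
- move=> i j ir jr ij; rewrite /dual_e /dual_D fmorphV.
  have h := eq_sub0 (D_f_apart H (rl _ ir) (rl _ jr) (apart_revi ir jr ij)).
  move: h; move: (adjoint _) (D _) => x D'; set h := _ - _ => eh.
  apply: (@eq_of_cert _ _ _ (- (p%:C ^- 1) *: h)); first by rewrite eh; nc_zero.
  by rewrite /h; nc_ring; field.
- move=> i j ir jr ij; rewrite /dual_e fmorphV /=.
  have := chev_serre H (rl _ ir) (rl _ jr) (neighbors_revi ir jr ij).
  move=> /(congr1 (@adjoint _ _ _)).
  rewrite adjointD adjointB adjointZ !adjointM adjoint0 => h.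
  move: P0 P2 h (chev_pJ H); move: (p%:C) => P P0 P2 h PJ.
  rewrite rmorphD /= conjc_inv PJ in h; move: h.
  move: (adjoint _) (adjoint _) => x y; set h := _ + _ => eh.
  apply: (@eq_of_cert _ _ _ ((P ^- 3) *: h)); first by rewrite eh; nc_zero.
  by rewrite /h; nc_ring; field.
- move=> i j ir jr ij; rewrite /dual_e fmorphV.
  have nij := apart_revi jr ir; rewrite /apart orbC in ij.
  have h := congr1 (@adjoint _ _ _) (chev_ecomm H (rl _ jr) (rl _ ir) (nij ij)).
  rewrite !adjointM in h.
  by rewrite -!scalemxAl -!scalemxAr h.
Qed.

Lemma grouplike_dual : grouplike r e Th ->
  grouplike r (dual_e p e) (fun k => Th (revi k)).
Proof.
move=> gl; split.
- by move=> k kr; apply: (gl_unit gl); apply: revi_lt.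
- by move=> k kr; apply: (gl_adj gl); apply: revi_lt.
- move=> k j kr jr; have [c c0 h] := gl_f gl (revi_lt kr) (revi_lt jr).
  exists c => //; rewrite /dual_e -scalemxAr h -scalemxAl !scalerA.
  by rewrite mulrC.
Qed.

Lemma irreducible_dual : irreducible r e D Th ->
  irreducible r (dual_e p e) (dual_D D) (fun k => Th (revi k)).
Proof.
move=> irr Q Q0 Qlin Qst Qne; apply: irr => // k v kr Qv.
have QZ c u : Q u -> Q (c *: u).
  by move=> hu; rewrite -[_ *: _]addr0; apply: Qlin.
have [h1 h2 h3 h4 h5] := Qst _ v (revi_lt kr) Qv.
rewrite adjoint_dual_e in h2; rewrite /dual_e in h1; rewrite /dual_D in h3.
rewrite !reviK // -?scalemxAl in h1 h2 h3 h4 h5.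
have pp u : Q ((p^-1)%:C *: u) -> Q u.
  move=> /(QZ p%:C); rewrite scalerA -rmorphM mulfV // scale1r //.
split => //; [exact: pp | exact: pp |].
by rewrite -[D k *m v]opprK -scaleN1r -mulNmx; apply: QZ.
Qed.

Section Lowest.
Variables (mu : nat -> int) (xi : 'cV[R[i]]_d).
Hypothesis gl : grouplike r e Th.
Hypothesis irr : irreducible r e D Th.
Hypothesis hw : highest_weight p r e D mu xi.
Hypothesis hTh : forall k, (k < r)%N -> exists2 c, c != 0 & Th k *m xi = c *: xi.

Let cyc : cyclic r e xi := cyclic_of_irreducible gl p_gt0 H irr hw hTh.

Lemma exists_longest_word : exists w,
  [/\ all (fun k => k < r)%N w, word e xi w != 0 &
      forall k, (k < r)%N -> f k *m word e xi w = 0].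
Proof.
have [L hL] := nilpotent cyc.
pose Q n := `[< exists w, [/\ all (fun k => k < r)%N w, word e xi w != 0
  & size w = n] >].
have Q0 : exists n, Q n.
  exists 0%N; apply/asboolP; exists [::]; split => //.
  by rewrite /word /= mul1mx; exact: hw_neq0 hw.
have QL n : Q n -> (n <= L)%N.
  move=> /asboolP[w [bw w0 <-]]; move: w0; apply: contraNT; rewrite -ltnNge => Lw.
  (* A long word in the lowering operators is the adjoint of a long word in the [e k], which
     vanishes by [nilpotent]. *)
  rewrite /word -[opword _ w]adjointK adjoint_opword.
  have -> : (fun k => adjoint (f k)) = e by apply/funext => k; rewrite adjointK.
  rewrite (hL e) ?adjoint0 ?mul0mx //.
  - by move=> k kr; apply: (lowers_e p_gt0 H hw).
  - by rewrite all_rev.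
  - by rewrite size_rev.
case: (ex_maxnP Q0 QL) => n /asboolP[w [bw w0 sw]] nmax.
exists w; split => // k kr; apply/eqP/negPn/negP => h.
suff : Q n.+1 by move=> /nmax; rewrite ltnn.
apply/asboolP; by exists (k :: w); rewrite /= kr bw sw word_cons.
Qed.

Lemma dnum_revi nu (y : 'cV[R[i]]_d) k : (k < r)%N ->
  D (revi k) *m y = (dnum p (nu : int))%:C *: y <->
  dual_D D k *m y = (dnum p^-1 (- nu))%:C *: y.
Proof.
move=> kr; rewrite /dual_D mulNmx dnum_inv // rmorphN scaleNr.
by split => [->//|h]; rewrite -[LHS]opprK h opprK.
Qed.

(* The lowest weight of V_mu is - sum_k mu_(r-1-k) omega_k: the weights of V_mu
   are stable under reversal of gl_{r+1} coordinates, which swaps the extreme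
   weights for the given generators and for the dual ones. *)
Lemma lowest_weight_vector : exists w,
  [/\ all (fun k => k < r)%N w,
      highest_weight p^-1 r (dual_e p e) (dual_D D) mu (word e xi w) &
      forall k, (k < r)%N ->
        exists2 c, c != 0 & Th (revi k) *m word e xi w = c *: word e xi w].
Proof.
have pV_gt0 : 0 < p^-1 by rewrite invr_gt0.
have [w [bw w0 fw]] := exists_longest_word; exists w.
have hTw k : (k < r)%N ->
    exists2 c, c != 0 & Th (revi k) *m word e xi w = c *: word e xi w.
  by move=> kr; apply: (gl_word gl) (revi_lt kr) bw (hTh (revi_lt kr)).
pose mu' k := - wt mu w (revi k).
have hw' : highest_weight p^-1 r (dual_e p e) (dual_D D) mu' (word e xi w).
  split=> // k kr.
    by rewrite /dual_e -scalemxAl fw ?scaler0 // revi_lt.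
  by apply/dnum_revi => //; rewrite (word_Dweight p_gt0 H hw) // revi_lt.
suff hmu : forall k, (k < r)%N -> mu' k = mu k.
  split=> //; split=> // k kr; first exact: (hw_e hw').
  by rewrite (hw_D hw') // hmu.
have cyc' := cyclic_of_irreducible (grouplike_dual gl) pV_gt0 chevalley_dual
  (irreducible_dual irr) hw' hTw.
have [y1 y10 hy1] := opposite_weight p_gt0 H hw cyc.
have [y2 y20 hy2] := opposite_weight pV_gt0 chevalley_dual hw' cyc'.
have [|u1 [bu1 _ hu1]] := Dweight_word pV_gt0 chevalley_dual hw' cyc' (nu := mu) y10.
  move=> k kr; have := hy1 (revi k) (revi_lt kr); rewrite -/(revi _) reviK //.
  by move/(dnum_revi _ _ kr); rewrite opprK.
have [|u2 [bu2 _ hu2]] := Dweight_word p_gt0 H hw cyc (nu := mu') y20.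
  move=> k kr; have := hy2 (revi k) (revi_lt kr); rewrite -/(revi _) reviK //.
  by move/(dnum_revi _ _ (revi_lt kr)); rewrite reviK.
have s1 := wt_height mu' bu1; have s2 := wt_height mu bu2.
(* [mu] lies below [mu'] by [u1] and [mu'] below [mu] by [u2], so the two heights are opposite, and
   both are nonnegative. *)
have : (size u1)%:Z *+ 2 + (size u2)%:Z *+ 2 = 0.
  rewrite -s1 -s2 -big_split big1 //= => k _.
  by rewrite -hu1 // -hu2 // -mulrDr addrA subrK subrr mulr0.
move=> s0; have su : size u2 = 0%N by lia.
by move=> k kr; rewrite hu2 // (size0nil su) /wt /=; case: (k) => [|k']; lia.
Qed.

End Lowest.
End Duality.

(** * Tensor products *)

Section Tensors.
Variables (R : realType).
Local Notation C := R[i].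

Lemma tensmx_addl m n p q (A B : 'M[C]_(m, n)) (M : 'M[C]_(p, q)) :
  (A + B) *t M = A *t M + B *t M.
Proof. by apply/matrixP => i j; rewrite !mxE mulrDl. Qed.

Lemma tensmx_addr m n p q (A B : 'M[C]_(m, n)) (M : 'M[C]_(p, q)) :
  M *t (A + B) = M *t A + M *t B.
Proof. by apply/matrixP => i j; rewrite !mxE mulrDr. Qed.

Lemma tensmx_scalel m n p q c (A : 'M[C]_(m, n)) (M : 'M[C]_(p, q)) :
  (c *: A) *t M = c *: (A *t M).
Proof. by apply/matrixP => i j; rewrite !mxE mulrA. Qed.

Lemma tensmx_scaler m n p q c (A : 'M[C]_(m, n)) (M : 'M[C]_(p, q)) :
  M *t (c *: A) = c *: (M *t A).
Proof. by apply/matrixP => i j; rewrite !mxE mulrCA. Qed.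

Lemma tensmx_oppl m n p q (A : 'M[C]_(m, n)) (M : 'M[C]_(p, q)) :
  (- A) *t M = - (A *t M).
Proof. by rewrite -scaleN1r tensmx_scalel scaleN1r. Qed.

Lemma tensmx_oppr m n p q (A : 'M[C]_(m, n)) (M : 'M[C]_(p, q)) :
  M *t (- A) = - (M *t A).
Proof. by rewrite -scaleN1r tensmx_scaler scaleN1r. Qed.

Lemma tensmx11 m n : (1%:M : 'M[C]_m) *t (1%:M : 'M[C]_n) = 1%:M.
Proof.
apply/matrixP => i j; case: (mxtens_indexP i) => a b; case: (mxtens_indexP j) => a' b'.
rewrite tensmxE !mxE -natrM mulnb; congr (_%:R); congr nat_of_bool.
rewrite (can_eq (mxtens_indexK (m := m) (n := n))) xpair_eqE //.
Qed.

Lemma sum_mxtens m n (F : 'I_(m * n) -> C) :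
  \sum_k F k = \sum_i \sum_j F (mxtens_index (i, j)).
Proof.
rewrite pair_big /= (reindex (@mxtens_index m n)) /=; last first.
  by exists (@mxtens_unindex m n) => x _; rewrite (mxtens_indexK, mxtens_unindexK).
by apply: eq_bigr => [[i j]].
Qed.

Variables m n : nat.
Implicit Types x : 'cV[C]_(m * n).

(** The second-leg component of [x] along the [i]-th basis vector of the first leg: operators
    [1 (x) B] act slice by slice, so estimates on one leg extend to tensors. *)
Definition row_slice x (i : 'I_m) : 'cV[C]_n := \col_j x (mxtens_index (i, j)) 0.
Definition col_slice x (j : 'I_n) : 'cV[C]_m := \col_i x (mxtens_index (i, j)) 0.

Lemma sqnorm_row_slice x : sqnorm x = \sum_i sqnorm (row_slice x i).
Proof.
apply: complexI; rewrite -dot_sqnorm dotE sum_mxtens rmorph_sum.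
apply: eq_bigr => i _ /=; rewrite -dot_sqnorm dotE; apply: eq_bigr => j _.
by rewrite !mxE.
Qed.

Lemma sqnorm_col_slice x : sqnorm x = \sum_j sqnorm (col_slice x j).
Proof.
apply: complexI; rewrite -dot_sqnorm dotE sum_mxtens rmorph_sum exchange_big.
apply: eq_bigr => i _ /=; rewrite -dot_sqnorm dotE; apply: eq_bigr => j _.
by rewrite !mxE.
Qed.

Lemma row_slice_tens (B : 'M[C]_n) x i :
  row_slice ((1%:M *t B) *m x) i = B *m row_slice x i.
Proof.
apply/matrixP => j k; rewrite !mxE sum_mxtens (bigD1 i) //= [X in _ + X]big1.
  rewrite addr0; apply: eq_bigr => l _.
  by rewrite tensmxE !mxE eqxx mul1r.
move=> a ai; rewrite big1 // => l _.
by rewrite tensmxE mxE eq_sym (negbTE ai) !mul0r.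
Qed.

Lemma col_slice_tens (A : 'M[C]_m) x j :
  col_slice ((A *t 1%:M) *m x) j = A *m col_slice x j.
Proof.
apply/matrixP => i k; rewrite !mxE sum_mxtens exchange_big (bigD1 j) //=.
rewrite [X in _ + X]big1.
  rewrite addr0; apply: eq_bigr => l _.
  by rewrite tensmxE !mxE eqxx mulr1.
move=> a aj; rewrite big1 // => l _.
by rewrite tensmxE !mxE eq_sym (negbTE aj) mulr0 mul0r.
Qed.

Lemma sqnorm_tens_le (A : 'M[C]_m) (k : R) x :
  (forall v, sqnorm (A *m v) <= k * sqnorm v) ->
  sqnorm ((A *t 1%:M) *m x) <= k * sqnorm x.
Proof.
move=> h; rewrite !sqnorm_col_slice mulr_sumr ler_sum // => j _.
by rewrite col_slice_tens.
Qed.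

End Tensors.

Lemma sqnorm_proj_le (R : realType) d (P : 'M[R[i]]_d) v :
  P *m P = P -> adjoint P = P -> sqnorm (P *m v) <= sqnorm v.
Proof.
move=> h1 h2; apply: (sqnorm_orthoproj_le (W := range (fun v => P *m v))).
by split.
Qed.

Section LineProj.
Variables (R : realType) (d : nat) (xi : 'cV[R[i]]_d).
Hypothesis xi0 : xi != 0.

Lemma line_proj_idem : line_proj xi *m line_proj xi = line_proj xi.
Proof. by case: (is_orthoproj_line xi0). Qed.

Lemma line_proj_adj : adjoint (line_proj xi) = line_proj xi.
Proof. by case: (is_orthoproj_line xi0). Qed.

Lemma mul_line_proj (A : 'M[R[i]]_d) c : A *m xi = c *: xi ->
  A *m line_proj xi = c *: line_proj xi.
Proof.
by move=> h; rewrite /line_proj -scalemxAr mulmxA h -scalemxAl !scalerA mulrC.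
Qed.

End LineProj.

Lemma scale_split (K : comPzRingType) (V : lmodType K) (c u : K) (x y : V) :
  (1 + c * u) *: x + u *: y = x + u *: (y + c *: x).
Proof. by rewrite scalerDl scale1r scalerDr scalerA mulrC -addrA [X in _ + X]addrC. Qed.

Section Schur.
Variables (R : realType) (p : R) (d r : nat) (e D : nat -> 'M[R[i]]_d).
Variables (mu : nat -> int) (xi : 'cV[R[i]]_d).
Hypothesis hw : highest_weight p r e D mu xi.
Hypothesis cyc : cyclic r e xi.

(** [A] maps [xi] to a vector killed by all [e k], hence to a multiple of [xi], and words carry the
    scalar to the whole module. *)
Lemma schur (A : 'M[R[i]]_d) :
  (forall k, (k < r)%N -> A *m e k = e k *m A) ->
  (forall k, (k < r)%N -> A *m adjoint (e k) = adjoint (e k) *m A) ->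
  exists c, forall v : 'cV[R[i]]_d, A *m v = c *: v.
Proof.
move=> hA hA'; have [|c hc] := killed_by_e hw cyc (y := A *m xi).
  by move=> k kr; rewrite mulmxA -hA // -mulmxA (hw_e hw) // mulmx0.
exists c => v; have [s bs ->] := cyc v.
have hwd w : all (fun k => k < r)%N w -> A *m word e xi w = c *: word e xi w.
  elim: w => [_|k w IH /= /andP[kr /IH {}IH]]; first by rewrite /word /= mul1mx.
  by rewrite word_cons mulmxA hA' // -mulmxA IH -scalemxAr.
rewrite mulmx_sumr scaler_sumr big_seq [RHS]big_seq; apply: eq_bigr => t ts.
by rewrite -scalemxAr hwd ?(allP bs) // !scalerA mulrC.
Qed.

End Schur.

Section ReversedRootVectors.
Variables (R : realType) (d : nat) (p : R[i]).

(* [rootvec] with reversed products: operators acting on the second leg of a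
   vector killed by the coproducts of the [e_k] are traded for operators on the
   first leg, in the opposite order. *)
Fixpoint rootvec_op (a : nat -> 'M[R[i]]_d) (i m : nat) : 'M[R[i]]_d :=
  if m is m'.+1 then
    a (i + m)%N *m rootvec_op a i m' - p^-1 *: (rootvec_op a i m' *m a (i + m)%N)
  else a i.

End ReversedRootVectors.

Lemma sum_ord_const (R : pzRingType) n (k : R) : \sum_(i < n) k = n%:R * k.
Proof. by rewrite sumr_const card_ord mulr_natl. Qed.

(** * The two estimates in a tensor product *)

Section Estimates.
Variables (R : realType) (p : R) (r : nat).
Hypothesis p_ge1 : 1 <= p.
Let p_gt0 : 0 < p. Proof. exact: lt_le_trans p_ge1. Qed.
Local Notation bounded b := (all (fun k => k < r)%N b).

Variables (dU : nat) (eU DU Th : nat -> 'M[R[i]]_dU) (lam : nat -> int).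
Variable xiU : 'cV[R[i]]_dU.
Hypothesis HU : chevalley p%:C r eU DU.
Hypothesis hwU : highest_weight p r eU DU lam xiU.
Hypothesis cycU : cyclic r eU xiU.
Hypothesis glU : grouplike r eU Th.
Hypothesis hTh : forall k, (k < r)%N -> exists2 c, c != 0 & Th k *m xiU = c *: xiU.

Local Notation aU := (fun k => - (invmx (Th k) *m eU k)).

(** The nilpotency and operator bounds on the first leg, for the [eU k] and for their twists. They
    refer to [V_lambda] alone, so [L] and [K] do not change with [n]. *)
Definition controls (L : nat) (K : R) : Prop := [/\ 0 <= K,
  forall u, bounded u -> (L < size u)%N -> opword eU u = 0,
  forall u, bounded u -> (L < size u)%N -> opword aU u = 0,
  forall i m v, (i < r)%N -> (m < r)%N ->
    sqnorm (rootvec p%:C eU i m *m v) <= K * sqnorm v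
  & forall i m v, (i < r)%N -> (m < r)%N ->
    sqnorm (rootvec_op p%:C aU i m *m v) <= K * sqnorm v].

Lemma controls_exist : exists L K, controls L K.
Proof.
have [L hL] := nilpotent cycU.
have bd (F : nat -> nat -> 'M[R[i]]_dU) : exists2 K : R, 0 <= K &
    forall i m v, (i < r)%N -> (m < r)%N -> sqnorm (F i m *m v) <= K * sqnorm v.
  have /choice[k hk] : forall im : 'I_r * 'I_r, exists k : R, 0 <= k /\
      forall v, sqnorm (F im.1 im.2 *m v) <= k * sqnorm v.
    by move=> im; have [k k0 h] := sqnorm_mulmx_le (F im.1 im.2); exists k.
  exists (\sum_im k im) => [|i m v ir mr].
    by apply: sumr_ge0 => im _; case: (hk im).
  have [_ h] := hk (Ordinal ir, Ordinal mr); apply: le_trans (h v) _.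
  rewrite ler_wpM2r ?sqnorm_ge0 // [leRHS](bigD1 (Ordinal ir, Ordinal mr)) //=.
  by rewrite lerDl sumr_ge0 // => im _; case: (hk im).
have [K1 K10 h1] := bd (rootvec p%:C eU).
have [K2 K20 h2] := bd (rootvec_op p%:C aU).
exists L, (K1 + K2); split.
- by rewrite addr_ge0.
- by apply: hL => k kr; apply: (lowers_e p_gt0 HU hwU).
- apply: hL => k kr; apply: (lowers_glV_e glU) => //; first exact: hTh.
  exact: (lowers_e p_gt0 HU hwU).
- move=> i m v ir mr; apply: le_trans (h1 i m v ir mr) _.
  by rewrite ler_wpM2r ?sqnorm_ge0 // lerDl.
- move=> i m v ir mr; apply: le_trans (h2 i m v ir mr) _.
  by rewrite ler_wpM2r ?sqnorm_ge0 // lerDr.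
Qed.

Variables (L : nat) (K : R).
Hypothesis ctl : controls L K.

Variables (dW : nat) (eW DW : nat -> 'M[R[i]]_dW) (mu : nat -> int).
Variable xiW : 'cV[R[i]]_dW.
Hypothesis HW : chevalley p%:C r eW DW.
Hypothesis hwW : highest_weight p r eW DW mu xiW.
Hypothesis cycW : cyclic r eW xiW.

Definition coprod_e k : 'M[R[i]]_(dU * dW) := eU k *t 1%:M + Th k *t eW k.
(** From [(K (x) K)^2 - 1 = (K^2 - 1) (x) 1 + K^2 (x) (K^2 - 1)]. *)
Definition coprod_D k : 'M[R[i]]_(dU * dW) :=
  DU k *t 1%:M + Ksq p%:C DU k *t DW k.

Local Notation PU := (line_proj xiU).
Local Notation PW := (line_proj xiW).

(** The common consequence of the two cases for [lambda]: the weight is large at the smallest letter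
    of every nonempty word that does not vanish. *)
Definition large_weight (n : nat) (d : nat) (e : nat -> 'M[R[i]]_d) nu xi :=
  forall w, bounded w -> w != [::] -> word e xi w != 0 ->
    exists2 i0, i0 \in w & all (fun k => i0 <= k)%N w /\ n%:Z <= nu i0.

Section SecondLeg.
Variable y : 'cV[R[i]]_(dU * dW).
Hypothesis hy : forall k, (k < r)%N -> coprod_e k *m y = 0.

Lemma second_leg_e k : (k < r)%N -> (1%:M *t eW k) *m y = (aU k *t 1%:M) *m y.
Proof.
move=> kr.
have h1 : (invmx (Th k) *t 1%:M) *m coprod_e k =
    (invmx (Th k) *m eU k) *t 1%:M + 1%:M *t eW k.
  rewrite /coprod_e mulmxDr (tensmx_mul _ 1%:M (eU k)) (tensmx_mul _ 1%:M (Th k)).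
  by rewrite mul1mx mulVmx ?mul1mx //; apply: (gl_unit glU).
have := congr1 (mulmx (invmx (Th k) *t 1%:M)) (hy kr).
rewrite mulmx0 mulmxA h1 mulmxDl => /eqP; rewrite addr_eq0 => /eqP h.
by rewrite tensmx_oppl mulNmx h opprK.
Qed.

Lemma second_leg_mul A A' B B' :
  (1%:M *t A) *m y = (A' *t 1%:M) *m y -> (1%:M *t B) *m y = (B' *t 1%:M) *m y ->
  (1%:M *t (A *m B)) *m y = ((B' *m A') *t 1%:M) *m y.
Proof.
move=> hA hB.
have -> : 1%:M *t (A *m B) = (1%:M *t A) *m (1%:M *t B) :> 'M[R[i]]_(dU * dW).
  by rewrite tensmx_mul mul1mx.
rewrite -mulmxA hB mulmxA tensmx_mul mul1mx mulmx1.
have -> : B' *t A = (B' *t 1%:M) *m (1%:M *t A) :> 'M[R[i]]_(dU * dW).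
  by rewrite tensmx_mul mul1mx mulmx1.
by rewrite -mulmxA hA mulmxA tensmx_mul mulmx1.
Qed.

Lemma second_leg_opword u : bounded u ->
  (1%:M *t opword eW u) *m y = (opword aU (rev u) *t 1%:M) *m y.
Proof.
elim: u => [_|k u IH /= /andP[kr /IH h]]; first by rewrite /= !tensmx11.
by rewrite rev_cons opword_rcons; apply: second_leg_mul (second_leg_e kr) h.
Qed.

Lemma second_leg_rootvec i m : (i + m < r)%N ->
  (1%:M *t rootvec p%:C eW i m) *m y = (rootvec_op p%:C aU i m *t 1%:M) *m y.
Proof.
elim: m => [|m IH] im; first by apply: second_leg_e; lia.
have {}IH := IH ltac:(lia); have he := second_leg_e im.
rewrite rootvecS tensmx_addr -scaleNr tensmx_scaler mulmxDl -scalemxAl.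
rewrite (second_leg_mul IH he) (second_leg_mul he IH).
by rewrite [rootvec_op _ _ _ m.+1]/= -scaleNr tensmx_addl tensmx_scalel mulmxDl
  -scalemxAl.
Qed.

(** [gap] is applied to each slice in the second leg. Summed over the slices, the root terms are
    squared norms of [1 (x) E] on [y], which [second_leg_rootvec] turns into first-leg operators
    bounded by [K]; there are at most [(r + 1)^2] roots. *)
Lemma killed_estimate n : (L * 2 <= n)%N -> large_weight n eW mu xiW ->
  gap_const p r L n * sqnorm ((1%:M - 1%:M *t PW) *m y) <=
  p ^ (L%:Z *+ 2) * ((r.+1 * r.+1)%:R * (K * sqnorm y)).
Proof.
move=> Ln large; case: ctl => K0 hN hN' hR hR'.
have slice i : row_slice ((1%:M - 1%:M *t PW) *m y) i =
    row_slice y i - PW *m row_slice y i.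
  rewrite -row_slice_tens mulmxBl mul1mx; apply/matrixP => j k.
  by rewrite !mxE.
rewrite sqnorm_row_slice mulr_sumr.
apply: (@le_trans _ _ (\sum_i p ^ (L%:Z *+ 2) * rootsum p r eW (row_slice y i))).
  apply: ler_sum => i _; rewrite slice.
  apply: (gap p_gt0 HW hwW cycW p_ge1 _ Ln large).
    exact: (hw_mu_ge0 p_gt0 HW hwW).
  move=> u bu Lu; rewrite -row_slice_tens second_leg_opword // hN' ?size_rev //.
    by rewrite tens0mx mul0mx; apply/matrixP => j k; rewrite !mxE.
  by rewrite all_rev.
rewrite -mulr_sumr ler_wpM2l ?exprz_ge0 ?(ltW p_gt0) //.
rewrite /rootsum exchange_big /= natrM -mulrA.
apply: (@le_trans _ _ (\sum_(i < r.+1) (r.+1)%:R * (K * sqnorm y))); last first.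
  by rewrite sum_ord_const.
apply: ler_sum => i _; rewrite exchange_big /=.
apply: (@le_trans _ _ (\sum_(j < r.+1) (K * sqnorm y))); last first.
  by rewrite sum_ord_const.
apply: ler_sum => j _; have [ij|ij] := ltnP i j; last first.
  by rewrite big1 // mulr_ge0 ?sqnorm_ge0.
under eq_bigr => k _ do rewrite -row_slice_tens.
rewrite -sqnorm_row_slice second_leg_rootvec; last by have := ltn_ord j; clear -ij; lia.
by apply: sqnorm_tens_le => v; apply: hR'; have := ltn_ord j; lia.
Qed.

End SecondLeg.

Variables (dX : nat) (eX DX : nat -> 'M[R[i]]_dX).
Variable xiX : 'cV[R[i]]_dX.
Hypothesis HX : chevalley p%:C r eX DX.
Hypothesis hwX : highest_weight p r eX DX (fun k => lam k + mu k) xiX.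
Hypothesis cycX : cyclic r eX xiX.

Section CartanComponent.
Variables (F : 'M[R[i]]_(dU * dW)) (S : 'M[R[i]]_(dU * dW, dX)).
Hypothesis F_idem : F *m F = F.
Hypothesis F_adj : adjoint F = F.
Hypothesis F_range : forall x : 'cV[R[i]]_(dU * dW),
  exists v : 'cV[R[i]]_dX, F *m x = S *m v.
Hypothesis F_id : F *m S = S.
Hypothesis F_comm : forall k, (k < r)%N -> F *m coprod_e k = coprod_e k *m F.
Hypothesis S_inj : forall v : 'cV[R[i]]_dX, S *m v = 0 -> v = 0.
Hypothesis S_e : forall k, (k < r)%N -> S *m eX k = coprod_e k *m S.
Hypothesis S_eJ : forall k, (k < r)%N ->
  S *m adjoint (eX k) = adjoint (coprod_e k) *m S.
Hypothesis S_D : forall k, (k < r)%N -> S *m DX k = coprod_D k *m S.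

(** [S] is only an intertwiner, but [adjoint S *m S] commutes with the [eX k] and their adjoints, so
    [schur] makes it a scalar. *)
Lemma S_isometric : exists2 c : R, 0 < c &
  forall u v, dot (S *m u) (S *m v) = c%:C * dot u v.
Proof.
have [||c hc] := schur hwX cycX (A := adjoint S *m S).
- move=> k kr; rewrite -mulmxA S_e // mulmxA -[coprod_e k]adjointK -adjointM.
  by rewrite -S_eJ // adjointM adjointK mulmxA.
- move=> k kr; rewrite -mulmxA S_eJ // mulmxA -adjointM -S_e //.
  by rewrite adjointM mulmxA.
have hd u v : dot (S *m u) (S *m v) = c * dot u v.
  by rewrite dot_adjointl mulmxA hc dotZr.
have x0 := hw_neq0 hwX; have sx0 := sqnorm_gt0 x0.
have Sx0 : S *m xiX != 0 by apply: contra_neq x0; exact: S_inj.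
exists (sqnorm (S *m xiX) / sqnorm xiX).
  by rewrite divr_gt0 // sqnorm_gt0.
move=> u v; rewrite hd; congr (_ * _).
rewrite rmorphM fmorphV /= -!dot_sqnorm hd mulfK //.
exact: dot_self_neq0.
Qed.

Local Notation cut := ((1%:M - PU) *t PW).

(** [S xiX] has weight [lam + mu]. Projecting its second leg to the line of weight [mu] leaves a
    first leg of weight [lam], which lies on the line of [xiU] by [Dweight_top]. *)
Lemma cut_top : cut *m (S *m xiX) = 0.
Proof.
have xU0 := hw_neq0 hwU; have xW0 := hw_neq0 hwW.
set z := S *m xiX; set z' := (1%:M *t PW) *m z.
have DP k : (k < r)%N -> PW *m DW k = (dnum p (mu k))%:C *: PW.
  move=> kr; rewrite -[PW]line_proj_adj // -[DW k](chev_DJ HW) // -adjointM.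
  by rewrite (mul_line_proj (hw_D hwW kr)) adjointZ conjc_real line_proj_adj.
have hz' k : (k < r)%N -> (DU k *t 1%:M) *m z' = (dnum p (lam k))%:C *: z'.
  move=> kr; have hz : coprod_D k *m z = (dnum p (lam k + mu k))%:C *: z.
    by rewrite /z mulmxA -S_D // -mulmxA (hw_D hwX) // -scalemxAr.
  have := congr1 (mulmx (1%:M *t PW)) hz.
  rewrite mulmxA mulmxDr !tensmx_mul !mul1mx mulmx1 DP //.
  rewrite -scalemxAr -/z' mulmxDl [_ *t (_%:C *: _)]tensmx_scaler.
  rewrite -[(_%:C *: (_ *t _)) *m z]scalemxAl.
  have e1 (A : 'M[R[i]]_dU) : (A *t PW) *m z = (A *t 1%:M) *m z'.
    by rewrite /z' mulmxA tensmx_mul mulmx1 mul1mx.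
  rewrite !e1 /Ksq tensmx_addl tensmx11 tensmx_scalel mulmxDl.
  rewrite mul1mx -scalemxAl dnumD // => h.
  have k0 : (p ^ (mu k *+ 2))%:C != 0.
    by rewrite fmorph_eq0 expfz_neq0 // gt_eqF.
  have hK : (p ^ (mu k *+ 2))%:C =
      1 + (p%:C - (p%:C)^-1) * (dnum p (mu k))%:C.
    by rewrite -dnum_ksq // rmorphD rmorph1 rmorphM rmorphB fmorphV.
  (* Multiplied by [p^(2 mu_k)] and increased by the eigenvalue at [mu_k], both sides become the
     action of [coprod_D k] at [lam_k + mu_k], by [dnumD]. *)
  apply: (scalerI k0); apply: (addIr ((dnum p (mu k))%:C *: z')).
  rewrite scalerA -scalerDl -rmorphM -rmorphD -h {1}hK.
  exact: scale_split.
have hU : (PU *t 1%:M) *m z' = z'.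
  apply/eqP; rewrite -subr_eq0; apply/eqP/sqnorm_eq0.
  rewrite sqnorm_col_slice big1 // => j _.
  have -> : col_slice ((PU *t 1%:M) *m z' - z') j = 
     PU *m col_slice z' j - col_slice z' j.
    by rewrite -col_slice_tens; apply/matrixP => a b; rewrite !mxE.
  rewrite (Dweight_top p_gt0 HU hwU cycU) ?subrr ?sqnorm0 // => k kr.
  rewrite -col_slice_tens hz' //; apply/matrixP => a b; by rewrite !mxE.
have -> : cut = ((1%:M - PU) *t 1%:M) *m (1%:M *t PW).
  by rewrite tensmx_mul mulmx1 mul1mx.
by rewrite -mulmxA -/z' tensmx_addl tensmx_oppl tensmx11 mulmxBl mul1mx hU subrr.
Qed.

Section FirstLeg.
Variable y : 'cV[R[i]]_(dU * dW).
Hypothesis hy : forall k, (k < r)%N -> (1%:M *t eW k) *m y = 0.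

Lemma cut_acts (A B : 'M[R[i]]_(dU * dW)) (A' B' : 'M[R[i]]_dU) :
  (forall M, A *m ((M *t 1%:M) *m y) = ((A' *m M) *t 1%:M) *m y) ->
  (forall M, B *m ((M *t 1%:M) *m y) = ((B' *m M) *t 1%:M) *m y) ->
  forall M, (A *m B) *m ((M *t 1%:M) *m y) = ((A' *m B' *m M) *t 1%:M) *m y.
Proof. by move=> hA hB M; rewrite -(mulmxA A B) hB hA (mulmxA A' B'). Qed.

Lemma cut_acts_e k M : (k < r)%N ->
  coprod_e k *m ((M *t 1%:M) *m y) = ((eU k *m M) *t 1%:M) *m y.
Proof.
move=> kr; rewrite mulmxA /coprod_e mulmxDl (tensmx_mul (eU k)).
rewrite (tensmx_mul (Th k)) mul1mx mulmx1 mulmxDl.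
have -> : (Th k *m M) *t eW k = ((Th k *m M) *t 1%:M) *m (1%:M *t eW k).
  by rewrite tensmx_mul mulmx1 mul1mx.
by rewrite -(mulmxA _ (1%:M *t eW k)) hy // mulmx0 addr0.
Qed.

Lemma cut_acts_opword u M : bounded u ->
  opword coprod_e u *m ((M *t 1%:M) *m y) = ((opword eU u *m M) *t 1%:M) *m y.
Proof.
elim: u M => [|k u IH] M /=; first by rewrite !mul1mx.
move=> /andP[kr bu]; apply: cut_acts => N; last exact: IH.
exact: cut_acts_e.
Qed.

Lemma cut_acts_rootvec i m M : (i + m < r)%N ->
  rootvec p%:C coprod_e i m *m ((M *t 1%:M) *m y) =
    ((rootvec p%:C eU i m *m M) *t 1%:M) *m y.
Proof.
elim: m M => [|m IH] M im; first by apply: cut_acts_e; lia.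
have hE := fun N => IH N ltac:(lia); have he := fun N => cut_acts_e N im.
rewrite !rootvecS mulmxBl -scalemxAl (cut_acts hE he) (cut_acts he hE).
by rewrite mulmxBl -scalemxAl tensmx_addl tensmx_oppl tensmx_scalel mulmxBl
  -scalemxAl.
Qed.

End FirstLeg.

Lemma S_opword u : bounded u -> S *m opword eX u = opword coprod_e u *m S.
Proof.
elim: u => [_|k u IH /= /andP[kr /IH h]]; first by rewrite /= mulmx1 mul1mx.
by rewrite mulmxA S_e // -mulmxA h mulmxA.
Qed.

Lemma F_opword u : bounded u -> F *m opword coprod_e u = opword coprod_e u *m F.
Proof.
elim: u => [_|k u IH /= /andP[kr /IH h]]; first by rewrite /= mulmx1 mul1mx.
by rewrite mulmxA F_comm // -mulmxA h mulmxA.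
Qed.

Lemma S_rootvec i m : (i + m < r)%N ->
  S *m rootvec p%:C eX i m = rootvec p%:C coprod_e i m *m S.
Proof.
elim: m => [|m IH] im; first by apply: S_e; lia.
have {}IH := IH ltac:(lia); have he := S_e im.
rewrite !rootvecS mulmxBr mulmxBl -scalemxAr -scalemxAl.
by rewrite [S *m (_ *m _)]mulmxA IH -mulmxA he [S *m (_ *m _)]mulmxA he
  -[_ *m S *m _]mulmxA IH !mulmxA.
Qed.

Lemma F_rootvec i m : (i + m < r)%N ->
  F *m rootvec p%:C coprod_e i m = rootvec p%:C coprod_e i m *m F.
Proof.
elim: m => [|m IH] im; first by apply: F_comm; lia.
have {}IH := IH ltac:(lia); have he := F_comm im.
rewrite !rootvecS mulmxBr mulmxBl -scalemxAr -scalemxAl.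
by rewrite [F *m (_ *m _)]mulmxA IH -mulmxA he [F *m (_ *m _)]mulmxA he
  -[_ *m F *m _]mulmxA IH !mulmxA.
Qed.

Lemma cartan_estimate n x : (L * 2 <= n)%N ->
  large_weight n eX (fun k => lam k + mu k) xiX ->
  gap_const p r L n * sqnorm (F *m cut *m x) <=
  p ^ (L%:Z *+ 2) * ((r.+1 * r.+1)%:R * (K * sqnorm x)).
Proof.
move=> Ln large; case: ctl => K0 hN hN' hR hR'.
have [c c0 hS] := S_isometric.
have sS v : sqnorm (S *m v) = c * sqnorm v.
  by apply: complexI; rewrite rmorphM /= -!dot_sqnorm hS.
have xU0 := hw_neq0 hwU; have xW0 := hw_neq0 hwW.
have cut_adj : adjoint cut = cut.
  by rewrite adjoint_tens adjointB adjoint1 !line_proj_adj.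
have cut_idem : cut *m cut = cut.
  rewrite tensmx_mul line_proj_idem // mulmxBl mul1mx mulmxBr mulmx1.
  by rewrite line_proj_idem // subrr subr0.
set y := cut *m x.
have hy k : (k < r)%N -> (1%:M *t eW k) *m y = 0.
  move=> kr; rewrite /y mulmxA tensmx_mul (mul_line_proj (c := 0)).
    by rewrite scale0r tensmx0 mul0mx.
  by rewrite scale0r (hw_e hwW).
have yx : sqnorm y <= sqnorm x by exact: sqnorm_proj_le.
have y1 : (1%:M *t 1%:M) *m y = y by rewrite tensmx11 mul1mx.
rewrite -mulmxA -/y; have [v hv] := F_range y; rewrite hv sS.
(* Up to the factor [c], the inner product of [xiX] and [v] is that of [S xiX] and [cut x]; [cut] is
   self-adjoint and kills [S xiX]. *)
have Pv : line_proj xiX *m v = 0.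
  rewrite line_projE; suff -> : dot xiX v = 0 by rewrite mul0r scale0r.
  have ccn : c%:C != 0 by rewrite fmorph_eq0 gt_eqF.
  apply: (mulfI ccn); rewrite -hS -hv mulr0 dot_adjointr F_adj.
  by rewrite (mulmxA F) F_id /y dot_adjointr cut_adj cut_top dot0l.
have gp := gap p_gt0 HX hwX cycX p_ge1 (hw_mu_ge0 p_gt0 HX hwX) Ln large (y := v).
rewrite Pv subr0 in gp; rewrite mulrCA.
apply: (@le_trans _ _ (c * (p ^ (L%:Z *+ 2) * rootsum p r eX v))).
  (* Long words kill [v] because they kill [S v = F y]: passed through [F], they act on the first
     leg of [y] alone. *)
  rewrite ler_pM2l //; apply: gp => u bu Lu; apply: S_inj.
  rewrite mulmxA S_opword // -mulmxA -hv mulmxA -F_opword // -mulmxA.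
  by rewrite -{1}y1 (cut_acts_opword hy) // mulmx1 hN // tens0mx mul0mx mulmx0.
rewrite mulrCA ler_wpM2l ?exprz_ge0 ?(ltW p_gt0) //.
have -> : c * rootsum p r eX v = \sum_(i < r.+1) \sum_(j < r.+1)
    (if (i < j)%N then sqnorm (S *m (rootvec p%:C eX i (j - i.+1) *m v)) else 0).
  rewrite /rootsum mulr_sumr; apply: eq_bigr => i _; rewrite mulr_sumr.
  by apply: eq_bigr => j _; case: ifP; rewrite ?mulr0 // sS.
rewrite natrM -mulrA.
apply: (@le_trans _ _ (\sum_(i < r.+1) (r.+1)%:R * (K * sqnorm x))); last first.
  by rewrite sum_ord_const.
apply: ler_sum => i _.
apply: (@le_trans _ _ (\sum_(j < r.+1) (K * sqnorm x))); last first.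
  by rewrite sum_ord_const.
apply: ler_sum => j _; case: ifP => ij; last by rewrite mulr_ge0 ?sqnorm_ge0.
have im : (i + (j - i.+1) < r)%N by have := ltn_ord j; clear -ij; lia.
rewrite mulmxA S_rootvec // -mulmxA -hv mulmxA -F_rootvec // -mulmxA.
apply: le_trans (sqnorm_proj_le _ F_idem F_adj) _.
rewrite -{1}y1 (cut_acts_rootvec hy) // mulmx1.
apply: (@le_trans _ _ (K * sqnorm y)); last by rewrite ler_wpM2l.
by apply: sqnorm_tens_le => u; apply: hR; clear -im; lia.
Qed.

End CartanComponent.
End Estimates.

(** * From U_q sl_N-modules to their Chevalley operators *)

(** A subspace of maximal dimension among those contained in [Q] exhausts [Q]. This links
    simplicity, stated for subspaces, with [irreducible], stated for predicates. *)
Lemma vspace_of_pred (K : fieldType) (vT : vectType K) (Q : vT -> Prop) :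
  Q 0 -> (forall c u v, Q u -> Q v -> Q (c *: u + v)) ->
  exists W : {vspace vT}, forall v, v \in W <-> Q v.
Proof.
move=> Q0 Qlin.
pose T n := `[< exists W : {vspace vT}, (forall v, v \in W -> Q v) /\ \dim W = n >].
have T0 : exists n, T n.
  exists 0%N; apply/asboolP; exists 0%VS; split; last exact: dimv0.
  by move=> v; rewrite memv0 => /eqP ->.
have TL n : T n -> (n <= \dim {:vT})%N.
  by move=> /asboolP[W [_ <-]]; apply/dimvS/subvf.
case: (ex_maxnP T0 TL) => n /asboolP[W [WQ dW]] nmax.
exists W => v; split=> [/WQ//|Qv]; apply: contrapT => /negP vW.
have : T (\dim (<[v]> + W)%VS).
  apply/asboolP; exists (<[v]> + W)%VS; split=> // u /memv_addP[x /vlineP[c ->]].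
  by move=> [w /WQ Qw ->]; apply: Qlin.
move=> /nmax; rewrite -dW; have -> // : (\dim (<[v]> + W) <= \dim W)%N = false.
apply/negbTE; rewrite -ltnNge; have sub := addvSr <[v]> W.
rewrite ltn_neqAle dimvS // andbT; apply: contraNneq vW => eqd.
have /eqP eW : (W == <[v]> + W)%VS by rewrite eqEdim sub eqd leqnn.
by rewrite eW (subvP (addvSl _ _)) // memv_line.
Qed.

Lemma orthoproj_unique (R : realType) d (W : set 'cV[R[i]]_d) (P Q : 'M[R[i]]_d) :
  is_orthoproj W P -> is_orthoproj W Q -> P = Q.
Proof.
move=> hP hQ.
have ext (A B : 'M[R[i]]_d) : (forall v : 'cV[R[i]]_d, A *m v = B *m v) -> A = B.
  move=> h; apply/matrixP => i j; have := congr1 (fun M : 'cV[R[i]]_d => M i 0)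
    (h (delta_mx j 0)).
  by rewrite -!colE !mxE.
have PQ : P *m Q = Q.
  by apply: ext => v; rewrite -mulmxA (orthoproj_id hP) //; exact: (orthoproj_in hQ).
have QP : Q *m P = P.
  by apply: ext => v; rewrite -mulmxA (orthoproj_id hQ) //; exact: (orthoproj_in hP).
by rewrite -{1}QP -(orthoproj_adj hQ) -{1}(orthoproj_adj hP) -adjointM PQ.
Qed.

Section Module.
Variables (R : realType) (N' : nat).
Local Notation N := N'.+2.
Local Notation r := N'.+1.
Variables (q : R).
Hypothesis q_gt0 : 0 < q.
Implicit Types V : genops R N.

Definition mod_e V k : 'M[R[i]]_(Defs.dim V) := opE V (inord k).
Definition mod_D V k : 'M[R[i]]_(Defs.dim V) :=
  if q == 1 then opT V (inord k)
  else (q%:C - (q%:C)^-1)^-1 *: (opT V (inord k) *m opT V (inord k) - 1%:M).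
Definition mod_Th V k : 'M[R[i]]_(Defs.dim V) :=
  if q == 1 then 1%:M else opT V (inord k).
Definition weight_nat (mu : weight N) (k : nat) : int := mu (inord k).

Let inordE k : (k < r)%N -> (inord k : 'I_r) = k :> nat.
Proof. exact: inordK. Qed.

Lemma cartan_self i : cartan (N := N) (inord i) (inord i) = 2.
Proof. by rewrite /cartan eqxx. Qed.

Lemma cartan_neighbors i j : (i < r)%N -> (j < r)%N -> neighbors i j ->
  cartan (N := N) (inord i) (inord j) = -1.
Proof.
move=> ir jr; rewrite /cartan /neighbors => ij.
rewrite -val_eqE /= !inordE //; have -> : (i == j) = false by lia.
by rewrite orbC ij.
Qed.

Lemma cartan_apart i j : (i < r)%N -> (j < r)%N -> apart i j ->
  cartan (N := N) (inord i) (inord j) = 0.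
Proof.
move=> ir jr; rewrite /cartan /apart => ij.
rewrite -val_eqE /= !inordE // !ifF //; lia.
Qed.

Let q0 : q != 0. Proof. by rewrite gt_eqF. Qed.
Let Q0 : q%:C != 0. Proof. by rewrite fmorph_eq0. Qed.

Let Q2 : q%:C ^+ 2 + 1 != 0.
Proof.
rewrite -rmorphXn -[1](rmorph1 (real_complex R)) -rmorphD fmorph_eq0 gt_eqF //.
by rewrite ltr_wpDl // exprn_ge0 // ltW.
Qed.

Section Quantum.
Hypothesis q1 : q != 1.
Variable V : genops R N.
Hypothesis Vmod : quantum_relations q V.
Hypothesis Vstar : is_star q V.
Local Notation E i := (opE V i).
Local Notation F i := (opF V i).
Local Notation T i := (opT V i).
Local Notation z := (q%:C).

Let k0 : z - z^-1 != 0.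
Proof. by rewrite -fmorphV -rmorphB fmorph_eq0 dnum_den_neq0. Qed.

Lemma quantum_unit i : T i \in unitmx. Proof. by case: Vmod. Qed.

Lemma quantum_adj i :
  [/\ adjoint (T i) = T i, adjoint (E i) = F i *m T i
    & adjoint (F i) = invmx (T i) *m E i].
Proof. by have := Vstar i; rewrite (negbTE q1) => -[-> [-> ->]]. Qed.

Lemma quantum_TE i j : T i *m E j = z ^ cartan i j *: (E j *m T i).
Proof.
have [_ /(_ i j)[_ h _ _ _]] := Vmod.
by rewrite scalemxAl -h -!mulmxA mulVmx ?quantum_unit // mulmx1.
Qed.

Lemma quantum_TF i j : T i *m F j = z ^ (- cartan i j) *: (F j *m T i).
Proof.
have [_ /(_ i j)[_ _ h _ _]] := Vmod.
by rewrite scalemxAl -h -!mulmxA mulVmx ?quantum_unit // mulmx1.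
Qed.

Lemma quantum_adjE i : adjoint (E i) = z ^+ 2 *: (T i *m F i).
Proof.
have [_ -> _] := quantum_adj i; rewrite quantum_TF /cartan eqxx scalerA.
rewrite -[z ^ (- 2)]/(z ^- 2) mulfV ?scale1r //.
by rewrite expf_neq0.
Qed.

(** Since [adjoint (E j) = F_j K_j], this is the relation for [E_i F_j - F_j E_i] multiplied by
    [K_j] on the right; [K - K^-1] becomes [K^2 - 1], the origin of [D]. *)
Lemma quantum_E_adjE i j : E i *m adjoint (E j) =
  z ^ (- cartan j i) *: (adjoint (E j) *m E i) +
  (i == j)%:R *: ((z - z^-1)^-1 *: (T i *m T i - 1%:M)).
Proof.
have [_ hE _] := quantum_adj j; rewrite hE.
have [_ /(_ i j)[_ _ _ h _]] := Vmod.
have -> : E i *m (F j *m T j) = (E i *m F j - F j *m E i) *m T j + F j *m (E i *m T j).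
  by rewrite mulmxBl !mulmxA subrK.
have ET : E i *m T j = z ^ (- cartan j i) *: (T j *m E i).
  by rewrite quantum_TE scalerA -expfzDr // addNr expr0z scale1r.
rewrite h ET -scalemxAr mulmxA addrC; congr (_ + _).
case: eqP => [->|_]; last by rewrite mul0r !scale0r mul0mx.
by rewrite mul1r scale1r -scalemxAl mulmxBl mulVmx ?quantum_unit.
Qed.

Lemma chevalley_quantum : chevalley z r (mod_e V) (mod_D V).
Proof.
have [_ rel] := Vmod.
have TTE i j : T i *m T i *m E j = z ^ (cartan i j *+ 2) *: (E j *m (T i *m T i)).
  rewrite -mulmxA quantum_TE -scalemxAr (mulmxA (T i) (E j)) quantum_TE -scalemxAl.
  by rewrite scalerA -expfzDr // -mulr2n -!mulmxA.
rewrite /mod_e /mod_D (negbTE q1); split => //.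
- exact: conjc_real.
- move=> i _; rewrite adjointZ adjointB adjointM adjoint1.
  have [-> _ _] := quantum_adj (inord i); congr (_ *: _).
  by rewrite -fmorphV -rmorphB -fmorphV conjc_real.
- move=> i ir; rewrite quantum_E_adjE cartan_self eqxx scale1r //.
- move=> i j ir jr ij; rewrite quantum_E_adjE.
  rewrite cartan_neighbors // 1?/neighbors 1?orbC // opprK.
  have -> : (inord i == inord j :> 'I_r) = false.
    by rewrite -val_eqE /= !inordE //; move: ij; rewrite /neighbors; lia.
  by rewrite scale0r addr0.
- move=> i j ir jr ij; rewrite quantum_E_adjE.
  rewrite cartan_apart // 1?/apart 1?orbC // oppr0 expr0z scale1r.
  have -> : (inord i == inord j :> 'I_r) = false.
    by rewrite -val_eqE /= !inordE //; move: ij; rewrite /apart; lia.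
  by rewrite scale0r addr0.
- move=> i ir; have := TTE (inord i) (inord i); rewrite cartan_self.
  rewrite -[z ^ _]/(z ^+ 4); move: (E _) (T _) => x t /eq_sub0.
  set h := _ - _ => eh.
  apply: (@eq_of_cert _ _ _ ((z - z^-1)^-1 *: h)); first by rewrite eh; nc_zero.
  rewrite /h; have k0' := k0.
  have e4 : z ^+ 4 - 1 = (z - z^-1) * (z ^+ 3 + z) by field.
  have -> : z ^+ 3 + z = (z - z^-1)^-1 * (z ^+ 4 - 1) by rewrite e4 mulrA mulVf ?mul1r.
  move: (z - z^-1) k0' => g g0; nc_ring; by field.
- move=> i j ir jr ij; have := TTE (inord i) (inord j); rewrite cartan_neighbors //.
  rewrite -[z ^ _]/(z ^- 2); move: (E _) (T _) => x t /eq_sub0.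
  set h := _ - _ => eh.
  apply: (@eq_of_cert _ _ _ ((z - z^-1)^-1 *: h)); first by rewrite eh; nc_zero.
  rewrite /h; have k0' := k0.
  have e4 : 1 - z ^- 2 = (z - z^-1) * z^-1 by field.
  have -> : z^-1 *: x = ((z - z^-1)^-1 * (1 - z ^- 2)) *: x.
    by rewrite e4 mulrA mulVf ?mul1r.
  move: (z ^- 2) (z - z^-1) k0' => y g g0; nc_ring; by field.
- move=> i j ir jr ij; have := TTE (inord i) (inord j); rewrite cartan_apart //.
  rewrite mul0rn expr0z scale1r => h.
  by rewrite -scalemxAl -scalemxAr mulmxBl mulmxBr h mul1mx mulmx1.
- move=> i j ir jr ij; have [_ _ _ _ [[_ h] _]] := rel (inord i) (inord j).
  by apply: h; rewrite cartan_neighbors.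
- move=> i j ir jr ij; have [_ _ _ _ [[h _] _]] := rel (inord i) (inord j).
  by apply: h; rewrite cartan_apart.
Qed.

End Quantum.

Section Classical.
Hypothesis q1 : q = 1.
Variable V : genops R N.
Hypothesis Vmod : classical_relations V.
Hypothesis Vstar : is_star q V.

Lemma elem_mxM (a b c d : nat) : (b < N)%N ->
  elem_mx R N a b *m elem_mx R N c d = (b == c)%:R *: elem_mx R N a d.
Proof.
move=> bN; apply/matrixP => i j; rewrite !mxE (bigD1 (Ordinal bN)) //= big1 ?addr0.
  by rewrite !mxE /= eqxx andbT -!natrM !mulnb; congr (_%:R); case: (_ == a); case: (b == c); case: (_ == d).
move=> k; rewrite -val_eqE /= => kb; rewrite !mxE [(k : nat) == b](negbTE kb).
by rewrite andbF mul0r.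
Qed.

Lemma elem_mx_tr (a b : nat) : (a < N)%N -> (b < N)%N ->
  \tr (elem_mx R N a b) = (a == b)%:R.
Proof.
move=> aN bN; rewrite /mxtrace (bigD1 (Ordinal aN)) //= big1 ?addr0.
  by rewrite !mxE eqxx.
by move=> k; rewrite -val_eqE /= !mxE => /negbTE ->.
Qed.

(** [rho] is controlled on traceless matrices only, so each relation is checked for matrix units and
    carried over by [bre] or [comm] together with the vanishing of the traces. *)
Lemma chevalley_classical : chevalley q%:C r (mod_e V) (mod_D V).
Proof.
have [rho [lin br] hV] := Vmod.
have tr_br (x y : 'M[R[i]]_N) : \tr (x *m y - y *m x) = 0.
  by rewrite raddfB /= mxtrace_mulC subrr.
have rho0 : rho 0 = 0.
  have := lin 1 0 0 (mxtrace0 _ _) (mxtrace0 _ _).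
  by rewrite !scale1r addr0 => /esym/eqP; rewrite -subr_eq0 addrK => /eqP.
have rhoZ c x : \tr x = 0 -> rho (c *: x) = c *: rho x.
  by move=> tx; rewrite -[c *: x]addr0 lin ?mxtrace0 // rho0 addr0.
have star i := Vstar (inord i : 'I_r).
rewrite q1 eqxx in star.
pose x i := elem_mx R N i i.+1; pose y i := elem_mx R N i.+1 i.
pose h i := elem_mx R N i i - elem_mx R N i.+1 i.+1.
have tx i : (i < r)%N -> \tr (x i) = 0.
  by move=> ir; rewrite elem_mx_tr //; [case: eqP => //; lia | lia].
have ty i : (i < r)%N -> \tr (y i) = 0.
  by move=> ir; rewrite elem_mx_tr //; [case: eqP => //; lia | lia].
have th i : (i < r)%N -> \tr (h i) = 0.
  by move=> ir; rewrite raddfB /= !elem_mx_tr ?eqxx ?subrr //; lia.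
have e_ i : (i < r)%N -> mod_e V i = rho (x i).
  by move=> ir; rewrite /mod_e; have [-> _ _] := hV (inord i); rewrite inordE.
have D_ i : (i < r)%N -> mod_D V i = rho (h i).
  by move=> ir; rewrite /mod_D q1 eqxx; have [_ _ ->] := hV (inord i); rewrite inordE.
have f_ i : (i < r)%N -> adjoint (mod_e V i) = rho (y i).
  move=> ir; rewrite /mod_e; have [_ [-> _]] := star i.
  by have [_ -> _] := hV (inord i); rewrite inordE.
have rq : real_complex R q = 1 by rewrite q1 rmorph1.
have bre A B c X : \tr A = 0 -> \tr B = 0 -> \tr X = 0 ->
    A *m B - B *m A = c *: X -> rho A *m rho B = rho B *m rho A + c *: rho X.
  move=> tA tB tX e; rewrite -rhoZ // -e br //.
  by rewrite addrC subrK.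
have delta (a b c d : nat) : (b < N)%N -> (d < N)%N ->
  elem_mx R N a b *m elem_mx R N c d - elem_mx R N c d *m elem_mx R N a b
   = (b == c)%:R *: elem_mx R N a d - (d == a)%:R *: elem_mx R N c b.
  by move=> bN dN; rewrite !elem_mxM.
have comm A B : \tr A = 0 -> \tr B = 0 -> A *m B - B *m A = 0 ->
    rho A *m rho B = rho B *m rho A.
  move=> tA tB e; have := bre A B 0 0 tA tB (mxtrace0 _ _).
  by rewrite scaler0 scale0r addr0; apply.
have bT : true%:R = 1 :> R[i] by [].
have bF : false%:R = 0 :> R[i] by [].
have hx i j : (i < r)%N -> (j < r)%N -> h i *m x j - x j *m h i =
    ((i == j)%:R - (i.+1 == j)%:R - (j.+1 == i)%:R + (j.+1 == i.+1)%:R) *: x j.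
  move=> ir jr; transitivity
    ((elem_mx R N i i *m x j - x j *m elem_mx R N i i) -
     (elem_mx R N i.+1 i.+1 *m x j - x j *m elem_mx R N i.+1 i.+1)).
    by rewrite /h; nc_ring; ring.
  rewrite (delta i i j j.+1) ?(delta i.+1 i.+1 j j.+1); try lia.
  rewrite [j.+1 == i.+1]eq_sym.
  have [->|ij] := eqVneq i j.
    have -> : (j.+1 == j) = false by lia.
    rewrite !eqxx !scale0r !scale1r.
    by apply/matrixP => s t; rewrite !mxE ?bT ?bF; ring.
  have [ij1|ij1] := eqVneq i.+1 j.
    have -> : (j.+1 == i) = false by lia.
    have -> : (i.+1 == j.+1) = false by lia.
    rewrite -ij1 ?eqxx !scale0r !scale1r.
    by apply/matrixP => s t; rewrite !mxE ?bT ?bF; ring.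
  have [ij2|ij2] := eqVneq j.+1 i.
    have -> : (i.+1 == j.+1) = false by lia.
    rewrite -ij2 ?eqxx !scale0r !scale1r.
    by apply/matrixP => s t; rewrite !mxE ?bT ?bF; ring.
  have -> : (i.+1 == j.+1) = false by lia.
  rewrite !scale0r.
  by apply/matrixP => s t; rewrite !mxE ?bT ?bF; ring.
rewrite rq; split.
- exact: oner_neq0.
- exact: rmorph1.
- by move: Q2; rewrite rq.
- by move=> i ir; rewrite /mod_D q1 eqxx; have [-> _] := star i.
- move=> i ir; rewrite f_ // e_ // D_ // expr1n invr1 scale1r.
  rewrite (bre _ _ 1 (h i)) ?scale1r ?tx ?ty ?th //.
  by rewrite (delta i i.+1 i.+1 i) ?eqxx ?scale1r //; lia.
- move=> i j ir jr ij; rewrite f_ // e_ // scale1r comm ?tx ?ty //.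
  rewrite (delta i i.+1 j.+1 j) //; try lia.
  have -> : (i.+1 == j.+1) = false by move: ij; rewrite /neighbors; lia.
  have -> : (j == i) = false by move: ij; rewrite /neighbors; lia.
  by rewrite !scale0r subrr.
- move=> i j ir jr ij; rewrite f_ // e_ // comm ?tx ?ty //.
  rewrite (delta i i.+1 j.+1 j) //; try lia.
  have -> : (i.+1 == j.+1) = false by move: ij; rewrite /apart; lia.
  have -> : (j == i) = false by move: ij; rewrite /apart; lia.
  by rewrite !scale0r subrr.
- move=> i ir; rewrite e_ // D_ // (bre (h i) (x i) 2 (x i)) ?tx ?th //; last first.
    rewrite hx // !eqxx; have -> : (i.+1 == i) = false by lia.
    by congr (_ *: _); rewrite ?bT ?bF; ring.
  by rewrite !expr1n scale1r; congr (_ + _ *: _); ring.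
- move=> i j ir jr ij; rewrite e_ // D_ // (bre _ _ (-1) (x j)) ?tx ?th //.
    by rewrite expr1n invr1 !scale1r scaleN1r.
  rewrite hx //; congr (_ *: _).
  have -> : (i == j) = false by move: ij; rewrite /neighbors; lia.
  have -> : (j.+1 == i.+1) = false by move: ij; rewrite /neighbors; lia.
  move: ij; rewrite /neighbors => /orP[] /eqP ->; rewrite eqxx.
    have -> : (i.+2 == i) = false by lia.
    by rewrite bT bF; ring.
  have -> : (j.+2 == j) = false by lia.
  by rewrite bT bF; ring.
- move=> i j ir jr ij; rewrite e_ // D_ // comm ?tx ?th // hx //.
  have -> : (i == j) = false by move: ij; rewrite /apart; lia.
  have -> : (j.+1 == i.+1) = false by move: ij; rewrite /apart; lia.
  have -> : (i.+1 == j) = false by move: ij; rewrite /apart; lia.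
  have -> : (j.+1 == i) = false by move: ij; rewrite /apart; lia.
  by rewrite !subr0 addr0 scale0r.
- move=> i j ir jr ij; rewrite !e_ // invr1.
  (* At [p = 1] the Serre relation is the vanishing of the double bracket; [w] is the inner one. *)
  pose w := x i *m x j - x j *m x i.
  have hw : x i *m w - w *m x i = 0.
    rewrite /w !(delta i i.+1 j j.+1) //; try lia.
    rewrite mulmxBr mulmxBl -!scalemxAr -!scalemxAl !elem_mxM //; try lia.
    move: ij; rewrite /neighbors => /orP[] /eqP ->; rewrite ?eqxx.
      have -> : (i.+2 == i) = false by lia.
      have -> : (i.+1 == i) = false by lia.
      by rewrite !(scale0r, scaler0, subr0).
    have -> : (j.+2 == j) = false by lia.
    have -> : (j.+2 == j.+1) = false by lia.
    by rewrite !(scale0r, scaler0, subr0, sub0r, oppr0).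
  have := br (x i) w (tx i ir) (tr_br _ _).
  rewrite hw rho0 /w br ?tx // => h0.
  transitivity (rho (x i) *m (rho (x i) *m rho (x j) - rho (x j) *m rho (x i)) -
    (rho (x i) *m rho (x j) - rho (x j) *m rho (x i)) *m rho (x i)); last by [].
  move: (rho _) (rho _) => s t; nc_ring; ring.
- move=> i j ir jr ij; rewrite !e_ // comm ?tx //.
  rewrite (delta i i.+1 j j.+1) //; try lia.
  have -> : (i.+1 == j) = false by move: ij; rewrite /apart; lia.
  have -> : (j.+1 == i) = false by move: ij; rewrite /apart; lia.
  by rewrite !scale0r subrr.
Qed.

End Classical.
End Module.

(** * Unitary models and Cartan projections *)

Lemma mulmx_ext (R : realType) m n (A B : 'M[R[i]]_(m, n)) :
  (forall v : 'cV[R[i]]_n, A *m v = B *m v) -> A = B.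
Proof.
move=> h; apply/matrixP => i j.
have := congr1 (fun M : 'cV[R[i]]_m => M i 0) (h (delta_mx j 0)).
by rewrite -!colE !mxE.
Qed.

(* [P] is the orthogonal projection onto the line of highest weight vectors of a
   unitary model of V_mu, given by its Chevalley operators. *)
Record model (R : realType) (p : R) (r d : nat) (e D Th : nat -> 'M[R[i]]_d)
    (mu : nat -> int) (xi : 'cV[R[i]]_d) (P : 'M[R[i]]_d) : Prop := {
  model_chev : chevalley p%:C r e D;
  model_hw : highest_weight p r e D mu xi;
  model_cyclic : cyclic r e xi;
  model_gl : grouplike r e Th;
  model_Th : forall k, (k < r)%N -> exists2 c, c != 0 & Th k *m xi = c *: xi;
  model_proj : P = line_proj xi
}.

(** The hypotheses of the estimate for the Cartan projection [F], with [S] the embedding of the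
    model of [V_(lambda + mu)], gathered so that they can be transported to the dual generators as a
    whole. *)
Record cartan_data (R : realType) (p : R) (r dU dW dX : nat)
    (eU DU Th : nat -> 'M[R[i]]_dU) (eW DW : nat -> 'M[R[i]]_dW)
    (eX DX : nat -> 'M[R[i]]_dX) (F : 'M[R[i]]_(dU * dW))
    (S : 'M[R[i]]_(dU * dW, dX)) : Prop := {
  cd_idem : F *m F = F;
  cd_adj : adjoint F = F;
  cd_range : forall x : 'cV[R[i]]_(dU * dW),
    exists v : 'cV[R[i]]_dX, F *m x = S *m v;
  cd_id : F *m S = S;
  cd_comm : forall k, (k < r)%N ->
    F *m coprod_e eU Th eW k = coprod_e eU Th eW k *m F;
  cd_inj : forall v : 'cV[R[i]]_dX, S *m v = 0 -> v = 0;
  cd_e : forall k, (k < r)%N -> S *m eX k = coprod_e eU Th eW k *m S;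
  cd_eJ : forall k, (k < r)%N ->
    S *m adjoint (eX k) = adjoint (coprod_e eU Th eW k) *m S;
  cd_D : forall k, (k < r)%N -> S *m DX k = coprod_D p DU DW k *m S
}.

Section DualTensor.
Variables (R : realType) (p : R) (r dU dW dX : nat).
Variables (eU DU Th : nat -> 'M[R[i]]_dU) (eW DW : nat -> 'M[R[i]]_dW).
Variables (eX DX : nat -> 'M[R[i]]_dX).
Hypothesis gl : grouplike r eU Th.

Local Notation eU' := (dual_e r p eU).
Local Notation eW' := (dual_e r p eW).
Local Notation eX' := (dual_e r p eX).
Local Notation Th' := (fun k => Th (revi r k)).

Lemma adjoint_coprod_e k : (k < r)%N -> adjoint (coprod_e eU Th eW k) =
  adjoint (eU k) *t 1%:M + Th k *t adjoint (eW k).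
Proof.
by move=> kr; rewrite /coprod_e adjointD !adjoint_tens adjoint1 (gl_adj gl).
Qed.

Lemma coprod_dual_e k : (k < r)%N ->
  coprod_e eU' Th' eW' k = (p^-1)%:C *: adjoint (coprod_e eU Th eW (revi r k)).
Proof.
move=> kr; rewrite adjoint_coprod_e ?revi_lt //.
by rewrite /coprod_e /dual_e tensmx_scalel tensmx_scaler scalerDr.
Qed.

Lemma coprod_dual_D k :
  coprod_D p^-1 (dual_D r DU) (dual_D r DW) k = - coprod_D p DU DW (revi r k).
Proof.
rewrite /coprod_D /dual_D opprD tensmx_oppl; congr (_ + _).
rewrite tensmx_oppr; congr (- (_ *t _)).
rewrite /Ksq; congr (_ + _).
by rewrite fmorphV invrK scalerN -scaleNr opprB.
Qed.

(** [F] and [S] stay the same. The dual coproduct is a multiple of the adjoint of the original one,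
    so [cd_e] and [cd_eJ] change places, and [cd_comm] passes to adjoints as [F] is self-adjoint. *)
Lemma cartan_data_dual F S :
  cartan_data p r eU DU Th eW DW eX DX F S ->
  cartan_data p^-1 r eU' (dual_D r DU) Th' eW' (dual_D r DW) eX' (dual_D r DX) F S.
Proof.
case=> h1 h2 h3 h4 h5 h6 h7 h8 h9; split=> //.
- move=> k kr; rewrite coprod_dual_e // -scalemxAr -scalemxAl; congr (_ *: _).
  by rewrite -{1}h2 -adjointM -h5 ?revi_lt // adjointM h2.
- move=> k kr; rewrite coprod_dual_e // /dual_e -scalemxAr -scalemxAl.
  by rewrite h8 // revi_lt.
- move=> k kr; rewrite coprod_dual_e // adjoint_dual_e adjointZ adjointK.
  by rewrite conjc_real -scalemxAr -scalemxAl h7 // revi_lt.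
- move=> k kr; rewrite coprod_dual_D {1}/dual_D mulmxN mulNmx h9 //.
  exact: revi_lt.
Qed.

End DualTensor.

Section ModuleModels.
Variables (R : realType) (N' : nat).
Local Notation N := N'.+2.
Local Notation r := N'.+1.
Variables (q : R).
Hypothesis q_gt0 : 0 < q.
Local Notation z := (q%:C).
Local Notation me := (@mod_e R N').
Local Notation mD := (@mod_D R N' q).
Local Notation mTh := (@mod_Th R N' q).

Let q0 : q != 0. Proof. by rewrite gt_eqF. Qed.
Let Q0 : z != 0. Proof. by rewrite fmorph_eq0. Qed.

Section OneModule.
Variable V : genops R N.
Hypothesis Vmod : is_module q V.
Hypothesis Vstar : is_star q V.

Lemma mod_chevalley : chevalley z r (me V) (mD V).
Proof.
move: Vmod; rewrite /is_module; case: eqP => [q1|/eqP q1] h.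
  exact: chevalley_classical.
exact: chevalley_quantum.
Qed.

Lemma mod_grouplike : grouplike r (me V) (mTh V).
Proof.
move: Vmod; rewrite /is_module /mod_Th; case: eqP => [q1|/eqP q1] h; split.
- by move=> k kr; rewrite unitmx1.
- by move=> k kr; rewrite adjoint1.
- by move=> k j kr jr; exists 1; rewrite ?oner_neq0 // mul1mx mulmx1 scale1r.
- by move=> k kr; apply: (quantum_unit h).
- by move=> k kr; have [-> _ _] := quantum_adj q1 Vstar (inord k).
- move=> k j kr jr; exists (z ^ cartan (N := N) (inord k) (inord j)).
    by rewrite expfz_neq0.
  exact: (quantum_TE h).
Qed.

Lemma killed_by_E_mod v :
  killed_by_E v <-> forall k, (k < r)%N -> me V k *m v = 0.
Proof.
split=> [h k kr|h i]; first exact: h.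
by have := h i (ltn_ord i); rewrite /mod_e inord_val.
Qed.

(** For [q != 1] the adjoint of [E_i] is [q^2 K_i F_i] with [K_i] invertible, so it has the kernel
    of [F_i]; for [q = 1] it is [F_i]. *)
Lemma killed_by_F_mod v :
  killed_by_F v <-> forall k, (k < r)%N -> adjoint (me V k) *m v = 0.
Proof.
move: Vmod; rewrite /is_module; case: eqP => [q1|/eqP q1] h.
  have hE i : adjoint (opE V i) = opF V i.
    by have := Vstar i; rewrite q1 eqxx => -[_ [-> _]].
  split=> [hv k kr|hv i]; first by rewrite /mod_e hE hv.
  by have := hv i (ltn_ord i); rewrite /mod_e inord_val hE.
have hE i : adjoint (opE V i) = z ^+ 2 *: (opT V i *m opF V i).
  exact: (quantum_adjE q_gt0 q1 h Vstar).
split=> [hv k kr|hv i].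
  by rewrite /mod_e hE -scalemxAl -mulmxA hv mulmx0 scaler0.
have := hv i (ltn_ord i); rewrite /mod_e inord_val hE -scalemxAl => /eqP.
rewrite scaler_eq0 expf_eq0 (negbTE Q0) andbF /= => /eqP h0.
have := congr1 (mulmx (invmx (opT V i))) h0.
by rewrite mulmx0 !mulmxA mulVmx ?mul1mx // (quantum_unit h).
Qed.

Lemma mod_irreducible : simple_module V -> irreducible r (me V) (mD V) (mTh V).
Proof.
move=> [_ simple] Q Q0' Qlin Qst [v v0 Qv] u.
have [W hW] := vspace_of_pred Q0' Qlin.
have QZ c x : Q x -> Q (c *: x).
  by move=> hx; rewrite -[_ *: _]addr0; apply: Qlin.
have Wsub : submodule W.
  move=> i x /hW Qx; have [h1 h2 h3 h4 h5] := Qst i x (ltn_ord i) Qx.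
  (* For [q != 1], [F_i] is recovered by applying the adjoint of [E_i], which is [F_i K_i], after
     [K_i^-1]. *)
  have [_ h2' _ _ _] := Qst i _ (ltn_ord i) h5.
  rewrite /mod_e /mod_D /mod_Th inord_val in h1 h2 h2' h3 h4.
  split; apply/hW => //.
    move: Vmod h2 h2'; rewrite /is_module.
    case: eqP => [q1|/eqP q1] h.
      by have := Vstar i; rewrite q1 eqxx => -[_ [-> _]].
    have [_ -> _] := quantum_adj q1 Vstar i => _.
    by rewrite -mulmxA (mulmxA (opT V i)) mulmxV ?mul1mx // (quantum_unit h).
  by move: h3 h4; case: eqP.
have [W0|W1] := simple W Wsub; last by apply/hW; rewrite W1 memvf.
by move/hW: Qv; rewrite W0 memv0 (negbTE v0).
Qed.

Lemma mod_highest_weight mu v : v != 0 -> has_weight q mu v -> killed_by_E v ->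
  highest_weight q r (me V) (mD V) (weight_nat mu) v /\
  forall k, (k < r)%N -> exists2 c, c != 0 & mTh V k *m v = c *: v.
Proof.
move=> v0 hv /killed_by_E_mod hE; split; first split=> //.
  move=> k kr; have := hv (inord k); rewrite /mod_D /dnum /weight_nat.
  case: eqP => [_ ->|/eqP q1 h]; first by rewrite rmorph_int.
  rewrite -scalemxAl mulmxBl mul1mx -mulmxA h -scalemxAr h scalerA.
  rewrite -expfzDr // -mulr2n -{2}[v]scale1r -scalerBl scalerA; congr (_ *: _).
  by rewrite [RHS]rmorphM [X in _ = _ * X]fmorphV !rmorphB fmorphV rmorph1 mulrC
    fmorphXz.
move=> k kr; rewrite /mod_Th; case: eqP => [_|/eqP q1].
  by exists 1; rewrite ?oner_neq0 // mul1mx scale1r.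
exists (z ^ mu (inord k)); first by rewrite expfz_neq0.
by rewrite hv (negbTE q1).
Qed.

(** [Pl] asks for weight vectors of the [K_i], while [D_i] only sees [K_i^2]. For [q != 1] the
    weight of a word is therefore computed from the [K_i] themselves. *)
Lemma mod_word_weight mu v w : v != 0 -> has_weight q mu v -> killed_by_E v ->
  all (fun k => k < r)%N w -> exists nu, has_weight q nu (word (me V) v w).
Proof.
move=> v0 hv hE bw; have [hw _] := mod_highest_weight v0 hv hE.
have [q1|q1] := eqVneq q 1.
  exists [ffun i : 'I_r => wt (weight_nat mu) w i] => i.
  have := word_Dweight q_gt0 mod_chevalley hw bw (ltn_ord i).
  rewrite /mod_D /dnum q1 eqxx inord_val ffunE => ->.
  by rewrite rmorph_int.
elim: w bw => [_|j w IH /= /andP[jr /IH [nu hnu]]].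
  by exists mu; rewrite /word /= mul1mx.
exists [ffun i : 'I_r => nu i - cartan (N := N) i (inord j)] => i.
have h : quantum_relations q V by move: Vmod; rewrite /is_module (negbTE q1).
have := congr1 (@adjoint _ _ _) (quantum_TE h i (inord j)).
have [hT _ _] := quantum_adj q1 Vstar i.
rewrite adjointZ !adjointM hT.
have -> : (z ^ cartan (N := N) i (inord j))^*%C = z ^ cartan (N := N) i (inord j).
  by rewrite -fmorphXz conjc_real.
move=> hTE; rewrite word_cons (negbTE q1) ffunE.
have := congr1 (fun A => z ^ (- cartan (N := N) i (inord j)) *: (A *m word (me V) v w)) hTE.
rewrite -scalemxAl scalerA -expfzDr // addNr expr0z scale1r -!mulmxA.
rewrite hnu (negbTE q1) -scalemxAr scalerA => <-.
by rewrite -expfzDr // addrC.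
Qed.

Lemma mod_model mu : is_Vmu q mu V -> exists xi,
  model q r (me V) (mD V) (mTh V) (weight_nat mu) xi (Ph q V).
Proof.
move=> [_ _ simple _ [xi [xi0 hxi hE]]]; exists xi.
have [hw hTh] := mod_highest_weight xi0 hxi hE.
have irr := mod_irreducible simple.
have cyc := cyclic_of_irreducible mod_grouplike q_gt0 mod_chevalley irr hw hTh.
split=> //; [exact: mod_chevalley | exact: mod_grouplike |].
have -> : Ph q V = orthoproj [set v | exists c, v = c *: xi].
  rewrite /Ph; congr orthoproj; apply/seteqP; split=> v /=.
    by move=> [_ /killed_by_E_mod hv]; exact: (killed_by_e hw cyc hv).
  move=> [c ->]; split.
    by exists mu => i; rewrite -scalemxAr hxi !scalerA mulrC.
  by move=> i; rewrite -scalemxAr hE scaler0.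
apply: (orthoproj_unique _ (is_orthoproj_line xi0)).
exact: (orthoprojP (is_orthoproj_line xi0)).
Qed.

Lemma mod_model_dual mu : is_Vmu q mu V -> exists zeta,
  model q^-1 r (dual_e r q (me V)) (dual_D r (mD V)) (fun k => mTh V (revi r k))
    (weight_nat mu) zeta (Pl q V).
Proof.
move=> [_ _ simple _ [xi [xi0 hxi hE]]].
have [hw hTh] := mod_highest_weight xi0 hxi hE.
have irr := mod_irreducible simple; have gl := mod_grouplike.
have ch := mod_chevalley.
have [w [bw hw' hTh']] := lowest_weight_vector q_gt0 ch gl irr hw hTh.
have qV_gt0 : 0 < q^-1 by rewrite invr_gt0.
have cyc := cyclic_of_irreducible (grouplike_dual q gl) qV_gt0
  (chevalley_dual ch) (irreducible_dual q_gt0 irr) hw' hTh'.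
set zeta := word (me V) xi w in hw' hTh' cyc *.
have z0 := hw_neq0 hw'; exists zeta; split=> //.
- exact: chevalley_dual.
- exact: grouplike_dual.
have -> : Pl q V = orthoproj [set v | exists c, v = c *: zeta].
  rewrite /Pl; congr orthoproj; apply/seteqP; split=> v /=.
    move=> [_ /killed_by_F_mod hv]; apply: (killed_by_e hw' cyc) => k kr.
    by rewrite /dual_e -scalemxAl hv ?scaler0 // revi_lt.
  move=> [c ->]; split.
    have [nu hnu] := mod_word_weight xi0 hxi hE bw.
    by exists nu => i; rewrite -scalemxAr hnu !scalerA mulrC.
  apply/killed_by_F_mod => k kr; rewrite -scalemxAr.
  have := hw_e hw' (revi_lt kr); rewrite /dual_e reviK // -scalemxAl => /eqP.
  rewrite scaler_eq0 fmorph_eq0 invr_eq0 (negbTE q0) /= => /eqP ->.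
  by rewrite scaler0.
apply: (orthoproj_unique _ (is_orthoproj_line z0)).
exact: (orthoprojP (is_orthoproj_line z0)).
Qed.

End OneModule.

Section Tensor.
Variables U W : genops R N.
Hypothesis Umod : is_module q U.
Hypothesis Ustar : is_star q U.
Hypothesis Wmod : is_module q W.
Hypothesis Wstar : is_star q W.

Lemma tens_E k : opE (tens q U W) (inord k) = coprod_e (me U) (mTh U) (me W) k.
Proof. by rewrite /= /coprod_e /mod_Th /mod_e; case: eqP. Qed.

Lemma tens_adjE k : (k < r)%N -> adjoint (coprod_e (me U) (mTh U) (me W) k) =
  if q == 1 then opF (tens q U W) (inord k)
  else opF (tens q U W) (inord k) *m opT (tens q U W) (inord k).
Proof.
move=> kr; rewrite (adjoint_coprod_e _ (mod_grouplike Umod Ustar)) //.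
rewrite /mod_e /mod_Th /=; case: eqP => [q1|/eqP q1].
  have := Ustar (inord k); have := Wstar (inord k).
  by rewrite q1 eqxx => -[_ [-> _]] -[_ [-> _]].
have [_ -> _] := quantum_adj q1 Ustar (inord k).
have [_ -> _] := quantum_adj q1 Wstar (inord k).
have hW : opT W (inord k) \in unitmx.
  by apply: quantum_unit; move: Wmod; rewrite /is_module (negbTE q1); apply.
rewrite mulmxDl !tensmx_mul mul1mx mulVmx //.
Qed.

(** For [q != 1] the adjoint is rewritten as [q^2 K F], with [F] acting first; the form [F K] of
    [tens_adjE] does not visibly kill [y]. *)
Lemma tens_killed_F y k : (k < r)%N -> killed_by_F (V := tens q U W) y ->
  adjoint (coprod_e (me U) (mTh U) (me W) k) *m y = 0.
Proof.
move=> kr hy; have := tens_adjE kr; case: eqP => [q1 ->|/eqP q1 _]; first exact: hy.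
have Uq : quantum_relations q U by move: Umod; rewrite /is_module (negbTE q1).
have Wq : quantum_relations q W by move: Wmod; rewrite /is_module (negbTE q1).
rewrite (adjoint_coprod_e _ (mod_grouplike Umod Ustar)) //.
rewrite /mod_e (quantum_adjE q_gt0 q1 Uq Ustar) (quantum_adjE q_gt0 q1 Wq Wstar).
rewrite /mod_Th (negbTE q1) tensmx_scalel tensmx_scaler -scalerDr.
have -> : (opT U (inord k) *m opF U (inord k)) *t 1%:M +
    opT U (inord k) *t (opT W (inord k) *m opF W (inord k)) =
    (opT U (inord k) *t opT W (inord k)) *m opF (tens q U W) (inord k).
  rewrite /= (negbTE q1) mulmxDr !tensmx_mul mulmx1 mulmxV //.
  exact: (quantum_unit Wq).
by rewrite -scalemxAl -mulmxA hy mulmx0 scaler0.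
Qed.

Lemma tens_D k : (k < r)%N -> coprod_D q (mD U) (mD W) k =
  if q == 1 then opT (tens q U W) (inord k)
  else (z - z^-1)^-1 *: (opT (tens q U W) (inord k) *m opT (tens q U W) (inord k)
    - 1%:M).
Proof.
move=> kr; rewrite /coprod_D /mod_D /Ksq /=; case: eqP => [q1|/eqP q1].
  by rewrite q1 rmorph1 invr1 subrr scale0r addr0.
have k0 : z - z^-1 != 0.
  by rewrite -fmorphV -rmorphB fmorph_eq0 dnum_den_neq0.
rewrite scalerA mulfV // scale1r [1%:M + _]addrC subrK tensmx_scalel tensmx_scaler.
rewrite -scalerDr; congr (_ *: _); rewrite !tensmx_addl tensmx_addr !tensmx_mul.
rewrite tensmx_oppl tensmx11 tensmx_oppr.
by rewrite addrC addrA subrK.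
Qed.

Lemma mod_cartan_data X : is_module q X -> is_star q X ->
  cartan_proj q U W X = 0 \/ exists S,
    cartan_data q r (me U) (mD U) (mTh U) (me W) (mD W) (me X) (mD X)
      (cartan_proj q U W X) S.
Proof.
move=> Xmod Xstar; rewrite /cartan_proj; case: xgetP => [F _ /=|_]; last by left.
move=> [Y [Ysub [S [Sint Sinj Srange]]] Fproj]; right; exists S.
have [F_idem F_adj F_range] := Fproj.
have SY v : [set` Y] (S *m v) by rewrite -Srange; exists v.
have FS : F *m S = S.
  by apply: mulmx_ext => v; rewrite -mulmxA (orthoproj_id Fproj).
(* Used for [coprod_e] and for its adjoint: when both preserve [Y], the two identities together make
   [F] commute with [coprod_e]. *)
have stab (A : 'M[R[i]]_(Defs.dim U * Defs.dim W)) :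
    (forall v, v \in Y -> A *m v \in Y) -> F *m A *m F = A *m F.
  move=> hA; apply: mulmx_ext => v; rewrite -!mulmxA (orthoproj_id Fproj) //.
  exact: (hA _ (orthoproj_in Fproj v)).
have YE k v : (k < r)%N -> v \in Y -> coprod_e (me U) (mTh U) (me W) k *m v \in Y.
  by move=> kr vY; have [h _ _] := Ysub (inord k) v vY; rewrite -tens_E; exact: h.
have YEJ k v : (k < r)%N -> v \in Y ->
    adjoint (coprod_e (me U) (mTh U) (me W) k) *m v \in Y.
  move=> kr vY; rewrite tens_adjE //; have [_ h1 h2] := Ysub (inord k) v vY.
  case: eqP => _ //; rewrite -mulmxA.
  by case: (Ysub (inord k) _ h2).
split=> //.
- by move=> x; have := orthoproj_in Fproj x; rewrite -Srange => -[v _ <-]; exists v.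
- move=> k kr; have h1 := stab _ (fun v => YE k v kr).
  have h2 := congr1 (@adjoint _ _ _) (stab _ (fun v => YEJ k v kr)).
  rewrite !adjointM adjointK F_adj in h2.
  by rewrite -h2 mulmxA h1.
- by move=> v h; apply: Sinj; rewrite h mulmx0.
- by move=> k kr; have [h _ _] := Sint (inord k); rewrite -tens_E; exact: h.
- move=> k kr; rewrite tens_adjE //; have [_ h1 h2] := Sint (inord k).
  have := Xstar (inord k); rewrite /mod_e; case: eqP => [_ [_ [-> _]]|_ [_ [-> _]]].
    exact: h1.
  by rewrite mulmxA h1 -mulmxA h2 mulmxA.
- move=> k kr; rewrite tens_D // /mod_D; have [_ _ h] := Sint (inord k).
  case: eqP => _; first exact: h.
  rewrite -scalemxAr -scalemxAl mulmxBr mulmxBl mulmx1 mul1mx.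
  by rewrite mulmxA h -mulmxA h mulmxA.
Qed.

End Tensor.
End ModuleModels.

(** * Asymptotics *)

Lemma seq_min (w : seq nat) : w != [::] ->
  exists2 i0, i0 \in w & all (fun k => i0 <= k)%N w.
Proof.
elim: w => // a w IH _; have [->|/IH[i0 i0w hi]] := eqVneq w [::].
  by exists a; rewrite ?mem_head //= leqnn.
have [ai|ia] := leqP a i0.
  exists a; first exact: mem_head.
  by rewrite /= leqnn; apply: sub_all hi => k; apply: leq_trans.
by exists i0; rewrite ?inE ?i0w ?orbT //= ltnW.
Qed.

(** If all [lam k] are positive, the smallest letter of the word serves. Otherwise look at the
    rightmost letter [l], the first to act on [xi]: the squared norm of [adjoint (e l) *m xi] is
    proportional to [dnum (mu l)], so [l] must be 0, which is below every letter. *)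
Lemma large_weight_multiple (R : realType) (p : R) (r d : nat)
    (e D : nat -> 'M[R[i]]_d) (lam mu : nat -> int) xi (m n : nat) :
  0 < p -> chevalley p%:C r e D -> highest_weight p r e D mu xi ->
  (forall k, (k < r)%N -> 0 <= lam k) -> (n <= m)%N ->
  (forall k, (k < r)%N -> mu k = lam k *+ m) ->
  (forall k, (k < r)%N -> 0 < lam k) \/
  (forall k, (k < r)%N -> k != 0%N -> lam k = 0) ->
  large_weight r n e mu xi.
Proof.
move=> p_gt0 H hw lam0 nm hmu cond w bw wn w0.
have big k : (k < r)%N -> 0 < lam k -> n%:Z <= mu k.
  by move=> kr lk; rewrite hmu //; nia.
case: cond => [reg|zero].
  have [i0 i0w hi] := seq_min wn; exists i0 => //; split=> //.
  by apply: big; [|apply: reg]; exact: (allP bw).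
case/lastP: w wn bw w0 => // w l _; rewrite all_rcons => /andP[lr bw].
rewrite /word opword_rcons -mulmxA => w0.
have fl : adjoint (e l) *m xi != 0 by apply: contraNneq w0 => ->; rewrite mulmx0.
have mul : mu l != 0.
  apply: contraNneq fl => ml; apply/eqP/sqnorm_eq0/complexI.
  rewrite -dot_sqnorm dot_adjointl adjointK mulmxA (chev_self H) // mulmxDl.
  rewrite -scalemxAl -mulmxA (hw_e hw) // mulmx0 scaler0 add0r (hw_D hw) // ml.
  by rewrite dnum0 scale0r dot0r.
have l0 : l = 0%N.
  by apply/eqP; apply: contraNT mul => l0; rewrite hmu // zero // mul0rn.
subst l; exists 0%N; first by rewrite mem_rcons mem_head.
split; first by apply/allP.
apply: big => //; have := lam0 0%N lr; rewrite le_eqVlt => /orP[/eqP h|//].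
by move: mul; rewrite hmu // -h mul0rn eqxx.
Qed.

(** * From the gap constant to rates of convergence *)

Section Bounds.
Variables (R : realType) (p : R) (r : nat).
Hypothesis p_ge1 : 1 <= p.
Let p_gt0 : 0 < p. Proof. exact: lt_le_trans p_ge1. Qed.

Definition norm_const (L : nat) (K : R) : R :=
  p ^ (L%:Z *+ 2) * ((r.+1 * r.+1)%:R * K).

Lemma opnorm_gap_le m n (A : 'M[R[i]]_(m, n)) (g B : R) : 0 < g -> 0 <= B ->
  (forall x, g * sqnorm (A *m x) <= B * sqnorm x) ->
  opnorm A <= Num.sqrt (B / g).
Proof.
move=> g0 B0 h; apply: opnorm_le => [|x]; first by rewrite divr_ge0 // ltW.
by rewrite mulrAC ler_pdivlMr // mulrC.
Qed.

Lemma norm_bounds (dU dW dX : nat) eU DU Th eW DW ThW eX DX ThX lam mu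
    (xiU : 'cV[R[i]]_dU) (xiW : 'cV[R[i]]_dW) (xiX : 'cV[R[i]]_dX) PU PW PX
    L K Z F n :
  model p r eU DU Th lam xiU PU -> model p r eW DW ThW mu xiW PW ->
  model p r eX DX ThX (fun k => lam k + mu k) xiX PX ->
  controls p r eU Th L K ->
  (Z = 0 \/ exists2 S, is_orthoproj S Z &
     forall y, S y -> forall k, (k < r)%N -> coprod_e eU Th eW k *m y = 0) ->
  (F = 0 \/ exists S, cartan_data p r eU DU Th eW DW eX DX F S) ->
  large_weight r n eW mu xiW -> large_weight r n eX (fun k => lam k + mu k) xiX ->
  (L * 2 <= n)%N -> 0 < gap_const p r L n ->
  opnorm ((1%:M - 1%:M *t PW) *m Z) <= Num.sqrt (norm_const L K / gap_const p r L n)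
  /\ opnorm (F *m ((1%:M - PU) *t PW)) <=
       Num.sqrt (norm_const L K / gap_const p r L n).
Proof.
move=> [HU hwU cycU glU hTh ->] [HW hwW cycW _ _ ->] [HX hwX cycX _ _ _] ctl.
move=> hZ hF largeW largeX Ln g0; have K0 : 0 <= K by case: ctl.
have B0 : 0 <= norm_const L K.
  by rewrite mulr_ge0 ?exprz_ge0 ?(ltW p_gt0) // mulr_ge0.
have Be x : norm_const L K * x = p ^ (L%:Z *+ 2) * ((r.+1 * r.+1)%:R * (K * x)).
  by rewrite /norm_const !mulrA.
split; apply: opnorm_gap_le => // x; rewrite Be.
  rewrite -mulmxA; case: hZ => [->|[S hS killed]].
    by rewrite mul0mx mulmx0 sqnorm0 mulr0 -Be mulr_ge0 ?sqnorm_ge0.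
  apply: le_trans (killed_estimate p_ge1 glU ctl HW hwW cycW
    (killed _ (orthoproj_in hS x)) Ln largeW) _.
  by rewrite -!Be ler_wpM2l // (sqnorm_orthoproj_le hS).
case: hF => [->|[S [h1 h2 h3 h4 h5 h6 h7 h8 h9]]].
  by rewrite !mul0mx sqnorm0 mulr0 -Be mulr_ge0 ?sqnorm_ge0.
exact: (cartan_estimate p_ge1 HU hwU cycU ctl HW hwW HX hwX cycX h1 h2 h3 h4 h5
  h6 h7 h8 h9 x Ln largeX).
Qed.

Lemma dnum_gt1E (m : int) : 1 < p ->
  dnum p m = (p ^ (m *+ 2) - 1) / (p - p^-1).
Proof. by move=> p1; rewrite /dnum gt_eqF. Qed.

Lemma exists_nat_ge (x : R) : exists n : nat, x <= n%:R.
Proof.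
exists (Num.bound `|x|); apply/ltW; apply: le_lt_trans (ler_norm x) _.
exact: archi_boundP.
Qed.

(** [gap_const] is at least linear in [n] up to constants, which gives the limit. For [p > 1] it is
    [s p^(2n) - A'], and the square root turns this into the rate [p^-1]. *)
Lemma gap_decay (L : nat) (B : R) (f : nat -> R) : 0 <= B ->
  (forall n, 0 <= f n) ->
  (forall n, (L * 2 <= n)%N -> 0 < gap_const p r L n ->
     f n <= Num.sqrt (B / gap_const p r L n)) ->
  f @ \oo --> (0 : R) /\
  (1 < p -> exists2 c, 0 < c & forall n, f n <= c * p^-1 ^+ n).
Proof.
move=> B0 f0 hf.
pose a := p ^ (- (L + r)%:Z *+ 2); pose A := L%:R * gap_loss p L.
have a0 : 0 < a by rewrite exprz_gt0.
have A0 : 0 <= A by rewrite mulr_ge0 // gap_loss_ge0.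
have gapE n : gap_const p r L n = a * dnum p (n%:Z - L%:Z *+ 2) - A by [].
split.
  apply/cvgrPdist_le => e e0.
  have [n0 hn0] := exists_nat_ge ((B / e ^+ 2 + 1 + A) / a).
  exists (n0 + L * 2)%N => // n /= hn.
  rewrite sub0r normrN ger0_norm //.
  have Be0 : 0 <= B / e ^+ 2 by rewrite divr_ge0 // exprn_ge0 // ltW.
  have gB : B / e ^+ 2 + 1 <= gap_const p r L n.
    rewrite gapE lerBrDr [a * _]mulrC -ler_pdivrMr //; apply: le_trans hn0 _.
    have -> : n%:Z - L%:Z *+ 2 = (n - L * 2)%N%:Z by lia.
    apply: le_trans (dnum_ge_nat _ p_ge1); rewrite ler_nat; lia.
  have g0 : 0 < gap_const p r L n.
    by apply: lt_le_trans gB; rewrite ltr_wpDl.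
  apply: le_trans (hf n (leq_trans (leq_addl _ _) hn) g0) _.
  rewrite -[e]ger0_norm ?(ltW e0) // -sqrtr_sqr ler_wsqrtr //.
  rewrite ler_pdivrMr // mulrC -ler_pdivrMr ?exprn_gt0 //.
  by apply: le_trans gB; rewrite lerDl.
move=> p1; pose k := p - p^-1.
have k0 : 0 < k by rewrite subr_gt0 (lt_trans _ p1) // invf_lt1.
pose s := a * p ^ (- L%:Z *+ 4) / k; pose A' := a / k + A.
have s0 : 0 < s by rewrite divr_gt0 // mulr_gt0 // exprz_gt0.
have gap2 n : gap_const p r L n = s * p ^+ (n * 2) - A'.
  rewrite gapE dnum_gt1E // -/k.
  have -> : (n%:Z - L%:Z *+ 2) *+ 2 = - L%:Z *+ 4 + (n * 2)%N%:Z by lia.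
  rewrite expfzDr ?gt_eqF // /s /A'; move: (p ^ (- L%:Z *+ 4)) => b.
  rewrite -[p ^ (n * 2)%N%:Z]/(p ^+ (n * 2)); field; exact: lt0r_neq0.
(* From [n0] on, [A'] is at most half of [s p^(2n)], because [p^(2n) = 1 + k * dnum p n >= k n]. *)
have [n0 hn0] := exists_nat_ge (A' * 2 / s / k).
have large n : (n0 <= n)%N -> s / 2 * p ^+ (n * 2) <= gap_const p r L n.
  move=> hn; rewrite gap2 lerBrDr -lerBrDl.
  have -> : s * p ^+ (n * 2) - s / 2 * p ^+ (n * 2) = s / 2 * p ^+ (n * 2) by field.
  have : A' * 2 / s <= p ^+ (n * 2).
    have := dnum_ksq p_gt0 n%:Z; rewrite -/k.
    have -> : n%:Z *+ 2 = (n * 2)%N%:Z by lia.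
    rewrite -[p ^ _]/(p ^+ (n * 2)) => pE.
    apply: (@le_trans _ _ (k * dnum p n)); last by rewrite -pE; lra.
    rewrite [k * _]mulrC -ler_pdivrMr //; apply: le_trans hn0 _.
    by apply: le_trans (dnum_ge_nat _ p_ge1); rewrite ler_nat.
  by rewrite ler_pdivrMr // => h; lra.
pose n1 := (n0 + L * 2)%N.
(* The sum absorbs the finitely many [n] below [n1], and the last 1 makes [c] positive. *)
pose c := Num.sqrt (B * 2 / s) + \sum_(m < n1) f m * p ^+ m + 1.
have S0 : 0 <= \sum_(m < n1) f m * p ^+ m.
  by apply: sumr_ge0 => m _; rewrite mulr_ge0 // exprn_ge0 // ltW.
have c0 : 0 < c by rewrite ltr_wpDl // addr_ge0 // sqrtr_ge0.
exists c => // n; have pn : 0 < p ^+ n by rewrite exprn_gt0.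
rewrite exprVn ler_pdivlMr //.
have [nn1|nn1] := ltnP n n1.
  apply: (@le_trans _ _ (\sum_(m < n1) f m * p ^+ m)).
    rewrite (bigD1 (Ordinal nn1)) //= lerDl sumr_ge0 // => m _.
    by rewrite mulr_ge0 // exprn_ge0 // ltW.
  by rewrite /c -addrA addrCA lerDl addr_ge0 ?sqrtr_ge0.
have hl := large n (leq_trans (leq_addr _ _) nn1).
have Ln : (L * 2 <= n)%N by apply: leq_trans nn1; rewrite leq_addl.
have g0 : 0 < gap_const p r L n.
  by apply: lt_le_trans hl; rewrite mulr_gt0 ?exprn_gt0 // divr_gt0.
apply: (@le_trans _ _ (Num.sqrt (B * 2 / s))); last first.
  by rewrite /c -addrA lerDl addr_ge0.
rewrite -ler_pdivlMr //; apply: le_trans (hf n Ln g0) _.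
have -> : Num.sqrt (B * 2 / s) / p ^+ n = Num.sqrt (B * 2 / s / p ^+ (n * 2)).
  have pV : 0 <= (p ^+ n)^-1 by rewrite invr_ge0 ltW.
  have Bs : 0 <= B * 2 / s by rewrite divr_ge0 ?(ltW s0) // mulr_ge0.
  by rewrite exprM -[(_ ^+ 2)^-1]exprVn [in RHS](sqrtrM _ Bs) sqrtr_sqr ger0_norm.
apply: ler_wsqrtr.
have -> : B * 2 / s / p ^+ (n * 2) = B / (s / 2 * p ^+ (n * 2)).
  by field; rewrite !lt0r_neq0 // exprn_gt0.
rewrite ler_wpM2l // lef_pV2 // posrE mulr_gt0 ?exprn_gt0 // divr_gt0 //.
Qed.

End Bounds.

(** * Decay for the given family of modules *)

Section Assembly.
Variables (R : realType) (N' : nat).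
Local Notation N := N'.+2.
Local Notation r := N'.+1.
Variables (q : R) (V : weight N -> genops R N) (lambda : weight N).
Hypothesis q_gt0 : 0 < q.
Hypothesis V_simple : forall mu : weight N, dominant mu -> is_Vmu q mu (V mu).
Hypothesis lambda_dom : dominant lambda.
Hypothesis lambda_cond : regular lambda \/ exists m : nat, lambda = omega1 N *+ m.

Local Notation lam := (weight_nat lambda).
Local Notation Vl := (V lambda).
Local Notation Vn n := (V (lambda *+ n)).
Local Notation Vx n := (V (lambda + lambda *+ n)).
Local Notation me := (@mod_e R N').
Local Notation mD := (@mod_D R N' q).
Local Notation mTh := (@mod_Th R N' q).

Lemma dominant_mulrn n : dominant (lambda *+ n).
Proof. by move=> i; rewrite ffunMnE mulrn_wge0. Qed.

Lemma dominant_next n : dominant (lambda + lambda *+ n).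
Proof. by rewrite -mulrS; exact: dominant_mulrn. Qed.

Lemma weight_nat_mulrn n k : weight_nat (lambda *+ n) k = lam k *+ n.
Proof. by rewrite /weight_nat ffunMnE. Qed.

Lemma weight_nat_next n : weight_nat (lambda + lambda *+ n) =
  (fun k => lam k + weight_nat (lambda *+ n) k).
Proof. by apply/funext => k; rewrite /weight_nat ffunE. Qed.

Lemma lam_cond : (forall k, (k < r)%N -> 0 < lam k) \/
  (forall k, (k < r)%N -> k != 0%N -> lam k = 0).
Proof.
case: lambda_cond => [reg|[m ->]]; [left | right] => k kr; first exact: reg.
by rewrite /weight_nat ffunMnE ffunE /= inordK // => /negbTE ->; rewrite mul0rn.
Qed.

Lemma large_n (p : R) d (e D : nat -> 'M[R[i]]_d) xi n : 0 < p ->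
  chevalley p%:C r e D ->
  highest_weight p r e D (weight_nat (lambda *+ n)) xi ->
  large_weight r n e (weight_nat (lambda *+ n)) xi.
Proof.
move=> p0 H hw; apply: (large_weight_multiple (lam := lam) (m := n) p0 H hw) => //.
- by move=> k _; exact: lambda_dom.
- by move=> k _; exact: weight_nat_mulrn.
- exact: lam_cond.
Qed.

Lemma large_next (p : R) d (e D : nat -> 'M[R[i]]_d) xi n : 0 < p ->
  chevalley p%:C r e D ->
  highest_weight p r e D (fun k => lam k + weight_nat (lambda *+ n) k) xi ->
  large_weight r n e (fun k => lam k + weight_nat (lambda *+ n) k) xi.
Proof.
move=> p0 H hw; apply: (large_weight_multiple (lam := lam) (m := n.+1) p0 H hw) => //.
- by move=> k _; exact: lambda_dom.
- by move=> k _; rewrite weight_nat_mulrn mulrS.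
- exact: lam_cond.
Qed.

Definition decays (p : R) (f : nat -> R) : Prop :=
  f @ \oo --> (0 : R) /\
  (1 < p -> exists2 c, 0 < c & forall n, f n <= c * p^-1 ^+ n).

Lemma highest_decay : 1 <= q ->
  decays q (fun n => opnorm ((1%:M - 1%:M *t Ph q (Vn n)) *m Ph_tens q Vl (Vn n))) /\
  decays q (fun n => opnorm (cartan_proj q Vl (Vn n) (Vx n) *m
    ((1%:M - Ph q Vl) *t Ph q (Vn n)))).
Proof.
move=> q1; have vl := V_simple lambda_dom.
have [lmod lstar _ _ _] := vl.
have [xiU mU] := mod_model q_gt0 lmod lstar vl.
have [HU hwU cycU glU hTh _] := mU.
(* [L] and [K] come from [V_lambda] alone and are fixed before [n]. *)
have [L [K ctl]] := controls_exist q1 HU hwU cycU glU hTh.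
have K0 : 0 <= K by case: ctl.
have B0 : 0 <= norm_const q r L K.
  by rewrite mulr_ge0 ?exprz_ge0 ?(ltW q_gt0) // mulr_ge0.
have key n : (L * 2 <= n)%N -> 0 < gap_const q r L n ->
  opnorm ((1%:M - 1%:M *t Ph q (Vn n)) *m Ph_tens q Vl (Vn n)) <=
    Num.sqrt (norm_const q r L K / gap_const q r L n) /\
  opnorm (cartan_proj q Vl (Vn n) (Vx n) *m ((1%:M - Ph q Vl) *t Ph q (Vn n))) <=
    Num.sqrt (norm_const q r L K / gap_const q r L n).
  move=> Ln g0; have vn := V_simple (dominant_mulrn n).
  have vx := V_simple (dominant_next n).
  have [nmod nstar _ _ _] := vn; have [xmod xstar _ _ _] := vx.
  have [xiW mW] := mod_model q_gt0 nmod nstar vn.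
  have [xiX mX] := mod_model q_gt0 xmod xstar vx.
  rewrite weight_nat_next in mX.
  apply: (norm_bounds q1 mU mW mX ctl) => //.
  - case: (orthoproj_cases (@killed_by_E R N (tens q Vl (Vn n)))) => h; [by left|].
    right; eexists; first exact: h.
    by move=> y hy k kr; rewrite -tens_E; exact: hy.
  - exact: mod_cartan_data.
  - exact: (large_n q_gt0 (model_chev mW) (model_hw mW)).
  - exact: (large_next q_gt0 (model_chev mX) (model_hw mX)).
split; apply: (gap_decay q1 B0) => [n|n Ln g0]; rewrite ?opnorm_ge0 //.
- by case: (key n Ln g0).
- by case: (key n Ln g0).
Qed.

Lemma lowest_decay : q <= 1 ->
  decays q^-1
    (fun n => opnorm ((1%:M - 1%:M *t Pl q (Vn n)) *m Pl_tens q Vl (Vn n))) /\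
  decays q^-1 (fun n => opnorm (cartan_proj q Vl (Vn n) (Vx n) *m
    ((1%:M - Pl q Vl) *t Pl q (Vn n)))).
Proof.
move=> q1; have vl := V_simple lambda_dom.
have qV1 : 1 <= q^-1 by rewrite invf_ge1.
have qV_gt0 : 0 < q^-1 by rewrite invr_gt0.
have [lmod lstar _ _ _] := vl.
have [xiU mU] := mod_model_dual q_gt0 lmod lstar vl.
have [HU hwU cycU glU hTh _] := mU.
have [L [K ctl]] := controls_exist qV1 HU hwU cycU glU hTh.
have K0 : 0 <= K by case: ctl.
have B0 : 0 <= norm_const q^-1 r L K.
  by rewrite mulr_ge0 ?exprz_ge0 ?(ltW qV_gt0) // mulr_ge0.
have gl := mod_grouplike q_gt0 lmod lstar.
have key n : (L * 2 <= n)%N -> 0 < gap_const q^-1 r L n ->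
  opnorm ((1%:M - 1%:M *t Pl q (Vn n)) *m Pl_tens q Vl (Vn n)) <=
    Num.sqrt (norm_const q^-1 r L K / gap_const q^-1 r L n) /\
  opnorm (cartan_proj q Vl (Vn n) (Vx n) *m ((1%:M - Pl q Vl) *t Pl q (Vn n))) <=
    Num.sqrt (norm_const q^-1 r L K / gap_const q^-1 r L n).
  move=> Ln g0; have vn := V_simple (dominant_mulrn n).
  have vx := V_simple (dominant_next n).
  have [nmod nstar _ _ _] := vn; have [xmod xstar _ _ _] := vx.
  have [xiW mW] := mod_model_dual q_gt0 nmod nstar vn.
  have [xiX mX] := mod_model_dual q_gt0 xmod xstar vx.
  rewrite weight_nat_next in mX.
  apply: (norm_bounds qV1 mU mW mX ctl) => //.
  - case: (orthoproj_cases (@killed_by_F R N (tens q Vl (Vn n)))) => h; [by left|].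
    right; eexists; first exact: h.
    move=> y hy k kr; rewrite (coprod_dual_e _ _ gl) // -scalemxAl.
    by rewrite (tens_killed_F q_gt0 lmod lstar nmod nstar) ?scaler0 // revi_lt.
  - case: (mod_cartan_data q_gt0 lmod lstar nmod nstar xmod xstar) => [|[S hS]].
      by left.
    by right; exists S; exact: cartan_data_dual.
  - exact: (large_n qV_gt0 (model_chev mW) (model_hw mW)).
  - exact: (large_next qV_gt0 (model_chev mX) (model_hw mX)).
split; apply: (gap_decay qV1 B0) => [n|n Ln g0]; rewrite ?opnorm_ge0 //.
- by case: (key n Ln g0).
- by case: (key n Ln g0).
Qed.

End Assembly.

Lemma decays_exp (R : realType) (p : R) (f g : nat -> R) : 1 < p ->
  decays p f -> decays p g ->
  exists c t : R, [/\ 0 < c, 0 < t, t < 1 &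
    forall n : nat, f n <= c * t ^+ n /\ g n <= c * t ^+ n].
Proof.
move=> p1 [_ /(_ p1)[c1 c10 h1]] [_ /(_ p1)[c2 c20 h2]].
have p0 : 0 < p by apply: lt_trans p1.
exists (c1 + c2), p^-1; split; rewrite ?invr_gt0 ?invf_lt1 ?addr_gt0 // => n.
have pn : 0 <= p^-1 ^+ n by rewrite exprn_ge0 // invr_ge0 ltW.
split; [apply: le_trans (h1 n) _ | apply: le_trans (h2 n) _];
  by rewrite ler_wpM2r // ?lerDl ?lerDr ltW.
Qed.

Theorem theorem3p9 (R : realType) (N : nat) (N_ge2 : (2 <= N)%N)
  (q : R) (q_gt0 : 0 < q)
  (V : weight N -> genops R N)
  (V_simple : forall mu : weight N, dominant mu -> is_Vmu q mu (V mu))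
  (lambda : weight N) (lambda_dom : dominant lambda)
  (lambda_cond : regular lambda \/ exists m : nat, lambda = omega1 N *+ m) :
  let Vl := V lambda in
  let Vn (n : nat) := V (lambda *+ n) in
  let f (n : nat) := cartan_proj q Vl (Vn n) (V (lambda + lambda *+ n)) in
  let normh1 (n : nat) :=
    opnorm ((1%:M - 1%:M *t Ph q (Vn n)) *m Ph_tens q Vl (Vn n)) in
  let normh2 (n : nat) :=
    opnorm (f n *m ((1%:M - Ph q Vl) *t Ph q (Vn n))) in
  let norml1 (n : nat) :=
    opnorm ((1%:M - 1%:M *t Pl q (Vn n)) *m Pl_tens q Vl (Vn n)) in
  let norml2 (n : nat) :=
    opnorm (f n *m ((1%:M - Pl q Vl) *t Pl q (Vn n))) in
  [/\ 1 <= q -> normh1 @ \oo --> (0 : R) /\ normh2 @ \oo --> (0 : R),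
      q <= 1 -> norml1 @ \oo --> (0 : R) /\ norml2 @ \oo --> (0 : R),
      1 < q -> exists c t : R, [/\ 0 < c, 0 < t, t < 1 &
        forall n : nat, normh1 n <= c * t ^+ n /\ normh2 n <= c * t ^+ n]
    & q < 1 -> exists c t : R, [/\ 0 < c, 0 < t, t < 1 &
        forall n : nat, norml1 n <= c * t ^+ n /\ norml2 n <= c * t ^+ n]].
Proof.
(* Writing [N] as [N'.+2] makes the index type of the simple roots visibly nonempty, as [inord]
   requires. *)
case: N N_ge2 V V_simple lambda lambda_dom lambda_cond => [|[|N']] // _.
move=> V V_simple lambda lambda_dom lambda_cond Vl Vn f normh1 normh2 norml1 norml2.
have hi := highest_decay q_gt0 V_simple lambda_dom lambda_cond.
have lo := lowest_decay q_gt0 V_simple lambda_dom lambda_cond.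
split.
- by move=> q1; have [[h1 _] [h2 _]] := hi q1; exact (conj h1 h2).
- by move=> q1; have [[h1 _] [h2 _]] := lo q1; exact (conj h1 h2).
- by move=> q1; have [h1 h2] := hi (ltW q1); exact: (decays_exp q1 h1 h2).
- move=> q1; have [h1 h2] := lo (ltW q1).
  have qV1 : 1 < q^-1 by rewrite invf_gt1.
  exact: (decays_exp qV1 h1 h2).
Qed.
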